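(* Assume (H1) (stated in the context), let $x\in\mathbb R^n$ and $u\in L^2_{\mathbb F}(0,T;\mathbb R^m)$. Let $Y_0$ solve $dY_0=-(A^\top+\tilde A^\top)Y_0ds$ on $[0,T]$, $Y_0(T)=-I_{n\times n}$. Then for any $t\in[0,T)$, with $X,\mathbf Y(\cdot,t),\mathbf Z(\cdot,t),\mathcal X,\mathcal M,\mathcal N$ the processes of the context, $$\lim_{\varepsilon\to0}\frac1\varepsilon\mathbb E_t\int_t^{t+\varepsilon}\Big[\mathcal B(s)^\top\big[Y_0(s)\gamma_1X(t)+\mathbf Y(s,t)\big]+\mathcal D(s)^\top\mathbf Z(s,t)\Big]ds=\lim_{\varepsilon\to0}\frac1\varepsilon\mathbb E_t\int_t^{t+\varepsilon}\Big[\mathcal B(s)^\top\big[Y_0(s)\gamma_1\mathcal X(s)+\mathcal M(s,s)\big]+\mathcal D(s)^\top\mathcal N(s)\Big]ds.$$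
   Context: Setting. $T>0$; $(\Omega,\mathcal F,\mathbb P,\mathbb F)$ is a complete filtered probability space, $\mathbb F=\{\mathcal F_t\}_{t\ge0}$ is the natural filtration of a one-dimensional standard Brownian motion $W$, augmented by all $\mathbb P$-null sets; $\mathbb E_t:=\mathbb E[\,\cdot\,|\mathcal F_t]$. Time arguments are often omitted. $\mathbb S^{k\times k}$: symmetric $k\times k$ real matrices. $L^\infty(0,T;H)$: deterministic measurable essentially bounded functions. $L^2_{\mathbb F}(s,t;H)$: $\mathbb F$-adapted measurable processes with $\mathbb E\int_s^t|X(r)|^2dr<\infty$. $L^2_{\mathbb F}(\Omega;L^1(s,t;H))$: adapted measurable processes with $\mathbb E[\int_s^t|X(r)|dr]^2<\infty$. $L^2_{\mathbb F}(\Omega;C([s,t];H))$: adapted continuous processes with $\mathbb E\sup_{r\in[s,t]}|X(r)|^2<\infty$. (H1): $A,\tilde A,C,\tilde C\in L^\infty(0,T;\mathbb R^{n\times n})$; $B,\tilde B,D,\tilde D\in L^\infty(0,T;\mathbb R^{n\times m})$; $Q,\tilde Q\in L^\infty(0,T;\mathbb S^{n\times n})$; $R,\tilde R\in L^\infty(0,T;\mathbb S^{m\times m})$; $G,\tilde G\in\mathbb S^{n\times n}$; $\gamma_1\in\mathbb R$, $\gamma_2\in\mathbb R^n$; $b\in L^2_{\mathbb F}(\Omega;L^1(0,T;\mathbb R^n))$; $\sigma\in L^2_{\mathbb F}(0,T;\mathbb R^n)$. Notation: $\mathcal A:=A+\tilde A$, $\mathcal B:=B+\tilde B$, $\mathcal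 C:=C+\tilde C$, $\mathcal D:=D+\tilde D$. For fixed $t$, the state $X$ (which depends on $t$) solves on $[0,T]$ $$dX=[AX+\tilde A\mathbb E_tX+Bu+\tilde B\mathbb E_tu+b]ds+[CX+\tilde C\mathbb E_tX+Du+\tilde D\mathbb E_tu+\sigma]dW(s),\quad X(0)=x,$$ while $\mathcal X$ (not depending on $t$) solves on $[0,T]$ $$d\mathcal X=[\mathcal A\mathcal X+\mathcal Bu+b]ds+[\mathcal C\mathcal X+\mathcal Du+\sigma]dW(s),\quad\mathcal X(0)=x.$$ $\mathcal P_1,\mathcal P_2,(\mathcal P_3,\mathcal L_3),(\mathcal P_4,\mathcal L_4)$ are the unique solutions on $[0,T]$ ($\mathcal P_1,\mathcal P_2$ deterministic continuous; $(\mathcal P_j,\mathcal L_j)\in L^2_{\mathbb F}(\Omega;C([0,T];\mathbb R^n))\times L^2_{\mathbb F}(0,T;\mathbb R^n)$, $j=3,4$) of $$\begin{aligned} d\mathcal P_1&=-(\mathcal P_1A+A^\top\mathcal P_1+C^\top\mathcal P_1C-Q)ds,\quad \mathcal P_1(T)=-G,\\ d\mathcal P_2&=-\{\mathcal P_2\mathcal A+\mathcal A^\top\mathcal P_2+\mathcal P_1\tilde A+\tilde A^\top\mathcal P_1+\tilde C^\top\mathcal P_1\mathcal C+C^\top\mathcal P_1\tilde C-\tilde Q\}ds,\quad \mathcal P_2(T)=-\tilde G,\\ d\mathcal P_3&=-[\mathcal A^\top\mathcal P_3+\tilde A^\top\mathcal P_4+\tilde C^\top\mathcal L_4+\mathcal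 P_1\tilde Bu+\mathcal P_2(\mathcal Bu+b)+\tilde C^\top\mathcal P_1(\mathcal Du+\sigma)+C^\top\mathcal P_1\tilde Du]ds+\mathcal L_3dW(s),\quad \mathcal P_3(T)=0,\\ d\mathcal P_4&=-\{A^\top\mathcal P_4+C^\top\mathcal L_4+\mathcal P_1(Bu+b)+C^\top\mathcal P_1(Du+\sigma)\}ds+\mathcal L_4dW(s),\quad \mathcal P_4(T)=-\gamma_2. \end{aligned}$$ For $0\le t\le s\le T$: $$\begin{aligned} \mathbf Y(s,t)&:=\mathcal P_1(s)X(s)+\mathcal P_2(s)\mathbb E_tX(s)+\mathbb E_t\mathcal P_3(s)+\mathcal P_4(s),\\ \mathbf Z(s,t)&:=\mathcal P_1(s)\big(C(s)X(s)+\tilde C(s)\mathbb E_tX(s)+D(s)u(s)+\tilde D(s)\mathbb E_tu(s)+\sigma(s)\big)+\mathcal L_4(s),\\ \mathcal M(s,t)&:=\mathcal P_1(s)\mathcal X(s)+\mathcal P_2(s)\mathbb E_t\mathcal X(s)+\mathbb E_t\mathcal P_3(s)+\mathcal P_4(s),\\ \mathcal N(s)&:=\mathcal P_1(s)\big(\mathcal C(s)\mathcal X(s)+\mathcal D(s)u(s)+\sigma(s)\big)+\mathcal L_4(s). \end{aligned}$$ *)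

(* Defs.v *)
From HB Require Import structures.
From mathcomp Require Import all_boot all_order all_algebra.
From mathcomp Require Import all_classical all_reals all_analysis.

Set Implicit Arguments.
Unset Strict Implicit.
Unset Printing Implicit Defensive.

Import Order.TTheory GRing.Theory Num.Theory.
Import numFieldNormedType.Exports.

Local Open Scope classical_set_scope.
Local Open Scope ring_scope.

(* Vectors of R^k are columns 'cV[R]_k = 'M[R]_(k, 1), so everything below is
   stated for matrix-valued functions and processes. `|_| is the library norm on
   matrices (largest absolute value of an entry); the spaces L^oo, L^2_F, etc.
   do not depend on the choice of the norm. *)

Definition mx_integrable (R : realType) (p q : nat) (D : set R)
    (f : R -> 'M[R]_(p, q)) : Prop :=
  forall i j, (@lebesgue_measure R).-integrable D (fun s => (f s i j)%:E).

Definition mx_integral (R : realType) (p q : nat) (D : set R)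
    (f : R -> 'M[R]_(p, q)) : 'M[R]_(p, q) :=
  \matrix_(i, j) Rintegral (@lebesgue_measure R) D (fun s => f s i j).

Definition Linfty (R : realType) (p q : nat) (T : R)
    (f : R -> 'M[R]_(p, q)) : Prop :=
  (forall i j, measurable_fun `[0, T] (fun s => f s i j)) /\
  (exists K : R, \forall s \ae (@lebesgue_measure R), 0 <= s <= T -> `|f s| <= K).

Definition Linfty_sym (R : realType) (p : nat) (T : R) (f : R -> 'M[R]_p) : Prop :=
  Linfty T f /\
  (\forall s \ae (@lebesgue_measure R), 0 <= s <= T -> (f s)^T = f s).

(* dY = beta ds on [0, T] *)
Definition differential (R : realType) (p q : nat) (T : R)
    (Y beta : R -> 'M[R]_(p, q)) : Prop :=
  [/\ {within `[0, T], continuous Y},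
      mx_integrable `[0, T] beta &
      forall s, 0 <= s <= T -> Y s = Y 0 + mx_integral `[0, s] beta].

Definition natural_filtration d (Omega : measurableType d) (R : realType)
    (W : R -> Omega -> R) (t : R) : set (set Omega) :=
  <<s [set A | exists r (B : set R),
         [/\ 0 <= r <= t, measurable B & A = W r @^-1` B] ] >>.

Definition augmented_filtration d (Omega : measurableType d) (R : realType)
    (P : probability Omega R) (W : R -> Omega -> R) (t : R) : set (set Omega) :=
  <<s natural_filtration W t `|` [set N | P.-negligible N] >>.

Definition standard_brownian_motion d (Omega : measurableType d) (R : realType)
    (P : probability Omega R) (W : R -> Omega -> R) : Prop :=
  [/\ forall t, 0 <= t -> measurable_fun setT (W t),
      \forall w \ae P, W 0 w = 0,
      \forall w \ae P, {within `[0, +oo[, continuous (fun t => W t w)},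
      (* the second parameter of normal_prob is the standard deviation *)
      forall (s t : R) (B : set R), 0 <= s < t -> measurable B ->
        P ((fun w => W t w - W s w) @^-1` B) = normal_prob 0 (Num.sqrt (t - s)) B &
      forall (s t : R) (A : set Omega) (B : set R), 0 <= s < t ->
        natural_filtration W s A -> measurable B ->
        P (A `&` (fun w => W t w - W s w) @^-1` B) =
        (P A * P ((fun w => W t w - W s w)%R @^-1` B))%E].

Definition measurable_wrt (Omega : Type) (R : realType)
    (G : set (set Omega)) (f : Omega -> R) : Prop :=
  forall B : set R, measurable B -> G (f @^-1` B).

Definition adapted_measurable d (Omega : measurableType d) (R : realType)
    (F : R -> set (set Omega)) (T : R) (p q : nat)
    (X : R -> Omega -> 'M[R]_(p, q)) : Prop :=
  forall i j,
    measurable_fun (`[0, T] `*` [set: Omega])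
      (fun sw : R * Omega => X sw.1 sw.2 i j) /\
    (forall s, 0 <= s <= T -> measurable_wrt (F s) (fun w => X s w i j)).

Definition continuous_paths d (Omega : measurableType d) (R : realType)
    (P : probability Omega R) (T : R) (p q : nat)
    (X : R -> Omega -> 'M[R]_(p, q)) : Prop :=
  \forall w \ae P, {within `[0, T], continuous (fun s => X s w)}.

Definition L2F d (Omega : measurableType d) (R : realType)
    (P : probability Omega R) (F : R -> set (set Omega)) (T : R) (p q : nat)
    (X : R -> Omega -> 'M[R]_(p, q)) : Prop :=
  adapted_measurable F T X /\
  (\int[P]_w \int[@lebesgue_measure R]_(s in `[0%R, T]) (`|X s w| ^+ 2)%:E
     < +oo)%E.

Definition L2F_L1 d (Omega : measurableType d) (R : realType)
    (P : probability Omega R) (F : R -> set (set Omega)) (T : R) (p q : nat)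
    (X : R -> Omega -> 'M[R]_(p, q)) : Prop :=
  adapted_measurable F T X /\
  (\int[P]_w ((\int[@lebesgue_measure R]_(s in `[0%R, T]) (`|X s w|)%:E) ^+ 2)
     < +oo)%E.

Definition L2F_C d (Omega : measurableType d) (R : realType)
    (P : probability Omega R) (F : R -> set (set Omega)) (T : R) (p q : nat)
    (X : R -> Omega -> 'M[R]_(p, q)) : Prop :=
  [/\ adapted_measurable F T X,
      continuous_paths P T X &
      (\int[P]_w ereal_sup [set (`|X s w| ^+ 2)%:E | s in `[0%R, T]] < +oo)%E].

Definition rv_integrable d (Omega : measurableType d) (R : realType)
    (P : probability Omega R) (p q : nat) (f : Omega -> 'M[R]_(p, q)) : Prop :=
  forall i j, P.-integrable setT (fun w => (f w i j)%:E).

(* g is a version of E[f | G] *)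
Definition is_condexp d (Omega : measurableType d) (R : realType)
    (P : probability Omega R) (G : set (set Omega)) (p q : nat)
    (f g : Omega -> 'M[R]_(p, q)) : Prop :=
  [/\ rv_integrable P f,
      rv_integrable P g,
      forall i j, measurable_wrt G (fun w => g w i j) &
      forall i j (A : set Omega), G A ->
        (\int[P]_(w in A) (g w i j)%:E = \int[P]_(w in A) (f w i j)%:E)%E].

(* V is an adapted measurable version of the process s |-> E_t[U(s)], t fixed.
   For U in L^2_F, the variable U(s) is integrable only for almost every s. *)
Definition condexp_process d (Omega : measurableType d) (R : realType)
    (P : probability Omega R) (F : R -> set (set Omega)) (T t : R) (p q : nat)
    (U V : R -> Omega -> 'M[R]_(p, q)) : Prop :=
  adapted_measurable F T V /\
  (forall s, 0 <= s <= T -> rv_integrable P (U s) ->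
     is_condexp P (F t) (U s) (V s)).

(* V t s is a version of E_t[U(s)]; measurability is required in s for each
   fixed t, and along the diagonal s = t. *)
Definition condexp_field d (Omega : measurableType d) (R : realType)
    (P : probability Omega R) (F : R -> set (set Omega)) (T : R) (p q : nat)
    (U : R -> Omega -> 'M[R]_(p, q)) (V : R -> R -> Omega -> 'M[R]_(p, q)) : Prop :=
  (forall t, 0 <= t <= T -> condexp_process P F T t U (V t)) /\
  adapted_measurable F T (fun s => V s s).

(* V e is a version of E_t[int_t^(t+e) f(s) ds], 0 < e <= T - t. Each V e is only
   determined up to a null set, so letting e -> 0 pathwise requires a selection
   that is almost surely continuous in e; it is unique up to
   indistinguishability. *)
Definition condexp_integral d (Omega : measurableType d) (R : realType)
    (P : probability Omega R) (F : R -> set (set Omega)) (T t : R) (p q : nat)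
    (f V : R -> Omega -> 'M[R]_(p, q)) : Prop :=
  (forall e, 0 < e <= T - t ->
     is_condexp P (F t) (fun w => mx_integral `[t, t + e] (fun s => f s w)) (V e)) /\
  (\forall w \ae P, {within `]0, T - t], continuous (fun e => V e w)}).

(* The process sum_(i < sp_size) sp_val i * 1_]sp_time i, sp_time i.+1] *)
Record simple_process (Omega : Type) (R : realType) := SimpleProcess {
  sp_size : nat;
  sp_time : nat -> R;
  sp_val : nat -> Omega -> R
}.

Definition simple_adapted (Omega : Type) (R : realType)
    (F : R -> set (set Omega)) (T : R) (h : simple_process Omega R) : Prop :=
  [/\ 0 <= sp_time h 0,
      sp_time h (sp_size h) <= T,
      forall i, (i < sp_size h)%N -> sp_time h i <= sp_time h i.+1,
      forall i, (i < sp_size h)%N -> measurable_wrt (F (sp_time h i)) (sp_val h i) &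
      forall i, (i < sp_size h)%N -> exists K : R, forall w, `|sp_val h i w| <= K].

Definition simple_eval (Omega : Type) (R : realType)
    (h : simple_process Omega R) (s : R) (w : Omega) : R :=
  \sum_(i < sp_size h)
     sp_val h i w * \1_(`]sp_time h i, sp_time h i.+1]%classic) s.

Definition simple_integral (Omega : Type) (R : realType) (W : R -> Omega -> R)
    (h : simple_process Omega R) (r : R) (w : Omega) : R :=
  \sum_(i < sp_size h)
     sp_val h i w *
     (W (Num.min (sp_time h i.+1) r) w - W (Num.min (sp_time h i) r) w).

(* I(r) = int_0^r H dW for r in [0, T]: a continuous version of the L^2(P) limit
   of the integrals of simple processes converging to H in L^2(dt x P). *)
Definition ito_integral d (Omega : measurableType d) (R : realType)
    (P : probability Omega R) (W : R -> Omega -> R) (T : R) (p q : nat)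
    (H I : R -> Omega -> 'M[R]_(p, q)) : Prop :=
  let F := augmented_filtration P W in
  [/\ L2F P F T H,
      adapted_measurable F T I,
      continuous_paths P T I &
      forall i j, exists h : nat -> simple_process Omega R,
        [/\ forall k, simple_adapted F T (h k),
            (fun k => \int[P]_w \int[@lebesgue_measure R]_(s in `[0%R, T])
               ((simple_eval (h k) s w - H s w i j) ^+ 2)%:E)%E @ \oo --> 0%E &
            forall r, 0 <= r <= T ->
              (fun k => \int[P]_w
                 ((simple_integral W (h k) r w - I r w i j) ^+ 2)%:E)%E
                @ \oo --> 0%E]].

(* dX = beta ds + zeta dW on [0, T] *)
Definition ito_differential d (Omega : measurableType d) (R : realType)
    (P : probability Omega R) (W : R -> Omega -> R) (T : R) (p q : nat)
    (X beta zeta : R -> Omega -> 'M[R]_(p, q)) : Prop :=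
  (\forall w \ae P, mx_integrable `[0, T] (fun s => beta s w)) /\
  (exists I : R -> Omega -> 'M[R]_(p, q),
     ito_integral P W T zeta I /\
     (\forall w \ae P, forall s, 0 <= s <= T ->
        X s w = X 0 w + mx_integral `[0, s] (fun r => beta r w) + I s w)).

(* The suffix t stands for a tilde; the coefficients cR, cRt are R and its tilde. *)
Record lq_data (Omega : Type) (R : realType) (n m : nat) := LQData {
  cA : R -> 'M[R]_n;       cAt : R -> 'M[R]_n;
  cC : R -> 'M[R]_n;       cCt : R -> 'M[R]_n;
  cB : R -> 'M[R]_(n, m);  cBt : R -> 'M[R]_(n, m);
  cD : R -> 'M[R]_(n, m);  cDt : R -> 'M[R]_(n, m);
  cQ : R -> 'M[R]_n;       cQt : R -> 'M[R]_n;
  cR : R -> 'M[R]_m;       cRt : R -> 'M[R]_m;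
  cG : 'M[R]_n;            cGt : 'M[R]_n;
  gamma1 : R;              gamma2 : 'cV[R]_n;
  cb : R -> Omega -> 'cV[R]_n;
  csigma : R -> Omega -> 'cV[R]_n
}.

Definition H1 d (Omega : measurableType d) (R : realType)
    (P : probability Omega R) (F : R -> set (set Omega)) (T : R) (n m : nat)
    (c : lq_data Omega R n m) : Prop :=
  [/\ [/\ Linfty T (cA c), Linfty T (cAt c), Linfty T (cC c) & Linfty T (cCt c)],
      [/\ Linfty T (cB c), Linfty T (cBt c), Linfty T (cD c) & Linfty T (cDt c)],
      [/\ Linfty_sym T (cQ c), Linfty_sym T (cQt c),
          Linfty_sym T (cR c) & Linfty_sym T (cRt c)],
      (cG c)^T = cG c /\ (cGt c)^T = cGt c &
      L2F_L1 P F T (cb c) /\ L2F P F T (csigma c)].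

(* sA, sB, sC, sD are the calligraphic letters. *)
Definition sA (Omega : Type) (R : realType) (n m : nat)
  (c : lq_data Omega R n m) (s : R) := cA c s + cAt c s.
Definition sB (Omega : Type) (R : realType) (n m : nat)
  (c : lq_data Omega R n m) (s : R) := cB c s + cBt c s.
Definition sC (Omega : Type) (R : realType) (n m : nat)
  (c : lq_data Omega R n m) (s : R) := cC c s + cCt c s.
Definition sD (Omega : Type) (R : realType) (n m : nat)
  (c : lq_data Omega R n m) (s : R) := cD c s + cDt c s.

(* EX and Eu stand for E_t X and E_t u; t enters the equation only through them. *)
Definition is_state d (Omega : measurableType d) (R : realType)
    (P : probability Omega R) (W : R -> Omega -> R) (T : R) (n m : nat)
    (c : lq_data Omega R n m) (x : 'cV[R]_n) (u Eu : R -> Omega -> 'cV[R]_m)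
    (X EX : R -> Omega -> 'cV[R]_n) : Prop :=
  [/\ L2F_C P (augmented_filtration P W) T X,
      \forall w \ae P, X 0 w = x &
      ito_differential P W T X
        (fun s w => cA c s *m X s w + cAt c s *m EX s w
                    + cB c s *m u s w + cBt c s *m Eu s w + cb c s w)
        (fun s w => cC c s *m X s w + cCt c s *m EX s w
                    + cD c s *m u s w + cDt c s *m Eu s w + csigma c s w)].

Definition is_cal_state d (Omega : measurableType d) (R : realType)
    (P : probability Omega R) (W : R -> Omega -> R) (T : R) (n m : nat)
    (c : lq_data Omega R n m) (x : 'cV[R]_n) (u : R -> Omega -> 'cV[R]_m)
    (cX : R -> Omega -> 'cV[R]_n) : Prop :=
  [/\ L2F_C P (augmented_filtration P W) T cX,
      \forall w \ae P, cX 0 w = x &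
      ito_differential P W T cX
        (fun s w => sA c s *m cX s w + sB c s *m u s w + cb c s w)
        (fun s w => sC c s *m cX s w + sD c s *m u s w + csigma c s w)].

Definition is_P1 (Omega : Type) (R : realType) (T : R) (n m : nat)
    (c : lq_data Omega R n m) (P1 : R -> 'M[R]_n) : Prop :=
  differential T P1
    (fun s => - (P1 s *m cA c s + (cA c s)^T *m P1 s
                 + (cC c s)^T *m P1 s *m cC c s - cQ c s)) /\
  P1 T = - cG c.

Definition is_P2 (Omega : Type) (R : realType) (T : R) (n m : nat)
    (c : lq_data Omega R n m) (P1 P2 : R -> 'M[R]_n) : Prop :=
  differential T P2
    (fun s => - (P2 s *m sA c s + (sA c s)^T *m P2 s
                 + P1 s *m cAt c s + (cAt c s)^T *m P1 s
                 + (cCt c s)^T *m P1 s *m sC c s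
                 + (cC c s)^T *m P1 s *m cCt c s - cQt c s)) /\
  P2 T = - cGt c.

Definition is_P4 d (Omega : measurableType d) (R : realType)
    (P : probability Omega R) (W : R -> Omega -> R) (T : R) (n m : nat)
    (c : lq_data Omega R n m) (u : R -> Omega -> 'cV[R]_m)
    (P1 : R -> 'M[R]_n) (P4 L4 : R -> Omega -> 'cV[R]_n) : Prop :=
  [/\ L2F_C P (augmented_filtration P W) T P4,
      L2F P (augmented_filtration P W) T L4,
      \forall w \ae P, P4 T w = - gamma2 c &
      ito_differential P W T P4
        (fun s w => - ((cA c s)^T *m P4 s w + (cC c s)^T *m L4 s w
                       + P1 s *m (cB c s *m u s w + cb c s w)
                       + (cC c s)^T *m P1 s *m (cD c s *m u s w + csigma c s w)))
        L4].

Definition is_P3 d (Omega : measurableType d) (R : realType)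
    (P : probability Omega R) (W : R -> Omega -> R) (T : R) (n m : nat)
    (c : lq_data Omega R n m) (u : R -> Omega -> 'cV[R]_m)
    (P1 P2 : R -> 'M[R]_n) (P4 L4 P3 L3 : R -> Omega -> 'cV[R]_n) : Prop :=
  [/\ L2F_C P (augmented_filtration P W) T P3,
      L2F P (augmented_filtration P W) T L3,
      \forall w \ae P, P3 T w = 0 &
      ito_differential P W T P3
        (fun s w => - ((sA c s)^T *m P3 s w + (cAt c s)^T *m P4 s w
                       + (cCt c s)^T *m L4 s w
                       + P1 s *m cBt c s *m u s w
                       + P2 s *m (sB c s *m u s w + cb c s w)
                       + (cCt c s)^T *m P1 s *m (sD c s *m u s w + csigma c s w)
                       + (cC c s)^T *m P1 s *m cDt c s *m u s w))
        L3].

Definition is_Y0 (Omega : Type) (R : realType) (T : R) (n m : nat)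
    (c : lq_data Omega R n m) (Y0 : R -> 'M[R]_n) : Prop :=
  differential T Y0 (fun s => - (((cA c s)^T + (cAt c s)^T) *m Y0 s)) /\
  Y0 T = - 1%:M.

(* EX and Eu are E_t X and E_t u for the fixed t; EcX t s and EP3 t s are
   E_t cX(s) and E_t P3(s). *)
Definition bold_Y (Omega : Type) (R : realType) (n : nat) (P1 P2 : R -> 'M[R]_n)
    (EP3 : R -> R -> Omega -> 'cV[R]_n) (P4 X EX : R -> Omega -> 'cV[R]_n)
    (s t : R) (w : Omega) : 'cV[R]_n :=
  P1 s *m X s w + P2 s *m EX s w + EP3 t s w + P4 s w.

Definition bold_Z (Omega : Type) (R : realType) (n m : nat)
    (c : lq_data Omega R n m) (P1 : R -> 'M[R]_n) (L4 : R -> Omega -> 'cV[R]_n)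
    (u Eu : R -> Omega -> 'cV[R]_m) (X EX : R -> Omega -> 'cV[R]_n)
    (s : R) (w : Omega) : 'cV[R]_n :=
  P1 s *m (cC c s *m X s w + cCt c s *m EX s w
           + cD c s *m u s w + cDt c s *m Eu s w + csigma c s w) + L4 s w.

Definition cal_M (Omega : Type) (R : realType) (n : nat) (P1 P2 : R -> 'M[R]_n)
    (EP3 : R -> R -> Omega -> 'cV[R]_n) (P4 cX : R -> Omega -> 'cV[R]_n)
    (EcX : R -> R -> Omega -> 'cV[R]_n)
    (s t : R) (w : Omega) : 'cV[R]_n :=
  P1 s *m cX s w + P2 s *m EcX t s w + EP3 t s w + P4 s w.

Definition cal_N (Omega : Type) (R : realType) (n m : nat)
    (c : lq_data Omega R n m) (P1 : R -> 'M[R]_n) (L4 : R -> Omega -> 'cV[R]_n)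
    (u : R -> Omega -> 'cV[R]_m) (cX : R -> Omega -> 'cV[R]_n)
    (s : R) (w : Omega) : 'cV[R]_n :=
  P1 s *m (sC c s *m cX s w + sD c s *m u s w + csigma c s w) + L4 s w.

(* Main.v *)
Require Import Defs.
From HB Require Import structures.
From mathcomp Require Import all_boot all_order all_algebra.
From mathcomp Require Import all_classical all_reals all_analysis.
From mathcomp Require Import measurable_realfun ring lra.

Set Implicit Arguments.
Unset Strict Implicit.
Unset Printing Implicit Defensive.

Import Order.TTheory GRing.Theory Num.Theory.
Import numFieldNormedType.Exports.

Local Open Scope classical_set_scope.
Local Open Scope ring_scope.

(* Write delta(e) for the difference of the two conditional integrals. Up to time
   t the equations of X and cX coincide, since E_t fixes what is known at t, so
   X(t) = cX(t) a.s. by uniqueness. For an event A in F_t the means of 1_A X(s)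
   and 1_A cX(s) solve the same linear equation on [t, T] and hence agree; as
   E_t and E_s are invisible to these means, only the term in Y0 survives and
   E[1_A delta(e)] = int_t^(t+e) gamma1 B^T Y0 (E[1_A cX(t)] - E[1_A cX(s)]) ds.
   It is bounded by e E[1_A K_h] for e <= h, where K_h is the integral over
   [t, t+h] of a constant times the drift of cX and E[K_h] -> 0 with h. A maximal
   inequality over rational e then gives delta(e) / e -> 0 almost surely. *)

(** * Gaussian moments and independence *)

(** Convergence of either quotient at a given t is not claimed, since control and coefficients are
    only measurable in time; what is proved is that the quotients differ by o(1), so that every
    candidate limit serves both or neither. The conditional expectations are versions, chosen
    separately at each time, which leaves no pathwise comparison of the two integrands. Testing
    against 1_A replaces each of them by an equality of numbers, and since F_t is contained in F_s
    for s >= t, the diagonal terms E_s disappear exactly as the terms E_t do. The resulting bound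
    has the form E[1_A K_h] with the same K_h for every A and every e <= h; this uniformity allows A
    to be the event of first exceedance. Continuity in e then leads from rational e to all e. The
    Ito integral is given only as an L^2 limit of simple integrals. Two facts are extracted from it:
    its increments after t have mean 0 on A, and second moments of differences are bounded by a
    constant times those of the integrands. The exact isometry is established for simple processes
    only; in the limit any constant is good enough, because Gronwall absorbs it. *)

Section normal_moments.
Context {R : realType}.
Local Notation mu := (@lebesgue_measure R).

Lemma measurable_EFin_normal_pdf (m s : R) :
  measurable_fun [set: R] (fun x => (normal_pdf m s x)%:E).
Proof. by apply/measurableT_comp => //=; exact: measurable_normal_pdf. Qed.

Lemma measurable_EFin_sqr : measurable_fun [set: R] (fun x => (x ^+ 2)%:E).
Proof. by apply/measurableT_comp => //=; exact: exprn_measurable. Qed.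

(** The Radon-Nikodym derivative of the normal law and [normal_pdf] have the same integral over
    every measurable set, hence agree almost everywhere. *)
Lemma ge0_integral_normal_prob (m s : R) (f : R -> \bar R) :
  measurable_fun [set: R] f -> (forall x, 0 <= f x)%E ->
  (\int[normal_prob m s]_x f x = \int[mu]_x (f x * (normal_pdf m s x)%:E))%E.
Proof.
move=> mf f0.
have dom := normal_prob_dominates m s.
rewrite -(Radon_Nikodym_SigmaFinite.change_of_variables dom)//=.
apply: ae_eq_integral => //.
- apply: emeasurable_funM => //; apply: (measurable_int mu).
  exact: Radon_Nikodym_SigmaFinite.f_integrable.
- apply: emeasurable_funM => //=; exact: measurable_EFin_normal_pdf.
apply: ae_eqe_mul2l => /=.
apply: integral_ae_eq => //=.
- exact: Radon_Nikodym_SigmaFinite.f_integrable.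
- by exact: measurable_EFin_normal_pdf.
- move=> E _ mE; rewrite -Radon_Nikodym_SigmaFinite.f_integral//.
Qed.

(** The density is even and Lebesgue measure is invariant under reflection. This symmetry is what
    later makes Brownian increments centred. *)
Lemma normal_prob0_opp (s : R) (B : set R) : s != 0 -> measurable B ->
  normal_prob 0 s (-%R @^-1` B) = normal_prob 0 s B.
Proof.
move=> s0 mB; rewrite /normal_prob.
transitivity (\int[pushforward mu (-%R : _ -> measurableTypeR R)]_(x in B) (normal_pdf 0 s x)%:E)%E.
  rewrite ge0_integral_pushforward; [|exact: oppr_measurable|exact: mB| |].
  - by apply: eq_integral => x _ /=; rewrite !normal_pdfE// /normal_fun !subr0 sqrrN.
  - by apply: measurable_funTS; exact: measurable_EFin_normal_pdf.
  - by move=> x _; rewrite lee_fin normal_pdf_ge0.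
by apply: eq_measure_integral => /= A mA _; exact: lebesgue_measureN.
Qed.

(* It equals 1, but serves only as a finite constant and is never evaluated. *)
Definition gauss_second_moment : \bar R :=
  (\int[normal_prob 0 1]_x (x ^+ 2)%:E)%E.

(** From 1 + y <= exp y at y = x^2 / 4 one gets x^2 exp(- x^2 / 2) <= 4 exp(- x^2 / 4). The right
    side is a multiple of the normal density with standard deviation sqrt 2, whose integral is 1;
    the constant [c] is 4 times the ratio of the two peaks. *)
Lemma gauss_second_moment_fin : (gauss_second_moment < +oo)%E.
Proof.
rewrite /gauss_second_moment ge0_integral_normal_prob//; last 2 first.
  by exact: measurable_EFin_sqr.
  by move=> x; rewrite lee_fin sqr_ge0.
have s20 : (Num.sqrt 2 : R) != 0 by rewrite gt_eqF// sqrtr_gt0.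
have p20 : 0 < normal_peak (Num.sqrt 2 : R) by rewrite normal_peak_gt0.
pose c : R := 4 * normal_peak 1 / normal_peak (Num.sqrt 2).
have c0 : 0 <= c by rewrite divr_ge0// ?mulr_ge0// ?normal_peak_ge0.
apply: (@le_lt_trans _ _ (\int[mu]_x (c%:E * (normal_pdf 0 (Num.sqrt 2) x)%:E))%E).
  apply: ge0_le_integral => //=.
  - by move=> x _; rewrite mule_ge0// lee_fin ?sqr_ge0 ?normal_pdf_ge0.
  - apply: emeasurable_funM; first exact: measurable_EFin_sqr.
    exact: measurable_EFin_normal_pdf.
  - by apply: measurable_funeM; exact: measurable_EFin_normal_pdf.
  move=> x _; rewrite -!EFinM lee_fin !normal_pdfE ?oner_neq0//.
  rewrite /normal_fun !subr0 expr1n sqr_sqrtr//.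
  rewrite /c mulrA [leRHS](_ : _ = normal_peak 1 * (4 * expR (- x ^+ 2 / (2 *+ 2)))); last first.
    by field; rewrite gt_eqF.
  rewrite -mulrA mulrCA ler_wpM2l// ?normal_peak_ge0//.
  rewrite (_ : - x ^+ 2 / (2 *+ 2) = - (x ^+ 2 / 4)); last by field.
  rewrite (_ : - x ^+ 2 / 2 = - (x ^+ 2 / 4) + - (x ^+ 2 / 4)); last by field.
  rewrite expRD mulrA ler_wpM2r ?expR_ge0// expRN.
  rewrite ler_pdivrMr ?expR_gt0//.
  have := expR_ge1Dx (x ^+ 2 / 4).
  have : 0 <= x ^+ 2 by exact: sqr_ge0.
  lra.
rewrite ge0_integralZl//.
- by rewrite integral_normal_pdf mule1 ltry.
- exact: measurable_EFin_normal_pdf.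
- by move=> x _; rewrite lee_fin normal_pdf_ge0.
Qed.

(** Substitution x -> x / s in the integral for the standard normal law. *)
Lemma normal_prob0_second_moment (s : R) : 0 < s ->
  (\int[normal_prob 0 s]_x (x ^+ 2)%:E = (s ^+ 2)%:E * gauss_second_moment)%E.
Proof.
move=> s0; have sn0 : s != 0 by rewrite gt_eqF.
rewrite /gauss_second_moment !ge0_integral_normal_prob//; last 4 first.
- by exact: measurable_EFin_sqr.
- by move=> x; rewrite lee_fin sqr_ge0.
- by exact: measurable_EFin_sqr.
- by move=> x; rewrite lee_fin sqr_ge0.
pose F (x : R^o) : R^o := x / s.
pose G (x : R) := x ^+ 2 * normal_pdf 0 1 x.
have dF x : derivable F x 1 by apply: derivableM.
have F'E : F^`()%classic = cst s^-1.
  apply/funext => x; rewrite /F derive1E deriveM// derive_cst scaler0 derive_id.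
  by rewrite add0r scaler1.
have cG : continuous G.
  move=> x; apply: cvgM; first exact: sqr_continuous.
  by apply: continuous_normal_pdf; rewrite oner_neq0.
rewrite [X in (_ * X)%E](_ : _ = \int[mu]_x (G x)%:E)%E; last first.
  by apply: eq_integral => x _; rewrite -EFinM.
rewrite (@increasing_ge0_integration_by_substitutionT _ F G); last first.
- by move=> x; rewrite mulr_ge0// ?sqr_ge0 ?normal_pdf_ge0.
- exact: cG.
- by apply/gt0_cvgMly; [rewrite invr_gt0|exact: cvg_id].
- by apply/gt0_cvgMlNy; [rewrite invr_gt0|exact: cvg_id].
- exact: dF.
- by rewrite F'E; exact: is_cvg_cst.
- by rewrite F'E; exact: is_cvg_cst.
- by rewrite F'E => ?; exact: cvg_cst.
- by move=> x y xy; rewrite /F ltr_pM2r// invr_gt0.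
rewrite -ge0_integralZl//; last 3 first.
- apply/measurableT_comp => //; rewrite F'E; apply: measurable_funM => //.
  apply: (@measurableT_comp _ _ _ _ _ _ G); last exact: measurable_funM.
  exact: continuous_measurable_fun.
- move=> x _; rewrite F'E lee_fin /= mulr_ge0// ?invr_ge0 ?(ltW s0)//.
  by rewrite mulr_ge0// ?sqr_ge0 ?normal_pdf_ge0.
- by rewrite lee_fin sqr_ge0.
apply: eq_integral => x _; rewrite -!EFinM; congr EFin.
rewrite F'E /= /G /F !normal_pdfE ?oner_neq0// /normal_fun !subr0 !expr1n.
have -> : normal_peak s = normal_peak 1 / s.
  rewrite /normal_peak expr1n mul1r -mulrnAr sqrtrM ?sqr_ge0// sqrtr_sqr gtr0_norm//.
  by rewrite invfM mulrC.
have -> : - x ^+ 2 / (s ^+ 2 *+ 2) = - (x / s) ^+ 2 / 2 by field.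
by rewrite !fctE /= subr0; field.
Qed.

End normal_moments.

Section independence.
Context {d : measure_display} {Omega : measurableType d} {R : realType}.
Variable P : probability Omega R.

(** Independence makes the joint law agree with the product of the two laws on rectangles, hence
    everywhere; Tonelli for |x y| then gives integrability and Fubini for x y gives the product
    formula. *)
Lemma indep_integrableM (X Y : Omega -> R) :
  measurable_fun setT X -> measurable_fun setT Y ->
  (forall A B : set R, measurable A -> measurable B ->
    P (X @^-1` A `&` Y @^-1` B) = (P (X @^-1` A) * P (Y @^-1` B))%E) ->
  P.-integrable setT (EFin \o X) -> P.-integrable setT (EFin \o Y) ->
  P.-integrable setT (fun w => (X w * Y w)%:E) /\
  (\int[P]_w (X w * Y w)%:E = \int[P]_w (X w)%:E * \int[P]_w (Y w)%:E)%E.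
Proof.
move=> mX mY XY iX iY.
pose X' : {RV P >-> R} := HB.pack X (isMeasurableFun.Build _ _ _ _ X mX).
pose Y' : {RV P >-> R} := HB.pack Y (isMeasurableFun.Build _ _ _ _ Y mY).
pose m1 : probability R R := distribution P X'.
pose m2 : probability R R := distribution P Y'.
pose XY' := fun w => (X w, Y w) : (R * R)%type.
have mXY : measurable_fun setT XY' by apply/measurable_fun_pairP; split.
pose m' := pushforward P XY'.
have m12 Z : measurable Z -> (m1 \x m2)%E Z = m' Z.
  apply: product_measure_unique => A B mA mB.
  by rewrite /m' /pushforward -XY.
have mM : measurable_fun setT (fun z : R * R => (z.1 * z.2)%:E).
  by apply/measurable_EFinP; apply: measurable_funM.
have E0 : (\int[P]_w `|(X w * Y w)%:E| = \int[m1 \x m2]_z `|(z.1 * z.2)%:E|)%E.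
  transitivity (\int[m']_z `|(z.1 * z.2)%:E|)%E.
    by rewrite ge0_integral_pushforward//; exact: measurableT_comp.
  by apply: eq_measure_integral => /= A mA _; exact: esym (m12 _ mA).
have E1 : (\int[P]_w `|(X w * Y w)%:E| = \int[P]_w `|(X w)%:E| * \int[P]_w `|(Y w)%:E|)%E.
  rewrite E0.
  rewrite fubini_tonelli1//; last exact: measurableT_comp.
  have Yc : (\int[m2]_y `|y%:E| = \int[P]_w `|(Y w)%:E|)%E.
    by rewrite ge0_integral_pushforward//; exact: measurableT_comp.
  have Xc : (\int[m1]_y `|y%:E| = \int[P]_w `|(X w)%:E|)%E.
    by rewrite ge0_integral_pushforward//; exact: measurableT_comp.
  rewrite -Xc -ge0_integralZr//; last 2 first.
  - exact: measurableT_comp.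
  - by rewrite integral_ge0.
  apply: eq_integral => x _; rewrite /fubini_F -Yc -ge0_integralZl//=.
  - by apply: eq_integral => y _; rewrite normrM EFinM.
  - exact: measurableT_comp.
have iXY : P.-integrable setT (fun w => (X w * Y w)%:E).
  apply/integrableP; split; first by apply/measurable_EFinP; exact: measurable_funM.
  move/integrableP : iX => [_ iX]; move/integrableP : iY => [_ iY].
  rewrite E1 lte_mul_pinfty// ?integral_ge0// ge0_fin_numE ?integral_ge0//.
split=> //.
have im12 : (m1 \x m2)%E.-integrable setT (fun z : R * R => (z.1 * z.2)%:E).
  apply/integrableP; split=> //; rewrite -E0.
  by move/integrableP : iXY => [].
have Yc : (\int[m2]_y y%:E = \int[P]_w (Y w)%:E)%E.
  by rewrite integral_pushforward.
have Xc : (\int[m1]_y y%:E = \int[P]_w (X w)%:E)%E.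
  by rewrite integral_pushforward.
transitivity (\int[m1 \x m2]_z (z.1 * z.2)%:E)%E.
  transitivity (\int[m']_z (z.1 * z.2)%:E)%E.
    by rewrite integral_pushforward.
  by apply: eq_measure_integral => /= A mA _; exact: esym (m12 _ mA).
rewrite -integral12_prod_meas1//=.
have fy : (\int[P]_w (Y w)%:E)%E \is a fin_num by exact: integrable_fin_num.
have im2 : m2.-integrable setT (EFin : R -> _).
  by apply: integrable_pushforward.
have im1 : m1.-integrable setT (EFin : R -> _).
  by apply: integrable_pushforward.
rewrite -Xc -(fineK fy) -integralZr//.
apply: eq_integral => x _; rewrite /fubini_F fineK// -Yc -integralZl//.
Qed.
End independence.

(** * The augmented Brownian filtration *)

Section filtration.
Context {d : measure_display} {Omega : measurableType d} {R : realType}.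
Variables (P : probability Omega R) (W : R -> Omega -> R).
Hypothesis cP : measure_is_complete P.
Hypothesis bm : standard_brownian_motion P W.

Local Notation F := (augmented_filtration P W).

Lemma natural_filtration_measurable t A :
  natural_filtration W t A -> measurable A.
Proof.
apply: smallest_sub; first exact: sigma_algebra_measurable.
move=> _ [r [B [/andP[r0 _] mB ->]]].
by have [mW _ _ _ _] := bm; rewrite -[X in measurable X]setTI; exact: mW.
Qed.

Lemma augmented_filtration_measurable t A : F t A -> measurable A.
Proof.
apply: smallest_sub; first exact: sigma_algebra_measurable.
by move=> B [/natural_filtration_measurable//|/cP].
Qed.

Lemma augmented_filtration_mono s t A : s <= t -> F s A -> F t A.
Proof.
move=> st; apply: sub_sigma_algebra2; apply: setSU; apply: sub_sigma_algebra2.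
move=> _ [r [C [/andP[r0 rs] mC ->]]].
by exists r, C; rewrite r0 (le_trans rs st).
Qed.

(** The sets that agree with a set of the natural filtration up to a negligible set form a
    sigma-algebra, and it contains both kinds of generators. This carries the independence of
    increments, postulated for the natural filtration, over to the augmented one. *)
Lemma augmented_filtration_approx t A : F t A ->
  exists2 B, natural_filtration W t B & P.-negligible ((A `\` B) `|` (B `\` A)).
Proof.
have sN := smallest_sigma_algebra setT ([set A | exists r (B : set R),
         [/\ 0 <= r <= t, measurable B & A = W r @^-1` B]]).
move: A; apply: smallest_sub.
  split.
  - exists set0; first by case: sN.
    by rewrite setD0 setU0; exact: negligible_set0.
  - move=> A [B nB AB]; exists (setT `\` B); first by case: sN => _ + _; exact.
    apply: negligibleS AB => w [] [[_ nA]] /=; first by move/not_andP => [|/contrapT]; [|right].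
    by move=> /not_andP[|/contrapT]; [|left].
  - move=> A /(_ _)/cid2-/all_sig2[B nB AB].
    exists (\bigcup_n B n); first by case: sN => _ _; exact.
    apply: (@negligibleS _ _ _ _ (\bigcup_n ((A n `\` B n) `|` (B n `\` A n)))).
      move=> w [] [[n _ Aw] nBw].
        by exists n => //; left; split => // Bw; apply: nBw; exists n.
      by exists n => //; right; split => // Aw'; apply: nBw; exists n.
    exact: negligible_bigcup.
move=> A [nA|nA]; first by exists A => //; rewrite setDv setU0; exact: negligible_set0.
exists set0; first by case: sN.
by rewrite setD0 set0D setU0.
Qed.

(** Replacing A by the event of the natural filtration from [augmented_filtration_approx] changes
    neither side. *)
Lemma augmented_filtration_indep s t A (B : set R) : 0 <= s < t ->
  F s A -> measurable B ->
  P (A `&` (fun w => W t w - W s w) @^-1` B) =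
  (P A * P ((fun w => (W t w - W s w)%R) @^-1` B))%E.
Proof.
move=> st FA mB; have [A' nA' AA'] := augmented_filtration_approx FA.
have [mW _ _ _ ind] := bm.
have mA := augmented_filtration_measurable FA.
have mA' := natural_filtration_measurable nA'.
have mZ : measurable ((fun w => W t w - W s w) @^-1` B).
  case/andP: st => s0 st.
  rewrite -[X in measurable X]setTI; apply: measurable_funB => //.
  - by apply: mW; rewrite (le_trans s0)// ltW.
  - exact: mW.
have PE C D : measurable C -> measurable D ->
    P.-negligible ((C `\` D) `|` (D `\` C)) -> P C = P D.
  move=> mC mD /[dup] nCD /cP mCD.
  have eqp := measure_negligible mCD nCD.
  have le X Y : measurable X -> measurable Y -> (X `\` Y `<=` (C `\` D) `|` (D `\` C)) ->
      (P X <= P Y)%E.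
    move=> mX mY XY.
    apply: (@le_trans _ _ (P (Y `|` ((C `\` D) `|` (D `\` C))))).
      apply: le_measure; rewrite ?inE//; first exact: measurableU.
      by move=> w Xw; have [Yw|nYw] := pselect (Y w); [left|right; exact: XY].
    by apply: (le_trans (measureU2 _ _ _)) => //; rewrite eqp adde0.
  by apply/eqP; rewrite eq_le; apply/andP; split; apply: le.
rewrite (PE A A')// -ind//; apply: PE; [exact: measurableI|exact: measurableI|].
by apply: negligibleS AA' => w [] [[? ?]] /= /not_andP[]; tauto.
Qed.

End filtration.

(** * Integrable and square integrable random variables *)

Section square_integrable.
Context {d : measure_display} {Omega : measurableType d} {R : realType}.
Variable P : probability Omega R.
Implicit Types f g : Omega -> R.

Definition L1 f := P.-integrable setT (EFin \o f).
Definition L2 f := measurable_fun setT f /\ L1 (fun w => f w ^+ 2).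
Definition Ex f : R := Rintegral P setT f.

Lemma L1_measurable f : L1 f -> measurable_fun setT f.
Proof. by move=> /measurable_int /measurable_EFinP. Qed.

Lemma L1_le f g : measurable_fun setT f -> (forall w, `|f w| <= g w) -> L1 g -> L1 f.
Proof.
move=> mf fg; apply: le_integrable => //; first exact/measurable_EFinP.
by move=> w _; rewrite /= lee_fin (le_trans (fg w))// ler_norm.
Qed.

Lemma L1D f g : L1 f -> L1 g -> L1 (fun w => f w + g w).
Proof. by move=> f1 g1; exact: (integrableD measurableT f1 g1). Qed.

Lemma L1B f g : L1 f -> L1 g -> L1 (fun w => f w - g w).
Proof. by move=> f1 g1; exact: (integrableB measurableT f1 g1). Qed.

Lemma L1Z c f : L1 f -> L1 (fun w => c * f w).
Proof. by move=> f1; exact: (integrableZl measurableT c f1). Qed.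

Lemma L1_sum (I : Type) (r : seq I) (Q : pred I) (f : I -> Omega -> R) :
  (forall i, Q i -> L1 (f i)) -> L1 (fun w => \sum_(i <- r | Q i) f i w).
Proof.
move=> fi; rewrite /L1 [X in integrable _ _ X](_ : _ =
  (fun w => \sum_(i <- r | Q i) (f i w)%:E)%E); first exact: integrable_sum.
by apply/funext => w /=; rewrite sumEFin.
Qed.

Lemma L1_cst c : L1 (fun=> c).
Proof. exact: finite_measure_integrable_cst. Qed.

Lemma L1M_bounded f g K : measurable_fun setT f -> (forall w, `|f w| <= K) ->
  L1 g -> L1 (fun w => f w * g w).
Proof.
move=> mf fK g1; apply: (@L1_le _ (fun w => K * `|g w|)).
- by apply: measurable_funM => //; exact: L1_measurable.
- by move=> w; rewrite normrM ler_wpM2r.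
- by apply: L1Z; exact: integrable_norm.
Qed.

Lemma L2M f g : L2 f -> L2 g -> L1 (fun w => f w * g w).
Proof.
move=> [mf f2] [mg g2]; apply: (@L1_le _ (fun w => f w ^+ 2 + g w ^+ 2)).
- exact: measurable_funM.
- move=> w; rewrite normrM -(real_normK (num_real (f w))) -(real_normK (num_real (g w))).
  by have := sqr_ge0 (`|f w| - `|g w|); have := normr_ge0 (f w); have := normr_ge0 (g w); nra.
- exact: L1D.
Qed.

Lemma L2_L1 f : L2 f -> L1 f.
Proof.
move=> [mf f2]; apply: (@L1_le _ (fun w => 1 + f w ^+ 2)) => //.
  move=> w; rewrite -(real_normK (num_real (f w))).
  by have := normr_ge0 (f w); have := sqr_ge0 (`|f w| - 1); nra.
by apply: L1D => //; exact: L1_cst.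
Qed.

Lemma L2D f g : L2 f -> L2 g -> L2 (fun w => f w + g w).
Proof.
move=> f2 g2; split; first by case: f2 g2 => mf _ [mg _]; exact: measurable_funD.
rewrite (_ : (fun w => _) = fun w => f w ^+ 2 + (2 * (f w * g w) + g w ^+ 2)); last first.
  by apply/funext => w; ring.
by apply: L1D; [exact: f2.2|apply: L1D; [apply/L1Z/L2M|exact: g2.2]].
Qed.

Lemma L2M_bounded f g K : measurable_fun setT f -> (forall w, `|f w| <= K) ->
  L2 g -> L2 (fun w => f w * g w).
Proof.
move=> mf fK [mg g2]; split; first exact: measurable_funM.
rewrite (_ : (fun w => _) = fun w => f w ^+ 2 * g w ^+ 2); last first.
  by apply/funext => w; rewrite exprMn.
apply: (@L1M_bounded _ _ (K ^+ 2)) => //; first exact: measurable_funX.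
by move=> w; rewrite normrX lerXn2r// nnegrE (le_trans _ (fK w)).
Qed.

Lemma L2Z c f : L2 f -> L2 (fun w => c * f w).
Proof. by move=> f2; apply: (@L2M_bounded _ _ `|c|). Qed.

Lemma L2B f g : L2 f -> L2 g -> L2 (fun w => f w - g w).
Proof.
move=> f2 g2; rewrite (_ : (fun w => _) = fun w => f w + (-1) * g w); last first.
  by apply/funext => w; rewrite mulN1r.
by apply: L2D => //; exact: L2Z.
Qed.

Lemma L2_cst c : L2 (fun=> c).
Proof. by split => //; exact: L1_cst. Qed.

Lemma L2_sum (I : Type) (r : seq I) (Q : pred I) (f : I -> Omega -> R) :
  (forall i, Q i -> L2 (f i)) -> L2 (fun w => \sum_(i <- r | Q i) f i w).
Proof.
move=> f2; elim: r => [|i r IH].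
  rewrite (_ : (fun w => _) = fun=> 0); first exact: L2_cst.
  by apply/funext => w; rewrite big_nil.
rewrite (_ : (fun w => _) = fun w => (if Q i then f i w else 0) +
   \sum_(i <- r | Q i) f i w); last first.
  by apply/funext => w; rewrite big_cons; case: ifP => // _; rewrite add0r.
by apply: L2D => //; case: (Q i) (f2 i) => [/(_ isT)|_] //; exact: L2_cst.
Qed.

Lemma ExD f g : L1 f -> L1 g -> Ex (fun w => f w + g w) = Ex f + Ex g.
Proof. by move=> f1 g1; exact: (RintegralD measurableT f1 g1). Qed.

Lemma ExB f g : L1 f -> L1 g -> Ex (fun w => f w - g w) = Ex f - Ex g.
Proof. by move=> f1 g1; exact: (RintegralB measurableT f1 g1). Qed.

Lemma ExZ c f : L1 f -> Ex (fun w => c * f w) = c * Ex f.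
Proof. by move=> f1; exact: (RintegralZl c measurableT f1). Qed.

Lemma Ex_cst c : Ex (fun=> c) = c.
Proof. by rewrite /Ex Rintegral_cst//; have /= -> := probability_setT P; rewrite mulr1. Qed.

Lemma Ex_sum (I : Type) (r : seq I) (f : I -> Omega -> R) :
  (forall i, L1 (f i)) -> Ex (fun w => \sum_(i <- r) f i w) = \sum_(i <- r) Ex (f i).
Proof.
move=> f1; elim: r => [|i r IH].
  rewrite big_nil (_ : (fun w => _) = cst 0); last by apply/funext => w; rewrite big_nil.
  by rewrite /Ex Rintegral_cst// mul0r.
rewrite big_cons -IH -ExD//; last exact: L1_sum.
by congr Ex; apply/funext => w; rewrite big_cons.
Qed.

Lemma ExE f : L1 f -> (\int[P]_w (f w)%:E = (Ex f)%:E)%E.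
Proof. by move=> f1; rewrite /Ex /Rintegral fineK//; exact: integrable_fin_num. Qed.

Lemma le_Ex f g : L1 f -> L1 g -> (forall w, f w <= g w) -> Ex f <= Ex g.
Proof. by move=> f1 g1 fg; apply: le_Rintegral. Qed.

End square_integrable.

(** * Brownian increments and the isometry for simple processes *)

Section brownian_increments.
Context {d : measure_display} {Omega : measurableType d} {R : realType}.
Variables (P : probability Omega R) (W : R -> Omega -> R).

Local Notation F := (augmented_filtration P W).
Local Notation G t := (natural_filtration W t `|` [set N | P.-negligible N]).
Implicit Types f g : Omega -> R.

(** Turns [measurable_wrt] into measurability for the generated sigma-algebra as a measurable space,
    where the closure properties of measurable functions are at hand. *)
Lemma measurable_wrtP t f : measurable_wrt (F t) f <->
  measurable_fun (setT : set (g_sigma_algebraType (G t)))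
    (f : g_sigma_algebraType (G t) -> R).
Proof.
split=> [mf _ B mB|mf B mB]; first by rewrite setTI; exact: mf.
by rewrite -[_ @^-1` _]setTI; exact: mf.
Qed.

Lemma measurable_wrt_cst t (c : R) : measurable_wrt (F t) (fun=> c).
Proof. by apply/measurable_wrtP. Qed.

Lemma measurable_wrtB t f g : measurable_wrt (F t) f -> measurable_wrt (F t) g ->
  measurable_wrt (F t) (fun w => f w - g w).
Proof. by move=> /measurable_wrtP ? /measurable_wrtP ?; apply/measurable_wrtP; exact: measurable_funB. Qed.

Lemma measurable_wrtM t f g : measurable_wrt (F t) f -> measurable_wrt (F t) g ->
  measurable_wrt (F t) (fun w => f w * g w).
Proof. by move=> /measurable_wrtP ? /measurable_wrtP ?; apply/measurable_wrtP; exact: measurable_funM. Qed.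

Lemma measurable_wrt_indic t A : F t A -> measurable_wrt (F t) (\1_A : Omega -> R).
Proof.
by move=> FA; apply/measurable_wrtP; exact: (@measurable_indic _ (g_sigma_algebraType (G t))).
Qed.

Hypothesis cP : measure_is_complete P.
Hypothesis bm : standard_brownian_motion P W.

Lemma measurable_wrt_measurable t f : measurable_wrt (F t) f -> measurable_fun setT f.
Proof.
move=> mf _ B mB; rewrite setTI.
exact: (augmented_filtration_measurable cP bm (mf _ mB)).
Qed.

Lemma measurable_wrt_mono s t f : s <= t -> measurable_wrt (F s) f -> measurable_wrt (F t) f.
Proof. by move=> st mf B mB; exact: augmented_filtration_mono st (mf _ mB). Qed.

Lemma measurable_wrt_bm s t : 0 <= s <= t -> measurable_wrt (F t) (W s).
Proof. by move=> st B mB; apply: sub_sigma_algebra; left; apply: sub_sigma_algebra; exists s, B. Qed.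

Definition incr s t w := W t w - W s w.

Lemma measurable_bm s : 0 <= s -> measurable_fun setT (W s).
Proof. by case: bm => mW _ _ _ _; exact: mW. Qed.

Lemma measurable_incr s t : 0 <= s <= t -> measurable_fun setT (incr s t).
Proof.
move=> /andP[s0 st]; apply: measurable_funB; apply: measurable_bm => //.
exact: le_trans st.
Qed.

Lemma measurable_wrt_incr s t r : 0 <= s <= t -> t <= r -> measurable_wrt (F r) (incr s t).
Proof.
move=> /andP[s0 st] tr; apply: measurable_wrtB; apply: measurable_wrt_bm.
  by rewrite (le_trans s0).
by rewrite s0 (le_trans st).
Qed.

Lemma incr_law s t (f : R -> \bar R) : 0 <= s < t -> measurable_fun setT f ->
  (forall x, 0 <= f x)%E ->
  (\int[P]_w f (incr s t w) = \int[normal_prob 0 (Num.sqrt (t - s))]_x f x)%E.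
Proof.
move=> st mf f0; have [_ _ _ law _] := bm.
have mi : measurable_fun setT (incr s t).
  by case/andP: st => ? /ltW ?; apply: measurable_incr; apply/andP.
transitivity (\int[pushforward P (incr s t : _ -> measurableTypeR R)]_x f x)%E.
  by rewrite ge0_integral_pushforward.
by apply: eq_measure_integral => /= A mA _; exact: law.
Qed.

Local Notation kappa := (fine (@gauss_second_moment R)).

Lemma gauss_second_moment_ge0 : 0 <= kappa.
Proof. by apply: fine_ge0; apply: integral_ge0 => x _; rewrite lee_fin sqr_ge0. Qed.

Lemma incr_second_moment s t : 0 <= s <= t ->
  (\int[P]_w (incr s t w ^+ 2)%:E = (kappa * (t - s))%:E)%E.
Proof.
move=> /andP[s0]; rewrite le_eqVlt => /predU1P[<-|st].
  rewrite subrr mulr0 integral0_eq// => w _.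
  by rewrite /incr subrr expr0n.
rewrite (@incr_law _ _ (fun x => (x ^+ 2)%:E)) ?s0//; last 2 first.
- by apply/measurable_EFinP; exact: exprn_measurable.
- by move=> x; rewrite lee_fin sqr_ge0.
rewrite normal_prob0_second_moment ?sqrtr_gt0 ?subr_gt0// sqr_sqrtr ?subr_ge0 ?ltW//.
rewrite muleC EFinM fineK// ge0_fin_numE ?gauss_second_moment_fin//.
by apply: integral_ge0 => x _; rewrite lee_fin sqr_ge0.
Qed.

Lemma incr_L2 s t : 0 <= s <= t -> L2 P (incr s t).
Proof.
move=> st; split; first exact: measurable_incr.
apply/integrableP; split.
  by apply/measurable_EFinP/measurable_funX; exact: measurable_incr.
under eq_integral do rewrite /= ger0_norm ?sqr_ge0//.
by rewrite incr_second_moment// ltry.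
Qed.

(** The increment and its opposite have the same law, so the mean equals its own opposite. *)
Lemma incr_mean0 s t : 0 <= s <= t -> (\int[P]_w (incr s t w)%:E = 0)%E.
Proof.
move=> /andP[s0]; rewrite le_eqVlt => /predU1P[<-|st].
  by rewrite integral0_eq// => w _; rewrite /incr subrr.
have st' : 0 <= s <= t by rewrite s0 ltW.
have i1 := L2_L1 (incr_L2 st').
have mi := measurable_incr st'.
have [_ _ _ law _] := bm.
have mNi : measurable_fun setT (fun w => - incr s t w) by exact: measurableT_comp.
have Np : (\int[P]_w (- incr s t w)%R%:E = \int[P]_w (incr s t w)%:E)%E.
  transitivity (\int[pushforward P (fun w => (- incr s t w)%R : measurableTypeR R)]_x x%:E)%E.
    rewrite integral_pushforward//.
    rewrite preimage_setT; apply: eq_integrable (L1Z (-1) i1) => // w _ /=.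
    by rewrite mulN1r.
  transitivity (\int[pushforward P (incr s t : _ -> measurableTypeR R)]_x x%:E)%E.
    apply: eq_measure_integral => /= A mA _.
    rewrite /pushforward [RHS]law ?s0//.
    rewrite -normal_prob0_opp ?gt_eqF ?sqrtr_gt0 ?subr_gt0//.
    rewrite -[RHS]law ?s0//.
    by rewrite -[X in measurable X]setTI; exact: oppr_measurable.
  by rewrite integral_pushforward.
have : (- Ex P (incr s t)) = Ex P (incr s t).
  apply: EFin_inj; rewrite -[RHS]ExE// -Np EFinN -ExE//.
  rewrite -integralN//.
  by apply: integrable_add_def.
move=> h; rewrite ExE//; congr EFin; lra.
Qed.

Lemma incr_indepM s t f (q : R -> R) : 0 <= s < t -> measurable_wrt (F s) f ->
  measurable_fun setT q -> L1 P f -> L1 P (fun w => q (incr s t w)) ->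
  L1 P (fun w => f w * q (incr s t w)) /\
  Ex P (fun w => f w * q (incr s t w)) = Ex P f * Ex P (fun w => q (incr s t w)).
Proof.
move=> st Ff mq f1 q1.
have mq' : measurable_fun setT (fun w => q (incr s t w)) by exact: (L1_measurable q1).
have [|i1 e1] := @indep_integrableM _ _ _ P f (fun w => q (incr s t w))
    (L1_measurable f1) mq' _ f1 q1.
  move=> A B mA mB.
  have mqB : measurable (q @^-1` B).
    by rewrite -[X in measurable X]setTI; exact: mq.
  exact: (augmented_filtration_indep cP bm st (Ff _ mA) mqB).
split=> //; apply: EFin_inj.
by rewrite -ExE// e1 !ExE.
Qed.

(** The conditional mean and variance of the increment given F_s, in tested form: [incr_indepM] with
    the identity and with the square. The degenerate case s = t is included so that capped steps
    need no special treatment. *)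
Lemma incr_mulE s t f : 0 <= s <= t -> measurable_wrt (F s) f -> L1 P f ->
  [/\ L1 P (fun w => f w * incr s t w), Ex P (fun w => f w * incr s t w) = 0,
      L1 P (fun w => f w * incr s t w ^+ 2) &
      Ex P (fun w => f w * incr s t w ^+ 2) = kappa * (t - s) * Ex P f].
Proof.
move=> /[dup] st' /andP[s0]; rewrite le_eqVlt => /predU1P[E|st] Ff f1.
  have E1 : (fun w => f w * incr s t w) = fun=> 0.
    by apply/funext => w; rewrite /incr E subrr mulr0.
  have E2 : (fun w => f w * incr s t w ^+ 2) = fun=> 0.
    by apply/funext => w; rewrite /incr E subrr expr0n mulr0.
  have E0 : Ex P (fun=> 0) = 0 by rewrite /Ex Rintegral_cst// mul0r.
  by rewrite E1 E2 E subrr mulr0 mul0r E0; split=> //; exact: L1_cst.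
have i2 := incr_L2 st'.
have st2 : 0 <= s < t by rewrite s0.
have [//|i1 e1] := @incr_indepM s t f id st2 Ff _ f1 (L2_L1 i2).
have [|j1 e2] := @incr_indepM s t f (fun x => x ^+ 2) st2 Ff _ f1 i2.2.
  exact: exprn_measurable.
have E0 : Ex P (incr s t) = 0.
  by apply: EFin_inj; rewrite -ExE ?incr_mean0//; exact: L2_L1.
have E2 : Ex P (fun w => incr s t w ^+ 2) = kappa * (t - s).
  by apply: EFin_inj; rewrite -ExE ?incr_second_moment//; exact: i2.2.
by split => //; [rewrite e1 E0 mulr0|rewrite e2 E2 mulrC].
Qed.

End brownian_increments.

Section simple_integrals.
Context {d : measure_display} {Omega : measurableType d} {R : realType}.
Variables (P : probability Omega R) (W : R -> Omega -> R).
Hypothesis cP : measure_is_complete P.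
Hypothesis bm : standard_brownian_motion P W.

Local Notation F := (augmented_filtration P W).
Local Notation kappa := (fine (@gauss_second_moment R)).

Definition bounded_wrt s (f : Omega -> R) :=
  measurable_wrt (F s) f /\ exists K, forall w, `|f w| <= K.

(** The length of the intersection of ]a, b] and ]a', b']. *)
Definition overlap (a b a' b' : R) := Num.max 0 (Num.min b b' - Num.max a a').

Lemma overlapC a b a' b' : overlap a b a' b' = overlap a' b' a b.
Proof. by rewrite /overlap minC (maxC a). Qed.

Lemma bounded_wrtM s f g : bounded_wrt s f -> bounded_wrt s g ->
  bounded_wrt s (fun w => f w * g w).
Proof.
move=> [mf [K fK]] [mg [K' gK]]; split; first exact: measurable_wrtM.
exists (K * K') => w; rewrite normrM.
by apply: ler_pM.
Qed.

Lemma bounded_wrt_mono s t f : s <= t -> bounded_wrt s f -> bounded_wrt t f.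
Proof. by move=> st [mf bf]; split => //; exact: measurable_wrt_mono st mf. Qed.

Lemma bounded_wrt_L2M s f g : bounded_wrt s f -> L2 P g -> L2 P (fun w => f w * g w).
Proof.
move=> [mf [K fK]] g2; apply: (L2M_bounded _ fK g2).
exact: (measurable_wrt_measurable cP bm mf).
Qed.

Lemma bounded_wrt_L2 s f : bounded_wrt s f -> L2 P f.
Proof.
move=> bf; rewrite (_ : f = fun w => f w * 1).
  by apply: (bounded_wrt_L2M bf); exact: L2_cst.
by apply/funext => w; rewrite mulr1.
Qed.

Lemma bounded_wrt_L1 s f : bounded_wrt s f -> L1 P f.
Proof. by move=> /bounded_wrt_L2 /L2_L1. Qed.

(** If b <= a', everything but the second increment is known at a', and that increment is centred.
    Otherwise, with c the smaller and e the larger of b and b', the product of increments splits as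
    [a,a'] [a',b'] + [a',c]^2 + [a',c] [c,e]; both mixed terms end in a centred independent factor,
    and the square yields the overlap c - a'. *)
Lemma incr_cross_le a b a' b' f f' : 0 <= a -> a <= b -> a' <= b' -> a <= a' ->
  bounded_wrt a f -> bounded_wrt a' f' ->
  Ex P (fun w => (f w * incr W a b w) * (f' w * incr W a' b' w)) =
  kappa * overlap a b a' b' * Ex P (fun w => f w * f' w).
Proof.
move=> a0 ab ab' aa' bf bf'.
have a'0 : 0 <= a' := le_trans a0 aa'.
have bff' := bounded_wrtM (bounded_wrt_mono aa' bf) bf'.
have centered p q r (h : Omega -> R) : 0 <= r -> r <= p -> p <= q ->
    forall s (g : Omega -> R), s <= p -> bounded_wrt s g ->
    Ex P (fun w => (g w * incr W r p w) * incr W p q w) = 0.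
  move=> r0 rp pq s g sp bg.
  have rp0 : 0 <= r <= p by rewrite r0.
  have pq0 : 0 <= p <= q by rewrite (le_trans r0 rp).
  have [] // := incr_mulE cP bm pq0 (f := fun w => g w * incr W r p w).
    apply: measurable_wrtM; first by apply: measurable_wrt_mono bg.1.
    exact: measurable_wrt_incr.
  by apply: L2_L1; apply: (bounded_wrt_L2M bg); exact: incr_L2.
have [ba'|a'b] := leP b a'.
  rewrite /overlap (max_idPr aa') (_ : Num.max _ _ = 0); last first.
    by apply/max_idPl; rewrite subr_le0 ge_min ba'.
  rewrite mulr0 mul0r.
  have ab0 : 0 <= a <= b by rewrite a0.
  have a'b'0 : 0 <= a' <= b' by rewrite a'0.
  have [||_ + _ _] := incr_mulE cP bm a'b'0 (f := fun w => f w * f' w * incr W a b w).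
  - by apply: measurable_wrtM; [exact: bff'.1|exact: measurable_wrt_incr].
  - by apply: L2_L1; apply: (bounded_wrt_L2M bff'); exact: incr_L2.
  by move=> <-; congr Ex; apply/funext => w; ring.
pose c := Num.min b b'; pose e := Num.max b b'.
have a'c : a' <= c by rewrite le_min (ltW a'b).
have ce : c <= e by rewrite ge_min !le_max lexx.
have -> : overlap a b a' b' = c - a'.
  by rewrite /overlap (max_idPr aa'); apply/max_idPr; rewrite subr_ge0.
have E w : (f w * incr W a b w) * (f' w * incr W a' b' w) =
    f w * f' w * incr W a a' w * incr W a' b' w
    + (f w * f' w * incr W a' c w ^+ 2 + f w * f' w * incr W a' c w * incr W c e w).
  rewrite /incr /c /e; have [bb'|bb'] := leP b b'; ring.
have I p q : 0 <= p -> p <= q -> L2 P (incr W p q).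
  by move=> p0 pq; apply: incr_L2 => //; rewrite p0.
have i1 : L1 P (fun w => f w * f' w * incr W a a' w * incr W a' b' w).
  by apply: L2M; [apply: (bounded_wrt_L2M bff')|]; exact: I.
have a'c0 : 0 <= a' <= c by rewrite a'0.
have [_ _ i2 e2] := incr_mulE cP bm a'c0 bff'.1 (bounded_wrt_L1 bff').
have i3 : L1 P (fun w => f w * f' w * incr W a' c w * incr W c e w).
  apply: L2M; [apply: (bounded_wrt_L2M bff')|]; apply: I => //.
  exact: le_trans a'c.
rewrite (_ : (fun w => _) = fun w => f w * f' w * incr W a a' w * incr W a' b' w
    + (f w * f' w * incr W a' c w ^+ 2 + f w * f' w * incr W a' c w * incr W c e w)); last first.
  by apply/funext.
rewrite ExD//; last exact: L1D.
rewrite ExD// e2 (centered _ _ _ f a0 aa' ab' _ _ (lexx _) bff').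
by rewrite (centered _ _ _ f a'0 a'c ce _ _ a'c bff') add0r addr0.
Qed.

Lemma incr_cross a b a' b' f f' : 0 <= a <= b -> 0 <= a' <= b' ->
  bounded_wrt a f -> bounded_wrt a' f' ->
  Ex P (fun w => (f w * incr W a b w) * (f' w * incr W a' b' w)) =
  kappa * overlap a b a' b' * Ex P (fun w => f w * f' w).
Proof.
move=> /andP[a0 ab] /andP[a'0 ab'] bf bf'.
have [aa'|aa'] := leP a a'; first exact: incr_cross_le.
rewrite overlapC [in RHS](_ : (fun w => _) = fun w => f' w * f w); last first.
  by apply/funext => w; rewrite mulrC.
rewrite -(incr_cross_le a'0 ab' ab (ltW aa') bf' bf).
by congr Ex; apply/funext => w; rewrite mulrC.
Qed.

(* Steps may overlap, so that the difference of two simple processes with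
   different partitions is again of this form. *)
Lemma steps_isometry (I : finType) (a b : I -> R) (f : I -> Omega -> R) :
  (forall i, 0 <= a i <= b i) -> (forall i, bounded_wrt (a i) (f i)) ->
  L2 P (fun w => \sum_i f i w * incr W (a i) (b i) w) /\
  Ex P (fun w => (\sum_i f i w * incr W (a i) (b i) w) ^+ 2) =
  \sum_i \sum_j kappa * overlap (a i) (b i) (a j) (b j) * Ex P (fun w => f i w * f j w).
Proof.
move=> ab bf.
have i2 i : L2 P (fun w => f i w * incr W (a i) (b i) w).
  by apply: (bounded_wrt_L2M (bf i)); exact: incr_L2.
split; first exact: L2_sum.
rewrite (_ : (fun w => _) = fun w => \sum_i \sum_j
   (f i w * incr W (a i) (b i) w) * (f j w * incr W (a j) (b j) w)); last first.
  apply/funext => w; rewrite expr2 mulr_suml; apply: eq_bigr => i _.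
  by rewrite mulr_sumr.
rewrite Ex_sum; last by move=> i; apply: L1_sum => j _; exact: L2M.
apply: eq_bigr => i _; rewrite Ex_sum; last by move=> j; exact: L2M.
by apply: eq_bigr => j _; exact: incr_cross.
Qed.

Local Notation mu := (@lebesgue_measure R).

(** The counterpart in time of [incr_cross]: the same overlap, without [kappa]. *)
Lemma integral_indic_overlap (a b a' b' r : R) : 0 <= a <= b -> 0 <= a' <= b' ->
  b <= r -> b' <= r ->
  mu.-integrable `[0, r] (EFin \o (fun s => \1_(`]a, b]%classic) s * \1_(`]a', b']%classic) s)) /\
  (\int[mu]_(s in `[0, r]) (\1_(`]a, b]%classic) s * \1_(`]a', b']%classic) s) = overlap a b a' b')%R.
Proof.
move=> /andP[a0 ab] /andP[a'0 ab'] br b'r.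
have -> : (fun s : R => \1_(`]a, b]%classic) s * \1_(`]a', b']%classic) s : R) =
   \1_(`]Num.max a a', Num.min b b']%classic).
  apply/funext => s; rewrite -[LHS]/((\1_(`]a, b]%classic) \* \1_(`]a', b']%classic)) s) -indicI.
  congr (\1__ s); apply/seteqP; split => y /=; rewrite !in_itv/= gt_max le_min.
    by move=> [/andP[-> ->] /andP[-> ->]].
  by move=> /andP[/andP[-> ->] /andP[-> ->]].
split.
  apply: (@integrableS _ _ _ mu setT) => //.
  exact: integrable_indic_itv.
rewrite /Rintegral integral_indic//= setIidl; last first.
  move=> y /=; rewrite !in_itv/= gt_max le_min => /andP[/andP[ay _] /andP[yb _]].
  by rewrite (le_trans a0 (ltW ay)) (le_trans yb br).
rewrite lebesgue_measure_itv/= lte_fin /overlap.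
case: (ltP (Num.max a a') (Num.min b b')) => h.
  by apply/esym/max_idPr; rewrite subr_ge0 ltW.
by apply/esym/max_idPl; rewrite subr_le0.
Qed.

End simple_integrals.

Section simple_process_isometry.
Context {d : measure_display} {Omega : measurableType d} {R : realType}.
Variables (P : probability Omega R) (W : R -> Omega -> R).
Hypothesis cP : measure_is_complete P.
Hypothesis bm : standard_brownian_motion P W.

Local Notation F := (augmented_filtration P W).
Local Notation kappa := (fine (@gauss_second_moment R)).
Local Notation mu := (@lebesgue_measure R).

(** Expanding the square gives the double sum of [steps_isometry] without its factor [kappa];
    comparing the two is the isometry. *)
Lemma steps_double_integral (I : finType) (a b : I -> R) (f : I -> Omega -> R) r :
  (forall i, 0 <= a i <= b i) -> (forall i, b i <= r) ->
  (forall i, bounded_wrt P W (a i) (f i)) ->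
  (\int[P]_w \int[mu]_(s in `[0%R, r])
     ((\sum_i f i w * \1_(`]a i, b i]%classic) s) ^+ 2)%:E =
  (\sum_i \sum_j overlap (a i) (b i) (a j) (b j) * Ex P (fun w => f i w * f j w))%:E)%E.
Proof.
move=> ab br bf.
transitivity (\int[P]_w (\sum_i \sum_j overlap (a i) (b i) (a j) (b j) * (f i w * f j w))%:E)%E.
  apply: eq_integral => w _.
  pose g (p : I * I) s := (f p.1 w * f p.2 w) *
     (\1_(`]a p.1, b p.1]%classic) s * \1_(`]a p.2, b p.2]%classic) s) : R.
  transitivity (\int[mu]_(s in `[0%R, r]) (\sum_p (g p s)%:E))%E.
    apply: eq_integral => s _; rewrite sumEFin; congr EFin.
    rewrite expr2 mulr_suml -(pair_bigA _ (fun i j => g (i, j) s))/=.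
    apply: eq_bigr => i _; rewrite mulr_sumr; apply: eq_bigr => j _.
    by rewrite /g/=; ring.
  have ig p : mu.-integrable `[0%R, r] (fun s => (g p s)%:E).
    have [ii _] := integral_indic_overlap (ab p.1) (ab p.2) (br p.1) (br p.2).
    exact: (integrableZl _ (f p.1 w * f p.2 w) ii).
  rewrite integral_sum//.
  rewrite -(pair_bigA _ (fun i j => \int[mu]_(s in `[0%R, r]) (g (i, j) s)%:E))%E/=.
  rewrite -sumEFin; apply: eq_bigr => i _; rewrite -sumEFin; apply: eq_bigr => j _.
  have [ii e] := integral_indic_overlap (ab i) (ab j) (br i) (br j).
  rewrite -e mulrC /g/=.
  under eq_integral do rewrite EFinM.
  rewrite (integralZl _ ii)// [in RHS]EFinM; congr (_ * _)%E.
  by rewrite /Rintegral fineK//; exact: integrable_fin_num.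
have ff i j : L1 P (fun w => f i w * f j w).
  by apply: L2M; exact: (bounded_wrt_L2 cP bm (bf _)).
rewrite ExE; last by apply: L1_sum => i _; apply: L1_sum => j _; exact: L1Z.
congr EFin; rewrite Ex_sum; last by move=> i; apply: L1_sum => j _; exact: L1Z.
apply: eq_bigr => i _; rewrite Ex_sum; last by move=> j; exact: L1Z.
by apply: eq_bigr => j _; rewrite ExZ.
Qed.

Variable T : R.

Lemma simple_time_ge0 (h : simple_process Omega R) i : simple_adapted F T h ->
  (i <= sp_size h)%N -> 0 <= sp_time h i.
Proof.
move=> [h0 _ hm _ _]; elim: i => // i IH ih.
exact: le_trans (IH (ltnW ih)) (hm _ ih).
Qed.

(** Stopping at r collapses a step that begins after r to the point r, where its value need not be
    known. Its interval being empty, the value may be replaced by 0, which makes it measurable at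
    the capped starting time. *)
Definition cap_val (h : simple_process Omega R) r (i : nat) w :=
  if sp_time h i <= r then sp_val h i w else 0.

Lemma cap_val_bounded h r i : 0 <= r -> simple_adapted F T h -> (i < sp_size h)%N ->
  bounded_wrt P W (Num.min (sp_time h i) r) (cap_val h r i).
Proof.
move=> r0 ha ih; have [_ _ _ hF hb] := ha.
have [tr|tr] := boolP (sp_time h i <= r).
  rewrite (min_idPl tr) (_ : cap_val h r i = sp_val h i).
    by split; [exact: hF|have [K hK] := hb _ ih; exists K].
  by apply/funext => w; rewrite /cap_val tr.
rewrite (_ : cap_val h r i = fun=> 0).
  by split; [exact: measurable_wrt_cst|exists 0 => w; rewrite normr0].
by apply/funext => w; rewrite /cap_val (negbTE tr).
Qed.

Lemma cap_time h r i : 0 <= r -> simple_adapted F T h -> (i < sp_size h)%N ->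
  0 <= Num.min (sp_time h i) r <= Num.min (sp_time h i.+1) r.
Proof.
move=> r0 ha ih; have [_ _ hm _ _] := ha.
by rewrite le_min r0 simple_time_ge0//= 1?ltnW// le_min2// hm.
Qed.

Lemma simple_integral_cap h r w : simple_adapted F T h -> simple_integral W h r w =
  \sum_(i < sp_size h) cap_val h r i w *
    incr W (Num.min (sp_time h i) r) (Num.min (sp_time h i.+1) r) w :> R.
Proof.
move=> [_ _ hm _ _]; apply: eq_bigr => i _; rewrite /cap_val /incr; case: ifPn => // tr.
rewrite -ltNge in tr.
by rewrite !(min_idPr _) ?subrr ?mulr0 ?(ltW tr)// (le_trans (ltW tr))// hm.
Qed.

Lemma simple_eval_cap h r s w : simple_adapted F T h -> s <= r -> simple_eval h s w =
  \sum_(i < sp_size h) cap_val h r i w *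
    \1_(`]Num.min (sp_time h i) r, Num.min (sp_time h i.+1) r]%classic) s :> R.
Proof.
move=> [_ _ hm _ _] sr; apply: eq_bigr => i _; rewrite /cap_val; case: ifPn => tr.
  rewrite (min_idPl tr); congr (_ * _).
  rewrite !indicE; congr (_%:R); congr nat_of_bool; apply/idP/idP; rewrite !inE/= !in_itv/=;
    move=> /andP[-> ]; rewrite ?le_min ?sr ?andbT// => ->//.
rewrite -ltNge in tr; rewrite mul0r indicE memNset ?mulr0//=.
by rewrite in_itv/= ltNge (le_trans sr (ltW tr)).
Qed.

(** The steps of both processes are put into one family indexed by the disjoint sum, those of h'
    with opposite sign, instead of passing to a common refinement. *)
Lemma simple_diff_isometry h h' r : 0 <= r ->
  simple_adapted F T h -> simple_adapted F T h' ->
  L2 P (fun w => simple_integral W h r w - simple_integral W h' r w) /\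
  (\int[P]_w ((simple_integral W h r w - simple_integral W h' r w) ^+ 2)%:E =
   kappa%:E * \int[P]_w \int[mu]_(s in `[0%R, r])
     ((simple_eval h s w - simple_eval h' s w) ^+ 2)%:E)%E.
Proof.
move=> r0 ha ha'.
(* The boolean is added to the index: [tm i false] is the capped beginning of step i and [tm i true]
   its capped end. *)
pose tm (i : 'I_(sp_size h) + 'I_(sp_size h')) (k : bool) :=
  Num.min (match i with inl i => sp_time h (i + k) | inr i => sp_time h' (i + k) end) r.
pose f (i : 'I_(sp_size h) + 'I_(sp_size h')) :=
  match i with inl i => cap_val h r i | inr i => fun w => - cap_val h' r i w end.
have tmP i : 0 <= tm i false <= tm i true.
  by rewrite /tm; case: i => i; rewrite addn0 addn1 cap_time.
have tmr i : tm i true <= r by rewrite ge_min lexx orbT.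
have bf i : bounded_wrt P W (tm i false) (f i).
  rewrite /tm /f; case: i => i; rewrite addn0; first exact: cap_val_bounded.
  have [mc [K cK]] := cap_val_bounded r0 ha' (ltn_ord i).
  split; last by exists K => w; rewrite normrN.
  rewrite (_ : (fun w => _) = fun w => 0 - cap_val h' r i w).
    by apply: measurable_wrtB => //; exact: measurable_wrt_cst.
  by apply/funext => w; rewrite sub0r.
have SE : (fun w => simple_integral W h r w - simple_integral W h' r w) =
    fun w => \sum_i f i w * incr W (tm i false) (tm i true) w.
  apply/funext => w; rewrite big_sumType/= (simple_integral_cap _ _ ha) (simple_integral_cap _ _ ha').
  congr (_ + _); first by apply: eq_bigr => i _; rewrite /tm addn0 addn1.
  by rewrite -sumrN; apply: eq_bigr => i _; rewrite /tm addn0 addn1 mulNr.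
have [S2 e] := steps_isometry cP bm tmP bf.
rewrite -SE in S2; split=> //.
rewrite ExE ?S2//; last exact: S2.2.
rewrite [X in Ex P X](_ : _ = fun w => (\sum_i f i w * incr W (tm i false) (tm i true) w) ^+ 2); last first.
  by apply/funext => w; rewrite -(congr1 (fun f => f w) SE).
rewrite e.
transitivity (kappa%:E * (\sum_i \sum_j overlap (tm i false) (tm i true) (tm j false) (tm j true)
   * Ex P (fun w => f i w * f j w))%:E)%E.
  rewrite -EFinM; congr EFin; rewrite mulr_sumr; apply: eq_bigr => i _.
  by rewrite mulr_sumr; apply: eq_bigr => j _; rewrite mulrA.
rewrite -(steps_double_integral tmP tmr bf); congr (_ * _)%E.
apply: eq_integral => w _; apply: eq_integral => s; rewrite inE/= in_itv/= => /andP[s0 sr].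
congr (_ ^+ 2)%:E.
rewrite big_sumType/= (simple_eval_cap _ ha sr) (simple_eval_cap _ ha' sr).
congr (_ + _); first by apply: eq_bigr => i _; rewrite /tm addn0 addn1.
by rewrite -sumrN; apply: eq_bigr => i _; rewrite /tm addn0 addn1 mulNr.
Qed.

End simple_process_isometry.

(** * Tonelli's theorem on a slab of times *)

Section tonelli_slab.
Context {d : measure_display} {Omega : measurableType d} {R : realType}.
Variable P : probability Omega R.
Local Notation mu := (@lebesgue_measure R).
Variables (D : set R) (f : R * Omega -> \bar R).
Hypothesis mD : measurable D.
Hypothesis mf : measurable_fun (D `*` [set: Omega]) f.
Hypothesis f0 : forall z, D z.1 -> (0 <= f z)%E.

Let mDT : measurable (D `*` [set: Omega]). Proof. exact: measurableX. Qed.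

(** Extension by 0 to the whole product, where Tonelli's theorem applies. *)
Let g := f \_ (D `*` [set: Omega]).

Let mg : measurable_fun setT g.
Proof. by apply/(measurable_restrictT _ mDT). Qed.

Let g0 z : (0 <= g z)%E.
Proof. by rewrite /g patchE; case: ifPn => //; rewrite inE => -[/f0]. Qed.

Let gE s w : g (s, w) = if s \in D then f (s, w) else 0%E.
Proof.
rewrite /g patchE; congr (if _ then _ else _); apply/idP/idP; rewrite !inE; first by case.
by split.
Qed.

Let innerT s : (\int[P]_w g (s, w) = ((fun s => \int[P]_w f (s, w)) \_ D) s)%E.
Proof.
rewrite patchE; case: ifPn => sD.
  by apply: eq_integral => w _; rewrite gE sD.
by rewrite integral0_eq// => w _; rewrite gE (negbTE sD).
Qed.

Let innerS w : (\int[mu]_s g (s, w) = \int[mu]_(s in D) f (s, w))%E.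
Proof.
rewrite [RHS]integral_mkcond; apply: eq_integral => s _.
by rewrite gE patchE.
Qed.

Lemma measurable_tonelli_slab1 : measurable_fun D (fun s => \int[P]_w f (s, w))%E.
Proof.
apply/(measurable_restrictT _ mD).
rewrite (_ : _ \_ _ = fun s => \int[P]_w g (s, w))%E; last first.
  by apply/funext => s; rewrite innerT.
exact: (measurable_fun_fubini_tonelli_F g mg g0).
Qed.

Lemma measurable_tonelli_slab2 : measurable_fun setT (fun w => \int[mu]_(s in D) f (s, w))%E.
Proof.
rewrite (_ : (fun w => _) = fun w => \int[mu]_s g (s, w))%E; last first.
  by apply/funext => w; rewrite innerS.
exact: (@measurable_fun_fubini_tonelli_G _ _ _ _ R mu g mg g0).
Qed.

Lemma tonelli_slab1 : (\int[mu \x P]_(z in D `*` [set: Omega]) f z =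
  \int[mu]_(s in D) \int[P]_w f (s, w))%E.
Proof.
rewrite [LHS]integral_mkcond (@fubini_tonelli1 _ _ _ _ R mu P g mg g0) [RHS]integral_mkcond.
by apply: eq_integral => s _; rewrite -innerT.
Qed.

Lemma tonelli_slab2 : (\int[mu \x P]_(z in D `*` [set: Omega]) f z =
  \int[P]_w \int[mu]_(s in D) f (s, w))%E.
Proof.
rewrite [LHS]integral_mkcond (@fubini_tonelli2 _ _ _ _ R mu P g mg g0).
by apply: eq_integral => w _; rewrite -innerS.
Qed.

End tonelli_slab.

(** The sign of w suits telescoping through approximations S and S': I - I' = (S - S') + (S' - I') -
    (S - I). *)
Lemma integral_sqr3 {d : measure_display} {T : measurableType d} {R : realType}
    (mu : {measure set T -> \bar R}) (D : set T) (u v w : T -> R) :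
  measurable D ->
  measurable_fun D u -> measurable_fun D v -> measurable_fun D w ->
  (\int[mu]_(x in D) ((u x + v x - w x) ^+ 2)%:E <=
   3%:E * (\int[mu]_(x in D) (u x ^+ 2)%:E + \int[mu]_(x in D) (v x ^+ 2)%:E +
           \int[mu]_(x in D) (w x ^+ 2)%:E))%E.
Proof.
move=> mD mu_ mv mw.
have m2 (f : T -> R) : measurable_fun D f -> measurable_fun D (fun x => (f x ^+ 2)%:E).
  by move=> mf; apply/measurable_EFinP; exact: measurable_funX.
have p2 (f : T -> R) x : D x -> (0 <= (f x ^+ 2)%:E)%E by rewrite lee_fin sqr_ge0.
rewrite -(ge0_integralD mu mD (p2 u) (m2 _ mu_) (p2 v) (m2 _ mv)).
rewrite -(ge0_integralD mu mD _ _ (p2 w) (m2 _ mw)); last 2 first.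
- by move=> x Dx; rewrite -EFinD lee_fin addr_ge0// sqr_ge0.
- by apply: emeasurable_funD; exact: m2.
have pp x : D x -> (0 <= (u x ^+ 2)%:E + (v x ^+ 2)%:E + (w x ^+ 2)%:E)%E.
  by move=> Dx; rewrite -!EFinD lee_fin !addr_ge0// sqr_ge0.
have mm : measurable_fun D (fun x => (u x ^+ 2)%:E + (v x ^+ 2)%:E + (w x ^+ 2)%:E)%E.
  by apply: emeasurable_funD; [apply: emeasurable_funD|]; exact: m2.
rewrite -(ge0_integralZl mu mD mm pp)//.
apply: (ge0_le_integral mu mD) => //.
- exact: p2.
- by apply: m2; apply: measurable_funB => //; exact: measurable_funD.
- exact: measurable_funeM.
move=> x _; rewrite -!EFinD -EFinM lee_fin.
have := sqr_ge0 (u x - v x); have := sqr_ge0 (u x + w x); have := sqr_ge0 (v x + w x).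
rewrite !expr2; nra.
Qed.

(** * Second moments of Ito integrals *)

Section ito_estimates.
Context {d : measure_display} {Omega : measurableType d} {R : realType}.
Variables (P : probability Omega R) (W : R -> Omega -> R).
Hypothesis cP : measure_is_complete P.
Hypothesis bm : standard_brownian_motion P W.
Variable T : R.

Local Notation F := (augmented_filtration P W).
Local Notation kappa := (fine (@gauss_second_moment R)).
Local Notation mu := (@lebesgue_measure R).
Local Notation slab r := (`[0%R, r]%classic `*` [set: Omega]).

(** The approximation clause of [ito_integral] for a single entry. *)
Definition approximates (h : nat -> simple_process Omega R) (H I : R -> Omega -> R) :=
  [/\ forall k, simple_adapted F T (h k),
      (fun k => \int[P]_w \int[mu]_(s in `[0%R, T])
         ((simple_eval (h k) s w - H s w) ^+ 2)%:E)%E @ \oo --> 0%E &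
      forall r, 0 <= r <= T ->
        (fun k => \int[P]_w ((simple_integral W (h k) r w - I r w) ^+ 2)%:E)%E
          @ \oo --> 0%E].

Lemma cvge0_lt (u : nat -> \bar R) (e : R) : u @ \oo --> 0%E -> 0 < e ->
  \forall k \near \oo, (u k < e%:E)%E.
Proof.
move=> u0 e0; apply: (u0 [set x | x < e%:E]%E); apply: open_nbhs_nbhs; split.
  exact: open_ereal_lt_ereal.
by rewrite /= lte_fin.
Qed.

Lemma measurable_simple_eval h (D : set (R * Omega)) : 0 <= T -> simple_adapted F T h ->
  measurable D ->
  measurable_fun D (fun z : R * Omega => simple_eval h z.1 z.2).
Proof.
move=> T0 ha mD; apply: measurable_funTS.
apply: measurable_sum => i; apply: measurable_funM.
  apply: (measurableT_comp (f := sp_val h i)) => //.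
  have [_ _ _ hF _] := ha.
  exact: (measurable_wrt_measurable cP bm (hF _ (ltn_ord i))).
have mi : measurable_fun setT (\1_(`]sp_time h i, sp_time h i.+1]%classic) : R -> R).
  exact: measurable_indic.
exact: (measurableT_comp mi measurable_fst).
Qed.

Lemma simple_integral_L2 h r : 0 <= r <= T -> simple_adapted F T h ->
  L2 P (simple_integral W h r).
Proof.
move=> /andP[r0 rT] ha.
(* The process without steps has integral 0, so the result on differences covers a single
   process. *)
pose h0 := SimpleProcess 0 (fun=> 0 : R) (fun _ (_ : Omega) => 0 : R).
have ha0 : simple_adapted F T h0 by split => //=; exact: le_trans rT.
have [S2 _] := simple_diff_isometry cP bm r0 ha ha0.
rewrite (_ : simple_integral W h r = fun w => simple_integral W h r w - simple_integral W h0 r w) //.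
by apply/funext => w; rewrite [X in _ - X]/simple_integral big_ord0 subr0.
Qed.

(** One k with finite approximation error exhibits I(r) as a difference of two square integrable
    variables. *)
Lemma approximates_L2 h H I r : 0 <= r <= T -> approximates h H I ->
  measurable_fun setT (I r) -> L2 P (I r).
Proof.
move=> rT [ha _ /(_ _ rT) hI] mI.
have [k _ /(_ k (leqnn k))/= hk] := cvge0_lt hI ltr01.
have S2 := simple_integral_L2 rT (ha k).
rewrite (_ : I r = fun w => simple_integral W (h k) r w - (simple_integral W (h k) r w - I r w)); last first.
  by apply/funext => w; rewrite subKr.
have mSI : measurable_fun setT (fun w => simple_integral W (h k) r w - I r w).
  by apply: measurable_funB => //; exact: S2.1.
apply: L2B => //; split => //; apply/integrableP; split.
  by apply/measurable_EFinP; exact: measurable_funX.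
under eq_integral do rewrite /= ger0_norm ?sqr_ge0//.
by apply: lt_trans hk _; rewrite ltry.
Qed.

(** Telescoping from the integrals to simple integrals costs a factor 3, the isometry a factor
    [kappa], and telescoping from simple processes back to the integrands another 3. *)
Lemma ito_diff_estimate h h' H H' I I' r : 0 <= r <= T ->
  measurable_fun (slab T) (fun z => H z.1 z.2) ->
  measurable_fun (slab T) (fun z => H' z.1 z.2) ->
  measurable_fun setT (I r) -> measurable_fun setT (I' r) ->
  approximates h H I -> approximates h' H' I' ->
  (\int[P]_w ((I r w - I' r w) ^+ 2)%:E <=
   (9 * kappa)%:E * \int[P]_w \int[mu]_(s in `[0%R, r]) ((H s w - H' s w) ^+ 2)%:E)%E.
Proof.
move=> /[dup] rT' /andP[r0 rT] mH mH' mI mI' [ha hH hI] [ha' hH' hI'].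
have T0 : 0 <= T := le_trans r0 rT.
have k0 : 0 <= kappa := gauss_second_moment_ge0.
have mr : measurable `[0%R, r] by exact: measurable_itv.
have mT : measurable `[0%R, T] by exact: measurable_itv.
have mslab : measurable (slab r) by exact: measurableX.
have mslabT : measurable (slab T) by exact: measurableX.
have sub : slab r `<=` slab T.
  move=> [s w] [/=]; rewrite !in_itv/= => /andP[-> sr] _; split => //.
  exact: le_trans rT.
have toslab (f : R -> Omega -> R) (q : R) : measurable_fun (slab q) (fun z => f z.1 z.2) ->
    (\int[P]_w \int[mu]_(s in `[0%R, q]) (f s w ^+ 2)%:E =
     \int[mu \x P]_(z in slab q) (f z.1 z.2 ^+ 2)%:E)%E.
  move=> mf; rewrite (tonelli_slab2 P (f := fun z => (f z.1 z.2 ^+ 2)%:E))//.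
  - by apply/measurable_EFinP; exact: measurable_funX.
  - by move=> z _; rewrite lee_fin sqr_ge0.
set DH : \bar R := (X in (_ <= _ * X)%E).
have DHE : DH = (\int[mu \x P]_(z in slab r) ((H z.1 z.2 - H' z.1 z.2) ^+ 2)%:E)%E.
  rewrite -(toslab (fun s w => H s w - H' s w))//.
  by apply: measurable_funB; [exact: measurable_funS mH|exact: measurable_funS mH'].
apply/lee_addgt0Pr => e e0.
(* The four approximation errors, each at most e', enter as 3 (kappa 3 (e' + e') + e' + e') = (6 +
   18 kappa) e'. *)
pose e' := e / (6 + 18 * kappa).
have C0 : 0 < 6 + 18 * kappa by lra.
have e'0 : 0 < e' by rewrite divr_gt0.
have [k _ /(_ k (leqnn k))/= [[hk hk'] [gk gk']]] :=
  filterI (filterI (cvge0_lt (hI _ rT') e'0) (cvge0_lt (hI' _ rT') e'0))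
          (filterI (cvge0_lt hH e'0) (cvge0_lt hH' e'0)).
have me := measurable_simple_eval T0 (ha k) mslabT.
have me' := measurable_simple_eval T0 (ha' k) mslabT.
rewrite (toslab (fun s w => simple_eval (h k) s w - H s w)) in gk; last exact: measurable_funB.
rewrite (toslab (fun s w => simple_eval (h' k) s w - H' s w)) in gk'; last exact: measurable_funB.
have [S2 iso] := simple_diff_isometry cP bm r0 (ha k) (ha' k).
rewrite (toslab (fun s w => simple_eval (h k) s w - simple_eval (h' k) s w)) in iso; last first.
  by apply: measurable_funB; [exact: measurable_funS me|exact: measurable_funS me'].
have mS := (simple_integral_L2 rT' (ha k)).1.
have mS' := (simple_integral_L2 rT' (ha' k)).1.
have step1 := @integral_sqr3 _ _ _ P setT
  (fun w => simple_integral W (h k) r w - simple_integral W (h' k) r w)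
  (fun w => simple_integral W (h' k) r w - I' r w)
  (fun w => simple_integral W (h k) r w - I r w) measurableT
  S2.1 (measurable_funB mS' mI') (measurable_funB mS mI).
have subm (f : R * Omega -> R) : measurable_fun (slab T) f -> measurable_fun (slab r) f.
  by apply: measurable_funS.
have step2 := @integral_sqr3 _ _ _ (mu \x P)%E (slab r)
  (fun z => H z.1 z.2 - H' z.1 z.2)
  (fun z => simple_eval (h k) z.1 z.2 - H z.1 z.2)
  (fun z => simple_eval (h' k) z.1 z.2 - H' z.1 z.2) mslab
  (subm _ (measurable_funB mH mH')) (subm _ (measurable_funB me mH))
  (subm _ (measurable_funB me' mH')).
have shrink (f : R * Omega -> R) : measurable_fun (slab T) f ->
    (\int[mu \x P]_(z in slab r) (f z ^+ 2)%:E <= \int[mu \x P]_(z in slab T) (f z ^+ 2)%:E)%E.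
  move=> mf; apply: ge0_subset_integral => //.
  - by apply/measurable_EFinP; exact: measurable_funX.
  - by move=> z _; rewrite lee_fin sqr_ge0.
have gr := le_lt_trans (shrink _ (measurable_funB me mH)) gk.
have gr' := le_lt_trans (shrink _ (measurable_funB me' mH')) gk'.
rewrite -DHE in step2.
have DH0 : (0 <= DH)%E.
  by rewrite DHE; apply: integral_ge0 => z _; rewrite lee_fin sqr_ge0.
rewrite (_ : (fun w => _) = fun w => ((I r w - I' r w) ^+ 2)%:E) in step1; last first.
  by apply/funext => w; congr (_ ^+ 2)%:E; ring.
rewrite (_ : (fun z => _) = fun z : R * Omega =>
    ((simple_eval (h k) z.1 z.2 - simple_eval (h' k) z.1 z.2) ^+ 2)%:E) in step2; last first.
  by apply/funext => z; congr (_ ^+ 2)%:E; ring.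
apply: (le_trans step1).
rewrite iso.
have e6 : e = 3 * (kappa * (3 * (e' + e')) + e' + e').
  by rewrite /e'; field; rewrite gt_eqF.
clearbody e'.
apply: (@le_trans _ _ (3%:E * (kappa%:E * (3%:E * (DH + e'%:E + e'%:E)) + e'%:E + e'%:E))%E).
  apply: lee_wpmul2l; first by rewrite lee_fin.
  apply: leeD; last exact: ltW.
  apply: leeD; last exact: ltW.
  apply: lee_wpmul2l; first by rewrite lee_fin.
  apply: (le_trans step2).
  apply: lee_wpmul2l; first by rewrite lee_fin.
  by apply: leeD; [apply: leeD => //|]; exact: ltW.
case: (DH) DH0 => [x x0| _ |//].
  rewrite -!(EFinD, EFinM) lee_fin e6; lra.
(* Here [DH] is infinite. As [kappa] is not evaluated, it could be 0, and then 0 * oo = 0 makes the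
   right side finite. *)
have [->|kn0] := eqVneq kappa 0.
  rewrite mulr0 !mul0e !add0e -!EFinD -!EFinM lee_fin e6.
  by have := mulr_ge0 k0 (ltW e'0); nra.
have kp : 0 < kappa by rewrite lt_def kn0.
by rewrite [X in (_ <= X + _)%E]gt0_muley ?lte_fin ?mulr_gt0// addye// leey.
Qed.

(** The martingale property tested on A: each step of a simple integral contributes mean 0 between t
    and s, and the property survives the L^2 limit. *)
Lemma approximates_centered h H I t s A : approximates h H I -> 0 <= t <= s -> s <= T ->
  (forall r, 0 <= r <= T -> measurable_fun setT (I r)) -> F t A ->
  Ex P (fun w => \1_A w * (I s w - I t w)) = 0.
Proof.
move=> /[dup] hap [ha hH hI] /andP[t0 ts] sT mI FA.
have tT : 0 <= t <= T by rewrite t0 (le_trans ts).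
have sT' : 0 <= s <= T by rewrite sT (le_trans t0).
have bA : bounded_wrt P W t (\1_A : Omega -> R).
  split; first exact: measurable_wrt_indic.
  by exists 1 => w; rewrite indicE; case: (_ \in _); rewrite ?normr1 ?normr0.
have mA : measurable_fun setT (\1_A : Omega -> R).
  exact: (measurable_wrt_measurable cP bm bA.1).
have b1 w : `|\1_A w : R| <= 1.
  by rewrite indicE; case: (_ \in _); rewrite ?normr1 ?normr0.
have simple0 k : Ex P (fun w => \1_A w *
    (simple_integral W (h k) s w - simple_integral W (h k) t w)) = 0.
  pose g (i : 'I_(sp_size (h k))) w := \1_A w * (sp_val (h k) i w *
    (W (Num.min (sp_time (h k) i.+1) s) w - W (Num.min (sp_time (h k) i) s) w -
    (W (Num.min (sp_time (h k) i.+1) t) w - W (Num.min (sp_time (h k) i) t) w))).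
  suff gi i : L1 P (g i) /\ Ex P (g i) = 0.
    rewrite (_ : (fun w => _) = fun w => \sum_i g i w); last first.
      apply/funext => w; rewrite -sumrB mulr_sumr; apply: eq_bigr => i _.
      by rewrite /g -mulrBr.
    by rewrite Ex_sum => [|i]; [rewrite big1// => i _; apply: (gi i).2|exact: (gi i).1].
  have [_ _ hm hF hb] := ha k.
  have ii := ltn_ord i; have tm := hm _ ii.
  have t_ge0 := simple_time_ge0 (ha k) (ltnW ii).
  have bv : bounded_wrt P W (sp_time (h k) i) (sp_val (h k) i).
    by split; [exact: hF|exact: hb].
  (* A step beginning after t has coefficient [\1_A * sp_val] known when it begins; a step ending
     before t has no increment left; a step straddling t counts from t on only, with its value
     already known at t. *)
  have [ti|ti] := leP t (sp_time (h k) i).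
    have st : 0 <= Num.min (sp_time (h k) i) s <= Num.min (sp_time (h k) i.+1) s.
      by rewrite le_min t_ge0 (le_trans t0)//= le_min2.
    have [is_|is_] := leP (sp_time (h k) i) s; last first.
      rewrite (_ : g i = fun=> 0); last first.
        apply/funext => w; rewrite /g !(min_idPr _) ?subrr ?mulr0 ?(ltW is_) ?(le_trans _ tm) ?(ltW is_)//.
      by split; [exact: L1_cst|exact: Ex_cst].
    rewrite (min_idPl is_) in st.
    have bAv := bounded_wrtM (bounded_wrt_mono ti bA) bv.
    have [j1 j2 _ _] := incr_mulE cP bm st bAv.1 (bounded_wrt_L1 cP bm bAv).
    rewrite (_ : g i = fun w => \1_A w * sp_val (h k) i w *
      incr W (sp_time (h k) i) (Num.min (sp_time (h k) i.+1) s) w)//.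
    apply/funext => w; rewrite /g (min_idPl is_).
    rewrite [Num.min _ t](min_idPr _) ?(le_trans ti)// [Num.min _ t](min_idPr _)//.
    by rewrite /incr; ring.
  have bAv := bounded_wrtM bA (bounded_wrt_mono (ltW ti) bv).
  have [it|it] := leP (sp_time (h k) i.+1) t.
    rewrite (_ : g i = fun=> 0); last first.
      apply/funext => w; rewrite /g !(min_idPl _) ?subrr ?mulr0 ?(ltW ti) ?(le_trans _ ts) ?(ltW ti)//.
    by split; [exact: L1_cst|exact: Ex_cst].
  have st : 0 <= t <= Num.min (sp_time (h k) i.+1) s by rewrite t0 le_min ts (ltW it).
  have [j1 j2 _ _] := incr_mulE cP bm st bAv.1 (bounded_wrt_L1 cP bm bAv).
  rewrite (_ : g i = fun w => \1_A w * sp_val (h k) i w *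
    incr W t (Num.min (sp_time (h k) i.+1) s) w)//.
  apply/funext => w; rewrite /g [Num.min (sp_time (h k) i) s](min_idPl _) ?(le_trans (ltW ti))//.
  rewrite [Num.min _ t](min_idPr _) ?(ltW it)// [Num.min _ t](min_idPl _) ?(ltW ti)//.
  by rewrite /incr; ring.
have L2I r : 0 <= r <= T -> L2 P (I r).
  by move=> rT; apply: (approximates_L2 rT hap); exact: mI.
apply/eqP; rewrite -normr_le0; apply/ler_addgt0Pr => e e0; rewrite add0r.
(* Each of the two approximation errors, at s and at t, will be at most 2 e'. *)
pose e' := e / 4.
have e'0 : 0 < e' by rewrite divr_gt0.
have [k _ /(_ k (leqnn k))/= [hs ht]] :=
  filterI (cvge0_lt (hI _ sT') (exprn_gt0 2 e'0)) (cvge0_lt (hI _ tT) (exprn_gt0 2 e'0)).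
pose U r w := simple_integral W (h k) r w - I r w.
have U2 r : 0 <= r <= T -> L2 P (U r).
  by move=> rT; apply: L2B; [exact: simple_integral_L2|exact: L2I].
have AL f : L2 P f -> L1 P (fun w => \1_A w * f w).
  by move=> f2; apply: (L1M_bounded mA b1); exact: L2_L1.
(* From |U| <= e' + U^2 / e', whose mean is at most e' + e'. *)
have smallU r : 0 <= r <= T -> (\int[P]_w (U r w ^+ 2)%:E < (e' ^+ 2)%:E)%E ->
    `|Ex P (fun w => \1_A w * U r w)| <= 2 * e'.
  move=> rT; rewrite ExE ?lte_fin; last exact: (U2 r rT).2.
  move=> Ue; apply: (@le_trans _ _ (Ex P (fun w => e' + e'^-1 * U r w ^+ 2))).
    apply: (le_trans (le_normr_Rintegral measurableT (AL _ (U2 r rT)))).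
    apply: le_Ex.
    - by apply: integrable_norm; exact: AL (U2 r rT).
    - by apply: L1D; [exact: L1_cst|apply: L1Z; exact: (U2 r rT).2].
    move=> w; rewrite normrM (le_trans (ler_piMl _ (b1 w)))//.
    rewrite -(real_normK (num_real (U r w))).
    rewrite -(ler_pM2l e'0) [leRHS](_ : _ = e' ^+ 2 + `|U r w| ^+ 2); last first.
      by field; rewrite gt_eqF.
    by have := sqr_ge0 (`|U r w| - e'); have := normr_ge0 (U r w); nra.
  rewrite ExD; [|exact: L1_cst|apply: L1Z; exact: (U2 r rT).2].
  rewrite (ExZ e'^-1 (U2 r rT).2).
  rewrite Ex_cst mulr_natl mulr2n lerD2l.
  by rewrite ler_pdivrMl// -expr2 ltW.
(* By [simple0] the simple integrals drop out of the mean and only the errors remain. *)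
have -> : Ex P (fun w => \1_A w * (I s w - I t w)) =
    Ex P (fun w => \1_A w * U t w) - Ex P (fun w => \1_A w * U s w).
  rewrite -ExB; [|exact: AL (U2 t tT)|exact: AL (U2 s sT')].
  apply/eqP; rewrite -subr_eq0 -ExB; last 2 first.
  - by apply: AL; apply: L2B; exact: L2I.
  - by apply: L1B; apply: AL; exact: U2.
  rewrite -[X in _ == X](simple0 k); apply/eqP; congr Ex; apply/funext => w.
  by rewrite /U; ring.
rewrite (le_trans (ler_normB _ _))//.
have := smallU _ tT ht; have := smallU _ sT' hs; rewrite /e'; lra.
Qed.

End ito_estimates.

(** The nonnegative integral is a supremum over simple functions below the integrand, so the
    comparison also covers integrands of unknown measurability, such as the supremum of a path in
    [L2F_C]. *)
Lemma ge0_integral_mono {d : measure_display} {T : measurableType d} {R : realType}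
    (mu : {measure set T -> \bar R}) (D : set T) (f g : T -> \bar R) :
  (forall x, D x -> 0 <= f x)%E -> (forall x, D x -> f x <= g x)%E ->
  (\int[mu]_(x in D) f x <= \int[mu]_(x in D) g x)%E.
Proof.
move=> f0 fg; rewrite [leLHS]integral_mkcond [leRHS]integral_mkcond.
have f0' x : (0 <= (f \_ D) x)%E.
  by rewrite patchE; case: ifPn => //; rewrite inE => /f0.
have fg' x : ((f \_ D) x <= (g \_ D) x)%E.
  by rewrite !patchE; case: ifPn => //; rewrite inE => /fg.
have g0' x : (0 <= (g \_ D) x)%E by exact: le_trans (fg' x).
rewrite !ge0_integralTE//; apply: le_ereal_sup => _ [h hf <-]; exists h => // x.
exact: le_trans (hf x) (fg' x).
Qed.

#[global] Instance ae_lebesgue_filter (R : realType) :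
  Filter (nbhs (almost_everywhere (@lebesgue_measure R))).
Proof. exact: (@ae_filter_ringOfSetsType _ _ _ (@lebesgue_measure R)). Qed.

#[global] Instance ae_probability_filter {d : measure_display} {T : measurableType d}
  {R : realType} (P : probability T R) : Filter (nbhs (almost_everywhere P)).
Proof. exact: (@ae_filter_ringOfSetsType _ _ _ P). Qed.

(** * Gronwall's lemma and the Cauchy-Schwarz inequality *)

Section gronwall.
Context {R : realType}.
Local Notation mu := (@lebesgue_measure R).

Lemma lee0_halving (M : R) (x : \bar R) : 0 <= M ->
  (forall m : nat, x <= (M / 2 ^+ m)%:E)%E -> (x <= 0)%E.
Proof.
move=> M0 xM; apply/lee_addgt0Pr => h h0; rewrite add0e.
have [m hm] : exists m : nat, M / 2 ^+ m <= h.
  exists (Num.truncn (M / h)).+1.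
  rewrite ler_pdivrMr ?exprn_gt0// -ler_pdivrMl// mulrC.
  apply: (le_trans (ltW (truncnS_gt _))).
  by rewrite -natrX ler_nat ltnW// ltn_expl.
by apply: (le_trans (xM m)); rewrite lee_fin.
Qed.

(** Time advances in steps of length e with C e <= 1/2. Once f vanishes on the earlier steps,
    feeding a bound N on the current step into the integral inequality returns N / 2; repeated
    halving forces f = 0 there. The outer induction counts steps, the inner one halvings. *)
Lemma gronwall0 (a b C M : R) (f : R -> \bar R) : a <= b -> 0 <= C ->
  (forall s, a <= s <= b -> (0 <= f s)%E) ->
  (forall s, a <= s <= b -> (f s <= M%:E)%E) ->
  (forall s, a <= s <= b -> (f s <= C%:E * \int[mu]_(r in `[a, s]) f r)%E) ->
  forall s, a <= s <= b -> f s = 0%E.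
Proof.
move=> ab C0 f0 fM fC.
have M0 : 0 <= M.
  by rewrite -lee_fin (le_trans (f0 a _)) ?fM ?lexx ?ab.
(* The summand 1 keeps e defined and positive when C = 0. *)
pose e := (2 * C + 1)^-1.
have C1 : 0 < 2 * C + 1 by lra.
have e0 : 0 < e by rewrite invr_gt0.
have Ce : C * e <= 2^-1.
  by rewrite /e ler_pdivrMr// mulrDr mulr1 mulrA mulVf// mul1r lerDl.
suff key (k m : nat) s : a <= s <= b -> s <= a + k%:R * e -> (f s <= (M / 2 ^+ m)%:E)%E.
  move=> s abs.
  have [k sk] : exists k : nat, s <= a + k%:R * e.
    exists (Num.truncn ((s - a) / e)).+1.
    by rewrite -lerBlDl -ler_pdivrMr// ltW// truncnS_gt.
  apply/eqP; rewrite eq_le f0// andbT; apply: (lee0_halving M0) => m; exact: key sk.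
elim: k m s => [m s /andP[as_ sb]|k IHk m].
  rewrite mul0r addr0 => sa.
  have -> : s = a by apply/eqP; rewrite eq_le sa.
  apply: (le_trans (fC a _)); first by rewrite lexx.
  rewrite set_itv1 integral_set1 mule0 lee_fin divr_ge0// exprn_ge0//.
have fk0 r : a <= r <= b -> r <= a + k%:R * e -> f r = 0%E.
  move=> abr rk; apply/eqP; rewrite eq_le f0// andbT.
  by apply: (lee0_halving M0) => m'; exact: IHk rk.
elim: m => [s abs _|m IHm s /andP[as_ sb] sk].
  by rewrite expr0 divr1; exact: fM.
apply: (le_trans (fC s _)); first by rewrite as_.
pose s0 := a + k%:R * e.
pose N := M / 2 ^+ m.
have N0 : 0 <= N by rewrite divr_ge0// exprn_ge0.
(* Up to s0 the function vanishes by the outer induction; beyond s0 it is at most N by the inner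
   one. *)
have le1 : (\int[mu]_(r in `[a, s]) f r <=
            \int[mu]_(r in `[a, s]) (N * \1_(`]s0, s0 + e]%classic) r)%:E)%E.
  apply: ge0_integral_mono => r /=; rewrite in_itv/= => /andP[ar rs].
    by apply: f0; rewrite ar (le_trans rs).
  have abr : a <= r <= b by rewrite ar (le_trans rs).
  have [rs0|rs0] := leP r s0.
    by rewrite fk0// lee_fin mulr_ge0.
  rewrite indicE mem_set ?mulr1.
    by apply: IHm => //; exact: le_trans rs sk.
  have sk' : s <= s0 + e by move: sk; rewrite -natr1 mulrDl mul1r addrA.
  by rewrite /= in_itv/= rs0 (le_trans rs sk').
have le2 : (\int[mu]_(r in `[a, s]) (N * \1_(`]s0, s0 + e]%classic) r)%:E <= (N * e)%:E)%E.
  apply: (@le_trans _ _ (\int[mu]_r (N * \1_(`]s0, s0 + e]%classic) r)%:E)%E).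
    apply: ge0_subset_integral => //.
    - apply/measurable_EFinP; apply: measurable_funM => //.
    - by move=> x _; rewrite lee_fin mulr_ge0.
  under eq_integral do rewrite EFinM.
  rewrite ge0_integralZl//; last exact/measurable_EFinP.
  rewrite integral_indic// setIT.
  rewrite /= lebesgue_measure_itv/= lte_fin ltrDl e0.
  by rewrite -EFinD addrC addKr EFinM.
apply: (le_trans (lee_wpmul2l _ (le_trans le1 le2))); first by rewrite lee_fin.
have -> : M / 2 ^+ m.+1 = N * 2^-1 by rewrite /N exprSr invfM mulrA.
by rewrite -EFinM lee_fin mulrCA ler_wpM2l.
Qed.

(** If f^2 is integrable, integrate (f - a / s)^2 >= 0 with a the integral of f; otherwise the right
    side is infinite. *)
Lemma sqr_Rintegral_le (s : R) (f : R -> R) : 0 <= s ->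
  mu.-integrable `[0, s] (EFin \o f) ->
  (((\int[mu]_(r in `[0, s]) f r)%R ^+ 2)%:E <= s%:E * \int[mu]_(r in `[0%R, s]) (f r ^+ 2)%:E)%E.
Proof.
rewrite le_eqVlt => /predU1P[<- _|s0 fi].
  by rewrite set_itv1 Rintegral_set1 expr0n mul0e.
have mD : measurable `[0, s] by exact: measurable_itv.
have mf : measurable_fun `[0, s] f by apply/measurable_EFinP; exact: measurable_int fi.
have mf2 : measurable_fun `[0, s] (fun r => (f r ^+ 2)%:E).
  by apply/measurable_EFinP; exact: measurable_funX.
have f20 : (0 <= \int[mu]_(r in `[0%R, s]) (f r ^+ 2)%:E)%E.
  by apply: integral_ge0 => r _; rewrite lee_fin sqr_ge0.
have [oo|] := eqVneq (\int[mu]_(r in `[0%R, s]) (f r ^+ 2)%:E)%E +oo%E.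
  by rewrite oo gt0_muley ?lte_fin// leey.
rewrite -ltey => fin2.
have i2 : mu.-integrable `[0, s] (EFin \o (fun r => f r ^+ 2)).
  apply/integrableP; split => //.
  by under eq_integral do rewrite /= ger0_norm ?sqr_ge0//.
have ic c : mu.-integrable `[0, s] (EFin \o cst c).
  apply/integrableP; split; first exact/measurable_EFinP.
  rewrite (eq_integral (cst `|c|%:E))// integral_cst//= lebesgue_measure_itv/= lte_fin s0.
  by rewrite -EFinD -EFinM ltry.
pose a := (\int[mu]_(r in `[0, s]) f r)%R.
have -> : (\int[mu]_(r in `[0%R, s]) (f r ^+ 2)%:E = (\int[mu]_(r in `[0%R, s]) (f r ^+ 2))%R%:E)%E.
  by rewrite /Rintegral fineK//; exact: integrable_fin_num i2.
rewrite -EFinM lee_fin -/a.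
have : 0 <= (\int[mu]_(r in `[0, s]) (f r ^+ 2 + ((- 2 * (a / s)) * f r + (a / s) ^+ 2)))%R.
  apply: Rintegral_ge0 => r _.
  by have := sqr_ge0 (f r - a / s); rewrite sqrrB; lra.
have iz c : mu.-integrable `[0, s] (EFin \o (fun r => c * f r)).
  exact: (@integrableZl _ _ _ mu _ mD c _ fi).
rewrite RintegralD//; last exact: (@integrableD _ _ _ mu _ mD _ _ (iz _) (ic _)).
rewrite RintegralD//; last exact: ic.
rewrite (@RintegralZl _ _ _ mu _ _ _ mD fi) Rintegral_cst//= lebesgue_measure_itv/= lte_fin s0 -EFinD/= subr0 -/a.
set b := Rintegral _ _ _.
have -> : - 2 * (a / s) * a + (a / s) ^+ 2 * s = - a ^+ 2 / s by field; rewrite gt_eqF.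
by rewrite mulNr subr_ge0 ler_pdivrMr// mulrC.
Qed.

End gronwall.

(** * Jointly integrable processes *)

Section joint_integrability.
Context {d : measure_display} {Omega : measurableType d} {R : realType}.
Variable P : probability Omega R.
Local Notation mu := (@lebesgue_measure R).
Implicit Types (D E : set R) (Y Z : R -> Omega -> R).

Definition jint D Y :=
  (mu \x P)%E.-integrable (D `*` [set: Omega]) (fun z => (Y z.1 z.2)%:E).

Lemma jint_measurable D Y : jint D Y ->
  measurable_fun (D `*` [set: Omega]) (fun z => Y z.1 z.2).
Proof. by move=> /measurable_int /measurable_EFinP. Qed.

Lemma measurable_slab D : measurable D -> measurable (D `*` [set: Omega]).
Proof. by move=> mD; exact: measurableX. Qed.

Lemma jintS D E Y : measurable D -> measurable E -> E `<=` D -> jint D Y -> jint E Y.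
Proof.
move=> mD mE ED; apply: integrableS; [exact: measurable_slab|exact: measurable_slab|].
by move=> z [Ez _]; split => //; exact: ED.
Qed.

Lemma jintD D Y Z : measurable D -> jint D Y -> jint D Z -> jint D (fun s w => Y s w + Z s w).
Proof. by move=> mD iY iZ; exact: (@integrableD _ _ _ (mu \x P)%E _ (measurable_slab mD) _ _ iY iZ). Qed.

Lemma jintB D Y Z : measurable D -> jint D Y -> jint D Z -> jint D (fun s w => Y s w - Z s w).
Proof. by move=> mD iY iZ; exact: (@integrableB _ _ _ (mu \x P)%E _ (measurable_slab mD) _ _ iY iZ). Qed.

Lemma jint_sum (I : Type) (r : seq I) D (Y : I -> R -> Omega -> R) : measurable D ->
  (forall i, jint D (Y i)) -> jint D (fun s w => \sum_(i <- r) Y i s w).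
Proof.
move=> mD iY; rewrite /jint (_ : (fun z => _) = fun z => (\sum_(i <- r) (Y i z.1 z.2)%:E)%E).
  by apply: integrable_sum => [|i _]; [exact: measurable_slab|exact: iY].
by apply/funext => z; rewrite sumEFin.
Qed.

Lemma jint_tonelli D Y : measurable D ->
  measurable_fun (D `*` [set: Omega]) (fun z => Y z.1 z.2) ->
  (\int[mu]_(s in D) \int[P]_w `|(Y s w)%:E| < +oo)%E -> jint D Y.
Proof.
move=> mD mY Yoo; apply/integrableP; split; first exact/measurable_EFinP.
rewrite (tonelli_slab1 P (f := fun z => `|(Y z.1 z.2)%:E|)%E)//.
by apply: measurableT_comp => //; exact/measurable_EFinP.
Qed.

Lemma jint_fin D Y : measurable D -> jint D Y ->
  (\int[mu]_(s in D) \int[P]_w `|(Y s w)%:E| < +oo)%E.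
Proof.
move=> mD /[dup] /jint_measurable mY /integrableP[_].
rewrite (tonelli_slab1 P (f := fun z => `|(Y z.1 z.2)%:E|)%E)//.
by apply: measurableT_comp => //; exact/measurable_EFinP.
Qed.

Lemma jint_indic D Y (A : set Omega) : measurable D -> measurable A -> jint D Y ->
  jint D (fun s w => \1_A w * Y s w).
Proof.
move=> mD mA iY; apply: le_integrable (iY); first exact: measurable_slab.
  apply/measurable_EFinP; apply: measurable_funM; last exact: (jint_measurable iY).
  have mI : measurable_fun setT (\1_A : Omega -> R) by exact: measurable_indic.
  by apply: measurable_funTS; exact: (measurableT_comp mI measurable_snd).
move=> z _; rewrite lee_fin normrM ler_piMl// indicE.
by case: (_ \in _); rewrite ?normr1 ?normr0.
Qed.

Lemma measurable_slab_at D Y s : measurable D -> D s ->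
  measurable_fun (D `*` [set: Omega]) (fun z => Y z.1 z.2) -> measurable_fun setT (Y s).
Proof.
move=> mD Ds /(measurable_restrictT _ (measurable_slab mD)) mY.
have := measurableT_comp mY (pair1_measurable s); congr (measurable_fun _ _).
by apply/funext => w /=; rewrite patchE mem_set.
Qed.

Lemma measurable_slab_path D Y w : measurable D ->
  measurable_fun (D `*` [set: Omega]) (fun z => Y z.1 z.2) ->
  measurable_fun D (fun s => Y s w).
Proof.
move=> mD /(measurable_restrictT _ (measurable_slab mD)) mY.
apply/(measurable_restrictT _ mD); have := measurableT_comp mY (pair2_measurable w); congr (measurable_fun _ _).
apply/funext => s /=; rewrite !patchE; congr (if _ then _ else _).
by apply/idP/idP; rewrite !inE //; case.
Qed.

Definition ae_bounded_on D (c : R -> R) := measurable_fun D c /\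
  exists2 K, 0 <= K & \forall s \ae mu, D s -> `|c s| <= K.

(** The bound on c holds for almost every time only, so the comparison is made between the inner
    expectations after Tonelli, not pointwise on the slab. *)
Lemma jint_coef D c Y : measurable D -> ae_bounded_on D c -> jint D Y ->
  jint D (fun s w => c s * Y s w).
Proof.
move=> mD [mc [K K0 cK]] iY; have mY := jint_measurable iY.
have mf : measurable_fun (D `*` [set: Omega]) (fun z => `|(Y z.1 z.2)%:E|%E).
  by apply: measurableT_comp => //; exact/measurable_EFinP.
have mg : measurable_fun D (fun s => \int[P]_w `|(Y s w)%:E|)%E.
  by apply: (measurable_tonelli_slab1 P (f := fun z => `|(Y z.1 z.2)%:E|)%E).
have mcs : measurable_fun (D `*` [set: Omega]) (fun z : R * Omega => c z.1).
  move=> mDT B mB.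
  rewrite (_ : _ `&` _ = (D `&` c @^-1` B) `*` [set: Omega]).
    by apply: measurable_slab; exact: mc.
  by apply/seteqP; split => -[s w] /=; tauto.
apply: jint_tonelli => //; first exact: measurable_funM.
apply: (@le_lt_trans _ _ (\int[mu]_(s in D) (K%:E * \int[P]_w `|(Y s w)%:E|))%E); last first.
  rewrite ge0_integralZl//; last by move=> s _; exact: integral_ge0.
  by rewrite lte_mul_pinfty// jint_fin.
have mcY : measurable_fun D (fun s => \int[P]_w `|(c s * Y s w)%:E|)%E.
  apply: (measurable_tonelli_slab1 P (f := fun z => `|(c z.1 * Y z.1 z.2)%:E|)%E) => //.
  apply: measurableT_comp => //; apply/measurable_EFinP; exact: measurable_funM.
apply: ae_ge0_le_integral => //.
- by move=> s _; exact: integral_ge0.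
- by move=> s _; apply: mule_ge0; [rewrite lee_fin|exact: integral_ge0].
- exact: measurable_funeM.
apply: filterS cK => s cK Ds.
have mYs := measurable_slab_at mD Ds mY.
rewrite -ge0_integralZl//; last first.
  by apply: measurableT_comp => //; exact/measurable_EFinP.
apply: ge0_integral_mono => w _; first exact: abse_ge0.
by rewrite -EFinM lee_fin normrM ler_wpM2r// cK.
Qed.

Lemma jint_ae_path D Y : measurable D -> jint D Y ->
  \forall w \ae P, mu.-integrable D (fun s => (Y s w)%:E).
Proof.
move=> mD /[dup] /jint_measurable mY /integrableP[_].
have mYa : measurable_fun (D `*` [set: Omega]) (fun z => `|(Y z.1 z.2)%:E|%E).
  by apply: measurableT_comp => //; exact/measurable_EFinP.
rewrite (tonelli_slab2 P (f := fun z => `|(Y z.1 z.2)%:E|)%E)// => Yoo.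
have : P.-integrable setT (fun w => \int[mu]_(s in D) `|(Y s w)%:E|)%E.
  apply/integrableP; split.
    exact: (measurable_tonelli_slab2 (f := fun z => `|(Y z.1 z.2)%:E|)%E).
  by under eq_integral do rewrite gee0_abs ?integral_ge0//.
move/(integrable_ae measurableT); apply: filterS => w /(_ I) fY.
apply/integrableP; split; last by rewrite ltey_eq fY.
by apply/measurable_EFinP; exact: (measurable_slab_path w mD mY).
Qed.

Lemma jint_ae_time D Y : measurable D -> jint D Y ->
  \forall s \ae mu, D s -> L1 P (Y s).
Proof.
move=> mD iY; have mY := jint_measurable iY; have Yoo := jint_fin mD iY.
have : mu.-integrable D (fun s => \int[P]_w `|(Y s w)%:E|)%E.
  apply/integrableP; split.
    apply: (measurable_tonelli_slab1 P (f := fun z => `|(Y z.1 z.2)%:E|)%E) => //.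
    by apply: measurableT_comp => //; exact/measurable_EFinP.
  by under eq_integral do rewrite gee0_abs ?integral_ge0//.
move=> h; have := @integrable_ae _ _ _ mu D mD _ h; apply: filterS => s fY Ds.
apply/integrableP; split; last by rewrite ltey_eq fY.
by apply/measurable_EFinP; exact: (measurable_slab_at mD Ds mY).
Qed.

Lemma jint_fubini D Y : measurable D -> jint D Y ->
  [/\ L1 P (fun w => Rintegral mu D (Y ^~ w)),
      mu.-integrable D (fun s => (Ex P (Y s))%:E) &
      Ex P (fun w => Rintegral mu D (Y ^~ w)) = Rintegral mu D (fun s => Ex P (Y s))].
Proof.
move=> mD iY.
pose g := (fun z : R * Omega => (Y z.1 z.2)%:E) \_ (D `*` [set: Omega]).
have ig : (mu \x P)%E.-integrable setT g.
  exact: (@integrable_mkcond _ _ _ (mu \x P)%E _ _ (measurable_slab mD)).1 iY.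
have gE s w : g (s, w) = (((fun s => (Y s w)%:E) \_ D) s)%E.
  rewrite /g !patchE; congr (if _ then _ else _).
  by apply/idP/idP; rewrite !inE //; case.
have Gw w : (\int[mu]_s g (s, w) = \int[mu]_(s in D) (Y s w)%:E)%E.
  by rewrite [RHS]integral_mkcond; apply: eq_integral => s _; exact: gE.
have Fs s : (\int[P]_w g (s, w) = ((fun s => \int[P]_w (Y s w)%:E) \_ D) s)%E.
  rewrite patchE; case: ifPn => sD.
    by apply: eq_integral => w _; rewrite gE patchE sD.
  by rewrite integral0_eq// => w _; rewrite gE patchE (negbTE sD).
have iG : P.-integrable setT (fun w => \int[mu]_(s in D) (Y s w)%:E)%E.
  have mY := jint_measurable iY.
  have mYa : measurable_fun (D `*` [set: Omega]) (fun z => `|(Y z.1 z.2)%:E|%E).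
    by apply: measurableT_comp => //; exact/measurable_EFinP.
  apply/integrableP; split.
    have := @measurable_fubini_G _ _ _ _ R mu P g ig; congr measurable_fun.
    by apply/funext => w; rewrite /fubini_G Gw.
  move/integrableP : iY => [_].
  rewrite (tonelli_slab2 P (f := fun z => `|(Y z.1 z.2)%:E|)%E)//.
  apply: le_lt_trans; apply: ge0_integral_mono => w _; first exact: abse_ge0.
  apply: le_abse_integral => //.
  by apply/measurable_EFinP; exact: (measurable_slab_path w mD mY).
have iF : mu.-integrable D (fun s => \int[P]_w (Y s w)%:E)%E.
  apply: (@integrable_mkcond _ _ _ mu _ _ mD).2.
  have := @integrable_fubini_F _ _ _ _ R mu P g ig; congr integrable.
  by apply/funext => s; rewrite /fubini_F Fs.
have fub : (\int[P]_w \int[mu]_(s in D) (Y s w)%:E = \int[mu]_(s in D) \int[P]_w (Y s w)%:E)%E.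
  transitivity (\int[mu \x P]_z g z)%E.
    rewrite -(@integral21_prod_meas1 _ _ _ _ R mu P g ig).
    by apply: eq_integral => w _; rewrite /fubini_G Gw.
  rewrite -(@integral12_prod_meas1 _ _ _ _ R mu P g ig) [RHS]integral_mkcond.
  by apply: eq_integral => s _; rewrite /fubini_F Fs.
(* [Ex] and [Rintegral] pass through [fine], which sends infinite values to 0. For an integrable
   function this alters a null set only. *)
have finE (d' : measure_display) (T : measurableType d') (m : {measure set T -> \bar R})
    (A : set T) (h : T -> \bar R) : measurable A -> m.-integrable A h ->
    m.-integrable A (fun x => (fine (h x))%:E) /\
    (\int[m]_(x in A) (fine (h x))%:E = \int[m]_(x in A) h x)%E.
  move=> mA ih; have mh := measurable_int m ih.
  have mfh : measurable_fun A (fun x => (fine (h x))%:E).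
    by apply/measurable_EFinP; apply: measurableT_comp.
  split.
    apply: (le_integrable mA mfh _ ih) => x _.
    by case: (h x) => [r| |]; [exact: lexx|rewrite /= normr0 leey|rewrite /= normr0 leey].
  apply: ae_eq_integral => //.
  have := integrable_ae mA ih; apply: filterS => x fx Ax.
  by rewrite fineK ?fx.
have [iG' eG] := finE _ _ P setT _ measurableT iG.
have [iF' eF] := finE _ _ mu D _ mD iF.
split=> //; apply: EFin_inj; rewrite -ExE// eG fub -eF.
by rewrite /Rintegral fineK//; exact: integrable_fin_num iF'.
Qed.

End joint_integrability.

(** * Matrix coefficients and matrix processes *)

Section matrix_coefficients.
Context {R : realType}.
Implicit Types (D : set R) (c : R -> R).

Lemma ler_mx_norm_entry p q (M : 'M[R]_(p, q)) i j : `|M i j| <= `|M|.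
Proof. by rewrite [leRHS]/Num.norm/= mx_normrE; apply: (le_bigmax _ (fun ij => `|M ij.1 ij.2|) (i, j)). Qed.

Lemma ae_bounded_cst D k : measurable D -> ae_bounded_on D (fun=> k).
Proof. by move=> mD; split => //; exists `|k| => //; apply: aeW. Qed.

Lemma ae_boundedD D c c' : ae_bounded_on D c -> ae_bounded_on D c' ->
  ae_bounded_on D (fun s => c s + c' s).
Proof.
move=> [mc [K K0 cK]] [mc' [K' K0' cK']]; split; first exact: measurable_funD.
exists (K + K'); first exact: addr_ge0.
apply: filterS2 cK cK' => s h h' Ds.
by rewrite (le_trans (ler_normD _ _))// lerD ?h ?h'.
Qed.

Lemma ae_boundedM D c c' : ae_bounded_on D c -> ae_bounded_on D c' ->
  ae_bounded_on D (fun s => c s * c' s).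
Proof.
move=> [mc [K K0 cK]] [mc' [K' K0' cK']]; split; first exact: measurable_funM.
exists (K * K'); first exact: mulr_ge0.
apply: filterS2 cK cK' => s h h' Ds.
by rewrite normrM ler_pM ?h ?h'.
Qed.

Lemma ae_bounded_sum (I : Type) (r : seq I) D (c : I -> R -> R) : measurable D ->
  (forall i, ae_bounded_on D (c i)) -> ae_bounded_on D (fun s => \sum_(i <- r) c i s).
Proof.
move=> mD hc; elim: r => [|i r IH].
  rewrite (_ : (fun s => _) = fun=> 0); first exact: ae_bounded_cst.
  by apply/funext => s; rewrite big_nil.
rewrite (_ : (fun s => _) = fun s => c i s + \sum_(j <- r) c j s); first exact: ae_boundedD.
by apply/funext => s; rewrite big_cons.
Qed.

Definition mx_coef D p q (M : R -> 'M[R]_(p, q)) :=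
  forall i j, ae_bounded_on D (fun s => M s i j).

Lemma mx_coefD D p q (M N : R -> 'M[R]_(p, q)) : mx_coef D M -> mx_coef D N ->
  mx_coef D (fun s => M s + N s).
Proof.
move=> hM hN i j; have := ae_boundedD (hM i j) (hN i j).
by congr ae_bounded_on; apply/funext => s; rewrite mxE.
Qed.

Lemma mx_coefM D p q r (M : R -> 'M[R]_(p, q)) (N : R -> 'M[R]_(q, r)) : measurable D ->
  mx_coef D M -> mx_coef D N -> mx_coef D (fun s => M s *m N s).
Proof.
move=> mD hM hN i j.
have := ae_bounded_sum (index_enum 'I_q) mD (fun k => ae_boundedM (hM i k) (hN k j)).
by congr ae_bounded_on; apply/funext => s; rewrite mxE.
Qed.

Lemma mx_coefT D p q (M : R -> 'M[R]_(p, q)) : mx_coef D M -> mx_coef D (fun s => (M s)^T).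
Proof.
move=> hM i j; have := hM j i.
by congr ae_bounded_on; apply/funext => s; rewrite mxE.
Qed.

Lemma mx_coefZ D p q k (M : R -> 'M[R]_(p, q)) : measurable D -> mx_coef D M ->
  mx_coef D (fun s => k *: M s).
Proof.
move=> mD hM i j; have := ae_boundedM (ae_bounded_cst k mD) (hM i j).
by congr ae_bounded_on; apply/funext => s; rewrite mxE.
Qed.

Lemma Linfty_mx_coef T p q (M : R -> 'M[R]_(p, q)) : Linfty T M -> mx_coef `[0, T] M.
Proof.
move=> [mM [K MK]] i j; split => //; exists `|K| => //.
apply: filterS MK => s h; rewrite /= in_itv/= => /h MK.
exact: le_trans (ler_mx_norm_entry _ _ _) (le_trans MK (ler_norm _)).
Qed.

Lemma continuous_mx_coef T p q (M : R -> 'M[R]_(p, q)) : 0 <= T ->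
  {within `[0, T], continuous M} -> mx_coef `[0, T] M.
Proof.
move=> T0 cM i j.
have cMij : {within `[0, T], continuous (fun s => M s i j)}.
  by move=> s; exact: (@cvg_comp _ _ _ _ (fun N : 'M[R]_(p, q) => N i j) _ _ _ (cM s) (@coord_continuous _ _ _ i j _)).
split; first exact: subspace_continuous_measurable_fun.
have [a _ ha] := EVT_max T0 cMij.
have [b _ hb] := EVT_min T0 cMij.
exists (`|M a i j| + `|M b i j|); first exact: addr_ge0.
apply: aeW => s Ds; rewrite ler_norml.
have := ha s Ds; have := hb s Ds; have := ler_norm (M a i j).
have := ler_norm (- M b i j); rewrite normrN.
by have := normr_ge0 (M a i j); have := normr_ge0 (M b i j); lra.
Qed.

End matrix_coefficients.

Section matrix_processes.
Context {d : measure_display} {Omega : measurableType d} {R : realType}.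
Variable P : probability Omega R.
Local Notation mu := (@lebesgue_measure R).
Implicit Types (D E : set R) (A : set Omega).

Definition mjint D p q (Y : R -> Omega -> 'M[R]_(p, q)) :=
  forall i j, jint P D (fun s w => Y s w i j).

Lemma mjintD D p q (Y Z : R -> Omega -> 'M[R]_(p, q)) : measurable D ->
  mjint D Y -> mjint D Z -> mjint D (fun s w => Y s w + Z s w).
Proof.
move=> mD hY hZ i j; have := jintD mD (hY i j) (hZ i j).
by congr jint; apply/funext => s; apply/funext => w; rewrite mxE.
Qed.

Lemma mjintB D p q (Y Z : R -> Omega -> 'M[R]_(p, q)) : measurable D ->
  mjint D Y -> mjint D Z -> mjint D (fun s w => Y s w - Z s w).
Proof.
move=> mD hY hZ i j; have := jintB mD (hY i j) (hZ i j).
by congr jint; apply/funext => s; apply/funext => w; rewrite !mxE.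
Qed.

Lemma mjintM D p q r (M : R -> 'M[R]_(p, q)) (Y : R -> Omega -> 'M[R]_(q, r)) :
  measurable D -> mx_coef D M -> mjint D Y -> mjint D (fun s w => M s *m Y s w).
Proof.
move=> mD hM hY i j.
have := jint_sum (index_enum 'I_q) mD (fun k => jint_coef mD (hM i k) (hY k j)).
by congr jint; apply/funext => s; apply/funext => w; rewrite mxE.
Qed.

Lemma mjintS D E p q (Y : R -> Omega -> 'M[R]_(p, q)) : measurable D -> measurable E ->
  E `<=` D -> mjint D Y -> mjint E Y.
Proof. by move=> mD mE ED hY i j; exact: jintS ED (hY i j). Qed.

Definition mL1 p q (f : Omega -> 'M[R]_(p, q)) := forall i j, L1 P (fun w => f w i j).

(** E[1_A f], entry by entry. For integrable f, these matrices with A ranging over F_t determine E_t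
    f almost surely. *)
Definition mEx p q A (f : Omega -> 'M[R]_(p, q)) : 'M[R]_(p, q) :=
  \matrix_(i, j) Ex P (fun w => \1_A w * f w i j).

Lemma L1_indicM A (f : Omega -> R) : measurable A -> L1 P f -> L1 P (fun w => \1_A w * f w).
Proof.
move=> mA; apply: (@L1M_bounded _ _ _ P _ _ 1); first exact: measurable_indic.
by move=> w; rewrite indicE; case: (_ \in _); rewrite ?normr1 ?normr0.
Qed.

Lemma mL1D p q (f g : Omega -> 'M[R]_(p, q)) : mL1 f -> mL1 g -> mL1 (fun w => f w + g w).
Proof.
move=> hf hg i j; have := L1D (hf i j) (hg i j).
by congr L1; apply/funext => w; rewrite mxE.
Qed.

Lemma mL1B p q (f g : Omega -> 'M[R]_(p, q)) : mL1 f -> mL1 g -> mL1 (fun w => f w - g w).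
Proof.
move=> hf hg i j; have := L1B (hf i j) (hg i j).
by congr L1; apply/funext => w; rewrite !mxE.
Qed.

Lemma mL1M p q r (M : 'M[R]_(p, q)) (f : Omega -> 'M[R]_(q, r)) : mL1 f ->
  mL1 (fun w => M *m f w).
Proof.
move=> hf i j.
have := L1_sum (index_enum 'I_q) (Q := xpredT) (f := fun k w => M i k * f w k j)
  (P := P) (fun k _ => L1Z (M i k) (hf k j)).
by congr L1; apply/funext => w; rewrite mxE.
Qed.

Lemma mExD p q A (f g : Omega -> 'M[R]_(p, q)) : measurable A -> mL1 f -> mL1 g ->
  mEx A (fun w => f w + g w) = mEx A f + mEx A g.
Proof.
move=> mA hf hg; apply/matrixP => i j; rewrite !mxE.
rewrite -ExD; [|exact: L1_indicM|exact: L1_indicM].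
by congr Ex; apply/funext => w; rewrite mxE mulrDr.
Qed.

Lemma mExB p q A (f g : Omega -> 'M[R]_(p, q)) : measurable A -> mL1 f -> mL1 g ->
  mEx A (fun w => f w - g w) = mEx A f - mEx A g.
Proof.
move=> mA hf hg; apply/matrixP => i j; rewrite !mxE.
rewrite -ExB; [|exact: L1_indicM|exact: L1_indicM].
by congr Ex; apply/funext => w; rewrite !mxE mulrBr.
Qed.

Lemma mExM p q r A (M : 'M[R]_(p, q)) (f : Omega -> 'M[R]_(q, r)) : measurable A -> mL1 f ->
  mEx A (fun w => M *m f w) = M *m mEx A f.
Proof.
move=> mA hf; apply/matrixP => i j; rewrite !mxE.
rewrite (_ : (fun w => _) = fun w => \sum_k M i k * (\1_A w * f w k j)); last first.
  by apply/funext => w; rewrite mxE mulr_sumr; apply: eq_bigr => k _; rewrite mulrCA.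
rewrite Ex_sum; last by move=> k; apply: L1Z; exact: L1_indicM.
by apply: eq_bigr => k _; rewrite mxE ExZ//; exact: L1_indicM.
Qed.

Lemma mjint_ae_mL1 D p q (Y : R -> Omega -> 'M[R]_(p, q)) : measurable D -> mjint D Y ->
  \forall s \ae mu, D s -> mL1 (Y s).
Proof.
move=> mD hY.
have : \forall s \ae mu, forall ij : 'I_p * 'I_q, D s -> L1 P (fun w => Y s w ij.1 ij.2).
  by apply: filter_forall => ij; exact: jint_ae_time.
by apply: filterS => s h Ds i j; exact: (h (i, j)).
Qed.

Lemma mjint_fubini D p q (Y : R -> Omega -> 'M[R]_(p, q)) A : measurable D -> measurable A ->
  mjint D Y ->
  [/\ mL1 (fun w => mx_integral D (Y ^~ w)), mx_integrable D (fun s => mEx A (Y s)) &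
      mEx A (fun w => mx_integral D (Y ^~ w)) = mx_integral D (fun s => mEx A (Y s))].
Proof.
move=> mD mA hY.
have F i j := jint_fubini mD (hY i j).
have FA i j := jint_fubini mD (jint_indic mD mA (hY i j)).
split.
- move=> i j; have [h _ _] := F i j.
  by move: h; congr L1; apply/funext => w; rewrite mxE.
- move=> i j; have [_ h _] := FA i j.
  by move: h; congr integrable; apply/funext => s; rewrite mxE.
apply/matrixP => i j; rewrite !mxE; have [_ _ h] := FA i j.
transitivity (Ex P (fun w => Rintegral mu D (fun s => \1_A w * Y s w i j))).
  congr Ex; apply/funext => w; rewrite mxE indicE; case: (_ \in _).
    by rewrite mul1r; apply: eq_Rintegral => s _; rewrite mul1r.
  by rewrite mul0r /Rintegral integral0_eq// => s _; rewrite mul0r.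
by rewrite h; apply: eq_Rintegral => s _; rewrite mxE.
Qed.

End matrix_processes.

(** * Conditional expectations *)

Section conditional_expectation.
Context {d : measure_display} {Omega : measurableType d} {R : realType}.
Variables (P : probability Omega R) (W : R -> Omega -> R).
Hypothesis cP : measure_is_complete P.
Hypothesis bm : standard_brownian_motion P W.
Local Notation F := (augmented_filtration P W).

Lemma Ex_indicE A (f : Omega -> R) : measurable A ->
  Ex P (fun w => \1_A w * f w) = fine (\int[P]_(w in A) (f w)%:E)%E.
Proof.
move=> mA; rewrite /Ex /Rintegral integral_mkcond; congr fine.
rewrite [RHS]integral_mkcond; apply: eq_integral => w _.
rewrite !patchE in_setT indicE; case: (_ \in _); first by rewrite mul1r.
by rewrite mul0r.
Qed.

Lemma condexp_mEx t p q (f g : Omega -> 'M[R]_(p, q)) A :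
  is_condexp P (F t) f g -> F t A -> mEx P A g = mEx P A f.
Proof.
move=> [_ _ _ fg] FA; apply/matrixP => i j; rewrite !mxE.
have mA := augmented_filtration_measurable cP bm FA.
by rewrite !Ex_indicE// fg.
Qed.

(** With B the event that the entry of g is nonnegative, E|g| = E[1_B g] - E[1_(~B) g]. Both events
    lie in F_t, so g may be replaced by f, and the result is at most E|f|. *)
Lemma condexp_contraction t p q (f g : Omega -> 'M[R]_(p, q)) i j :
  is_condexp P (F t) f g ->
  (\int[P]_w `|(g w i j)%:E| <= \int[P]_w `|(f w i j)%:E|)%E.
Proof.
move=> /[dup] fg [f1 g1 mg _].
have FB : F t [set w | 0 <= g w i j].
  have := mg i j `[0, +oo[%classic (measurable_itv _); congr (F t _).
  by apply/seteqP; split => w /=; rewrite in_itv/= andbT.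
have FC : F t (~` [set w | 0 <= g w i j]).
  have := mg i j `]-oo, 0[%classic (measurable_itv _); congr (F t _).
  by apply/seteqP; split => w /=; rewrite in_itv/= ltNge; [move/negP|move/negP].
have mB := augmented_filtration_measurable cP bm FB.
have mC := augmented_filtration_measurable cP bm FC.
set B := [set w | _] in FB FC mB mC.
have e1 := condexp_mEx fg FB; have e2 := condexp_mEx fg FC.
move/matrixP/(_ i j) : e1; move/matrixP/(_ i j) : e2; rewrite !mxE => e2 e1.
have fa := integrable_norm (f1 i j); have ga := integrable_norm (g1 i j).
rewrite (ExE ga) (ExE fa) lee_fin.
have -> : Ex P (fun w => `|g w i j|) = Ex P (fun w => \1_B w * g w i j) - Ex P (fun w => \1_(~` B) w * g w i j).
  rewrite -ExB; [|exact: L1_indicM (g1 i j)|exact: L1_indicM (g1 i j)].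
  congr Ex; apply/funext => w; rewrite !indicE in_setC.
  have [h|h] := boolP (w \in B); rewrite /= mul1r mul0r.
    by rewrite subr0 ger0_norm//; move: h; rewrite inE.
  by rewrite sub0r ltr0_norm// ltNge; apply/negP => h'; move/negP: h; apply; rewrite inE.
rewrite e1 e2 -ExB; [|exact: L1_indicM (f1 i j)|exact: L1_indicM (f1 i j)].
apply: le_Ex => //.
  by apply: L1B; exact: L1_indicM (f1 i j).
move=> w; rewrite !indicE in_setC; case: (w \in B); rewrite /= mul1r mul0r ?subr0 ?sub0r.
  exact: ler_norm.
by rewrite -normrN ler_norm.
Qed.

(** If f is known at t, then g - f is a version of the conditional expectation of 0, and the
    contraction gives E|g - f| = 0. *)
Lemma condexp_ae_eq t p q (f g : Omega -> 'M[R]_(p, q)) :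
  is_condexp P (F t) f g -> (forall i j, measurable_wrt (F t) (fun w => f w i j)) ->
  \forall w \ae P, g w = f w.
Proof.
move=> /[dup] fg [f1 g1 mg efg] mf.
have c0 : is_condexp P (F t) (fun=> 0 : 'M[R]_(p, q)) (fun w => g w - f w).
  split.
  - by move=> i j; rewrite (_ : (fun w => _) = fun=> 0%E); [exact: integrable0|apply/funext => w; rewrite mxE].
  - exact: mL1B.
  - move=> i j; rewrite (_ : (fun w => _) = fun w => g w i j - f w i j).
      exact: measurable_wrtB.
    by apply/funext => w; rewrite !mxE.
  - move=> i j A FA; have mA := augmented_filtration_measurable cP bm FA.
    rewrite [RHS]integral0_eq; last by move=> w _; rewrite mxE.
    under eq_integral do rewrite !mxE EFinB.
    have fA : P.-integrable A (fun w => (f w i j)%:E) by exact: integrableS (f1 i j).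
    have gA : P.-integrable A (fun w => (g w i j)%:E) by exact: integrableS (g1 i j).
    rewrite integralB// efg// subee//.
    exact: integrable_fin_num.
have z i j : (\int[P]_w `|((g w - f w) i j)%:E| = 0)%E.
  apply/eqP; rewrite eq_le integral_ge0// andbT.
  apply: (le_trans (condexp_contraction i j c0)).
  by rewrite integral0_eq// => w _; rewrite mxE abse0.
have : \forall w \ae P, forall ij : 'I_p * 'I_q, ((g w - f w) ij.1 ij.2)%:E = 0%E.
  apply: filter_forall => ij.
  have m : measurable_fun setT (fun w => ((g w - f w) ij.1 ij.2)%:E).
    by apply/measurable_EFinP; exact: L1_measurable (mL1B g1 f1 ij.1 ij.2).
  have := (ae_eq_integral_abs P measurableT m).1 (z _ _).
  by apply: filterS => w /(_ I).
apply: filterS => w h; apply/matrixP => i j; have [] := h (i, j).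
by rewrite !mxE => /eqP; rewrite subr_eq0 => /eqP.
Qed.

End conditional_expectation.

(** * Joint integrability of the process classes *)

Section process_classes.
Context {d : measure_display} {Omega : measurableType d} {R : realType}.
Variables (P : probability Omega R) (W : R -> Omega -> R).
Hypothesis cP : measure_is_complete P.
Hypothesis bm : standard_brownian_motion P W.
Variable T : R.
Local Notation F := (augmented_filtration P W).
Local Notation mu := (@lebesgue_measure R).

Let mT : measurable `[0, T]. Proof. exact: measurable_itv. Qed.

Lemma L2F_C_second_moment p q (X : R -> Omega -> 'M[R]_(p, q)) : L2F_C P F T X ->
  exists2 K, 0 <= K & forall s i j, 0 <= s <= T ->
    L2 P (fun w => X s w i j) /\ (\int[P]_w (X s w i j ^+ 2)%:E <= K%:E)%E.
Proof.
move=> [aX _ Xoo].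
set S := (\int[P]_w _)%E in Xoo.
have le_S s i j : 0 <= s <= T -> (\int[P]_w (X s w i j ^+ 2)%:E <= S)%E.
  move=> sT; apply: ge0_integral_mono => w _; first by rewrite lee_fin sqr_ge0.
  apply: (@le_trans _ _ (`|X s w| ^+ 2)%:E).
    rewrite lee_fin -(real_normK (num_real (X s w i j))) lerXn2r// ?nnegrE//.
    exact: ler_mx_norm_entry.
  by apply: ereal_sup_ubound; exists s.
(* For T < 0 the supremum is over the empty set and [S] is -oo; the absolute value and [fine] keep
   the constant nonnegative in that case too. *)
exists (fine `|S|%E); first exact: fine_ge0.
move=> s i j sT; have := le_S s i j sT.
have I0 : (0 <= \int[P]_w (X s w i j ^+ 2)%:E)%E.
  by apply: integral_ge0 => w _; rewrite lee_fin sqr_ge0.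
have mX : measurable_fun setT (fun w => X s w i j).
  exact: (measurable_wrt_measurable cP bm ((aX i j).2 s sT)).
move=> IS; split; last first.
  rewrite fineK; first exact: (le_trans IS (lee_abs S)).
  by rewrite abse_fin_num ge0_fin_numE// (le_trans I0).
split => //; apply/integrableP; split.
  by apply/measurable_EFinP; exact: measurable_funX.
under eq_integral do rewrite /= ger0_norm ?sqr_ge0//.
exact: le_lt_trans IS Xoo.
Qed.

Lemma L2F_C_mjint p q (X : R -> Omega -> 'M[R]_(p, q)) : L2F_C P F T X -> mjint P `[0, T] X.
Proof.
move=> /[dup] [[aX _ _]] /L2F_C_second_moment[K K0 hK] i j.
apply: jint_tonelli => //; first exact: (aX i j).1.
apply: (@le_lt_trans _ _ (\int[mu]_(s in `[0%R, T]) (1 + K)%:E)%E).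
  apply: ge0_integral_mono => s /=; first by move=> _; exact: integral_ge0.
  rewrite in_itv/= => sT; have [X2 XK] := hK s i j sT.
  have X1 := L2_L1 X2.
  have iX : L1 P (fun w => `|X s w i j|) by exact: integrable_norm X1.
  rewrite ExE// lee_fin.
  move: XK; rewrite (ExE X2.2) lee_fin => XK.
  apply: (@le_trans _ _ (Ex P (fun w => 1 + X s w i j ^+ 2))).
    apply: le_Ex => //; first by apply: L1D; [exact: L1_cst|exact: X2.2].
    move=> w; rewrite -(real_normK (num_real (X s w i j))).
    by have := normr_ge0 (X s w i j); have := sqr_ge0 (`|X s w i j| - 1); nra.
  by rewrite ExD; [rewrite Ex_cst lerD2l|exact: L1_cst|exact: X2.2].
rewrite integral_cst//= lebesgue_measure_itv/= lte_fin.
by case: ifP => _; rewrite ?mule0 ?ltry// -EFinD -EFinM ltry.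
Qed.

Lemma L2F_mjint p q (X : R -> Omega -> 'M[R]_(p, q)) : L2F P F T X -> mjint P `[0, T] X.
Proof.
move=> [aX Xoo] i j; have mX := (aX i j).1.
apply: jint_tonelli => //.
have mXa : measurable_fun (`[0, T]%classic `*` [set: Omega]) (fun z => `|(X z.1 z.2 i j)%:E|%E).
  by apply: measurableT_comp => //; exact/measurable_EFinP.
have mX2 : measurable_fun (`[0, T]%classic `*` [set: Omega]) (fun z => (1 + X z.1 z.2 i j ^+ 2)%:E).
  by apply/measurable_EFinP; apply: measurable_funD => //; exact: measurable_funX.
rewrite -(tonelli_slab1 P (f := fun z => `|(X z.1 z.2 i j)%:E|)%E)//.
apply: (@le_lt_trans _ _ (\int[mu \x P]_(z in `[0%R, T]%classic `*` [set: Omega])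
    (1 + X z.1 z.2 i j ^+ 2)%:E)%E).
  apply: ge0_integral_mono => z _; first exact: abse_ge0.
  rewrite lee_fin -(real_normK (num_real (X z.1 z.2 i j))).
  by have := normr_ge0 (X z.1 z.2 i j); have := sqr_ge0 (`|X z.1 z.2 i j| - 1); nra.
have mS : measurable (`[0, T]%classic `*` [set: Omega]) by exact: measurable_slab.
under eq_integral do rewrite EFinD.
rewrite ge0_integralD//; last 2 first.
- by move=> z _; rewrite lee_fin sqr_ge0.
- by apply/measurable_EFinP; exact: measurable_funX.
apply: lte_add_pinfty.
  rewrite integral_cst// mul1e.
  rewrite /= (@product_measure1E _ _ _ _ _ mu P)//= lebesgue_measure_itv/=.
  have /= -> := probability_setT P; rewrite mule1 lte_fin.
  by case: ifP => _; rewrite ?ltry// -EFinD ltry.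
rewrite (tonelli_slab2 P (f := fun z => (X z.1 z.2 i j ^+ 2)%:E))//; last 2 first.
- by apply/measurable_EFinP; exact: measurable_funX.
- by move=> z _; rewrite lee_fin sqr_ge0.
apply: le_lt_trans Xoo; apply: ge0_integral_mono => w _.
  by apply: integral_ge0 => s _; rewrite lee_fin sqr_ge0.
apply: ge0_integral_mono => s _; first by rewrite lee_fin sqr_ge0.
rewrite lee_fin -(real_normK (num_real (X s w i j))) lerXn2r// ?nnegrE//.
exact: ler_mx_norm_entry.
Qed.

Lemma L2F_L1_mjint p q (X : R -> Omega -> 'M[R]_(p, q)) : L2F_L1 P F T X -> mjint P `[0, T] X.
Proof.
move=> [aX Xoo] i j; have mX := (aX i j).1.
apply: jint_tonelli => //.
have mXa : measurable_fun (`[0, T]%classic `*` [set: Omega]) (fun z => `|(X z.1 z.2 i j)%:E|%E).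
  by apply: measurableT_comp => //; exact/measurable_EFinP.
rewrite -(tonelli_slab1 P (f := fun z => `|(X z.1 z.2 i j)%:E|)%E)//.
rewrite (tonelli_slab2 P (f := fun z => `|(X z.1 z.2 i j)%:E|)%E)//.
have mI := measurable_tonelli_slab2 mT mXa (fun _ _ => abse_ge0 _).
set I := (fun w => _) in mI.
have I0 w : (0 <= I w)%E by exact: integral_ge0.
apply: (@le_lt_trans _ _ (\int[P]_w (1 + I w ^+ 2))%E).
  apply: ge0_integral_mono => w _; first exact: (I0 w).
  rewrite -/(I w); case: (I w) (I0 w) => [x x0| _|//].
    rewrite expe2 -EFinM -EFinD lee_fin.
    by have := sqr_ge0 (x - 1); nra.
  by rewrite addey// leey.
rewrite ge0_integralD//; last 2 first.
- by move=> w _; rewrite expe2 mule_ge0.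
- rewrite (_ : (fun w => I w ^+ 2)%E = (fun w => I w * I w)%E); first exact: emeasurable_funM.
  by apply/funext => w; rewrite expe2.
apply: lte_add_pinfty.
  by rewrite integral_cst// mul1e; have /= -> := probability_setT P; rewrite ltry.
apply: le_lt_trans Xoo; apply: ge0_integral_mono => w _.
  by rewrite expe2 mule_ge0.
have h : (I w <= \int[mu]_(s in `[0%R, T]) (`|X s w|)%:E)%E.
  apply: ge0_integral_mono => s _; first exact: abse_ge0.
  by rewrite lee_fin ler_mx_norm_entry.
by rewrite !expe2 lee_pmul.
Qed.

(** [tau s] is the time of conditioning: constant for E_t, the identity for the diagonal s |-> E_s.
    At almost every s the variable U(s) is integrable and the contraction applies. *)
Lemma condexp_mjint p q (U V : R -> Omega -> 'M[R]_(p, q)) (tau : R -> R) :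
  adapted_measurable F T V -> mjint P `[0, T] U ->
  (forall s, 0 <= s <= T -> rv_integrable P (U s) -> is_condexp P (F (tau s)) (U s) (V s)) ->
  mjint P `[0, T] V.
Proof.
move=> aV jU cUV i j; have mV := (aV i j).1; apply: jint_tonelli => //.
have mVa : measurable_fun (`[0, T]%classic `*` [set: Omega]) (fun z => `|(V z.1 z.2 i j)%:E|%E).
  by apply: measurableT_comp => //; exact/measurable_EFinP.
have mUa : measurable_fun (`[0, T]%classic `*` [set: Omega]) (fun z => `|(U z.1 z.2 i j)%:E|%E).
  have mU := jint_measurable (jU i j).
  by apply: measurableT_comp => //; exact/measurable_EFinP.
apply: le_lt_trans (jint_fin mT (jU i j)).
apply: ae_ge0_le_integral => //.
- by move=> s _; exact: integral_ge0.
- exact: (measurable_tonelli_slab1 P (f := fun z => `|(V z.1 z.2 i j)%:E|)%E).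
- by move=> s _; exact: integral_ge0.
- exact: (measurable_tonelli_slab1 P (f := fun z => `|(U z.1 z.2 i j)%:E|)%E).
have := mjint_ae_mL1 mT jU; apply: filterS => s hs /[dup] Ds /hs Us.
apply: (condexp_contraction cP bm i j (cUV s _ Us)).
by move: Ds; rewrite /= in_itv/=.
Qed.

End process_classes.

(** * Stochastic differentials: means and uniqueness *)

Section stochastic_differentials.
Context {d : measure_display} {Omega : measurableType d} {R : realType}.
Variables (P : probability Omega R) (W : R -> Omega -> R).
Hypothesis cP : measure_is_complete P.
Hypothesis bm : standard_brownian_motion P W.
Variable T : R.
Hypothesis T0 : 0 <= T.
Local Notation F := (augmented_filtration P W).
Local Notation mu := (@lebesgue_measure R).
Local Notation kappa := (fine (@gauss_second_moment R)).

Let mT : measurable `[0, T]. Proof. exact: measurable_itv. Qed.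

Let sub_0T (a b : R) : 0 <= a -> b <= T -> `[a, b]%classic `<=` `[0, T]%classic.
Proof.
move=> a0 bT s /=; rewrite !in_itv/= => /andP[as_ sb].
by rewrite (le_trans a0)// (le_trans sb).
Qed.

Lemma mEx_ae_eq p q A (f g : Omega -> 'M[R]_(p, q)) : measurable A -> mL1 P f -> mL1 P g ->
  (\forall w \ae P, f w = g w) -> mEx P A f = mEx P A g.
Proof.
move=> mA f1 g1 fg; apply/matrixP => i j; rewrite !mxE /Ex /Rintegral; congr fine.
apply: ae_eq_integral => //.
- by apply/measurable_EFinP; exact: L1_measurable (L1_indicM mA (f1 i j)).
- by apply/measurable_EFinP; exact: L1_measurable (L1_indicM mA (g1 i j)).
by apply: filterS fg => w -> _.
Qed.

Lemma Rintegral_itv_split (t s : R) (f : R -> R) : 0 <= t <= s ->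
  mu.-integrable `[0, s] (fun r => (f r)%:E) ->
  Rintegral mu `[0, s] f = Rintegral mu `[0, t] f + Rintegral mu `[t, s] f.
Proof.
move=> /andP[t0 ts] fi; apply/eqP; rewrite addrC -subr_eq; apply/eqP.
rewrite Rintegral_itvB//.
apply: Rintegral_itv_obnd_cbnd; apply: integrableS fi => //.
by move=> r /=; rewrite !in_itv/= => /andP[tr ->]; rewrite (le_trans t0 (ltW tr)).
Qed.

Lemma mx_integral_itv_split p q (t s : R) (f : R -> 'M[R]_(p, q)) : 0 <= t <= s ->
  mx_integrable `[0, s] f ->
  mx_integral `[0, s] f = mx_integral `[0, t] f + mx_integral `[t, s] f.
Proof. by move=> ts fi; apply/matrixP => i j; rewrite !mxE; exact: Rintegral_itv_split. Qed.

Lemma mx_integrable_0 p q s (f : R -> 'M[R]_(p, q)) : s <= T ->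
  mx_integrable `[0, T] f -> mx_integrable `[0, s] f.
Proof. by move=> sT fi i j; apply: integrableS (fi i j) => //; exact: sub_0T. Qed.

(** The stochastic integral has centred increments on A, and Fubini moves the mean inside the drift:
    means over A obey an ordinary integral equation. *)
Lemma sde_mEx p q (X beta zeta : R -> Omega -> 'M[R]_(p, q)) t s A :
  ito_differential P W T X beta zeta -> mjint P `[0, T] beta ->
  (forall r, 0 <= r <= T -> mL1 P (X r)) -> 0 <= t <= s -> s <= T -> F t A ->
  mEx P A (X s) = mEx P A (X t) + mx_integral `[t, s] (fun r => mEx P A (beta r)).
Proof.
move=> [bi [I [[_ aI _ hI] XE]]] jb X1 /[dup] ts /andP[t0 ts'] sT FA.
have mA := augmented_filtration_measurable cP bm FA.
have s0T : 0 <= s <= T by rewrite sT (le_trans t0).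
have t0T : 0 <= t <= T by rewrite t0 (le_trans ts').
have mI r i j : 0 <= r <= T -> measurable_fun setT (fun w => I r w i j).
  by move=> rT; exact: (measurable_wrt_measurable cP bm ((aI i j).2 r rT)).
have I2 r i j : 0 <= r <= T -> L2 P (fun w => I r w i j).
  move=> rT; have [h hh] := hI i j.
  by apply: (approximates_L2 cP bm (I := fun r w => I r w i j) rT hh); exact: mI.
have Id1 : mL1 P (fun w => I s w - I t w).
  by apply: mL1B => i j; apply: L2_L1; exact: I2.
have mts : measurable `[t, s] by exact: measurable_itv.
have jts : mjint P `[t, s] beta by apply: (mjintS mT mts) jb; exact: sub_0T.
have [J1 _ JE] := mjint_fubini mts mA jts.
rewrite -JE; apply/eqP; rewrite addrC -subr_eq; apply/eqP.
rewrite -mExB//; [|exact: X1|exact: X1].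
rewrite (@mEx_ae_eq _ _ _ _ (fun w => mx_integral `[t, s] (beta ^~ w) + (I s w - I t w)))//.
- rewrite mExD// (_ : mEx P A (fun w => I s w - I t w) = 0) ?addr0//.
  apply/matrixP => i j; rewrite !mxE.
  have [h hh] := hI i j.
  rewrite -[RHS](approximates_centered cP bm (I := fun r w => I r w i j) hh ts sT _ FA); last first.
    by move=> r rT; exact: mI.
  by congr Ex; apply/funext => w; rewrite !mxE.
- by apply: mL1B; exact: X1.
- exact: mL1D.
apply: filterS2 bi XE => w bi XE; rewrite (XE s s0T) (XE t t0T).
rewrite (mx_integral_itv_split ts (mx_integrable_0 sT bi)).
have E (a b c u v : 'M[R]_(p, q)) : a + (b + c) + u - (a + b + v) = c + (u - v).
  by rewrite opprD addrACA (addrA a) [a + b + c]addrC addrK.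
exact: E.
Qed.

Lemma sqr_sum_le (I : finType) (a : I -> R) :
  (\sum_i a i) ^+ 2 <= #|I|%:R * \sum_i a i ^+ 2.
Proof.
rewrite expr2 mulr_suml.
apply: (@le_trans _ _ (\sum_i \sum_j (a i ^+ 2 / 2 + a j ^+ 2 / 2))).
  apply: ler_sum => i _; rewrite mulr_sumr; apply: ler_sum => j _.
  by have := sqr_ge0 (a i - a j); rewrite sqrrB; lra.
under eq_bigr do rewrite big_split/= sumr_const.
rewrite big_split/= sumr_const sumrMnl -mulr_suml.
by rewrite -[X in X + _ <= _]mulr_natl -[X in _ + X <= _]mulr_natl -mulrDr -splitr.
Qed.

(** [integral_sqr3] with third term 0 separates drift and noise at the price of a factor 3.
    Cauchy-Schwarz in time contributes s <= T to the drift, [ito_diff_estimate] contributes 9 kappa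
    to the noise. *)
Lemma sde_diff_second_moment p q (X beta zeta X' beta' zeta' : R -> Omega -> 'M[R]_(p, q)) s i j :
  ito_differential P W T X beta zeta -> ito_differential P W T X' beta' zeta' ->
  mjint P `[0, T] beta -> mjint P `[0, T] beta' ->
  (\forall w \ae P, X 0 w = X' 0 w) -> 0 <= s <= T ->
  measurable_fun setT (fun w => X s w i j - X' s w i j) ->
  (\int[P]_w ((X s w i j - X' s w i j) ^+ 2)%:E <=
   (3 * T)%:E * \int[mu]_(r in `[0%R, s]) \int[P]_w ((beta r w i j - beta' r w i j) ^+ 2)%:E +
   (27 * kappa)%:E * \int[mu]_(r in `[0%R, s]) \int[P]_w ((zeta r w i j - zeta' r w i j) ^+ 2)%:E)%E.
Proof.
move=> [bi [I [[zL aI _ hI] XE]]] [bi' [I' [[zL' aI' _ hI'] XE']]] jb jb' X0 /[dup] s0T /andP[s0 sT] mX.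
have ms : measurable `[0, s] by exact: measurable_itv.
have mI : measurable_fun setT (fun w => I s w i j).
  exact: (measurable_wrt_measurable cP bm ((aI i j).2 s s0T)).
have mI' : measurable_fun setT (fun w => I' s w i j).
  exact: (measurable_wrt_measurable cP bm ((aI' i j).2 s s0T)).
have [h hh] := hI i j; have [h' hh'] := hI' i j.
have mz := (zL.1 i j).1; have mz' := (zL'.1 i j).1.
have est := ito_diff_estimate cP bm (H := fun r w => zeta r w i j) (H' := fun r w => zeta' r w i j)
  (I := fun r w => I r w i j) (I' := fun r w => I' r w i j) s0T mz mz' mI mI' hh hh'.
have jd : jint P `[0, s] (fun r w => beta r w i j - beta' r w i j).
  by apply: (jintS mT ms (sub_0T (lexx _) sT)); apply: jintB.
have mzd : measurable_fun (`[0, s]%classic `*` [set: Omega]) (fun z => zeta z.1 z.2 i j - zeta' z.1 z.2 i j).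
  apply: measurable_funB; [apply: measurable_funS mz|apply: measurable_funS mz'];
    try exact: measurable_slab; by move=> z [h1 h2]; split => //; exact: sub_0T h1.
have sq (f : R -> Omega -> R) : measurable_fun (`[0, s]%classic `*` [set: Omega]) (fun z : R * Omega => f z.1 z.2) ->
    (\int[P]_w \int[mu]_(r in `[0%R, s]) (f r w ^+ 2)%:E =
     \int[mu]_(r in `[0%R, s]) \int[P]_w (f r w ^+ 2)%:E)%E.
  move=> mf.
  have mf2 : measurable_fun (`[0, s]%classic `*` [set: Omega]) (fun z : R * Omega => (f z.1 z.2 ^+ 2)%:E).
    by apply/measurable_EFinP; exact: measurable_funX.
  rewrite -(tonelli_slab2 P (f := fun z => (f z.1 z.2 ^+ 2)%:E))//; last by move=> z _; rewrite lee_fin sqr_ge0.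
  by rewrite -(tonelli_slab1 P (f := fun z => (f z.1 z.2 ^+ 2)%:E))// => z _; rewrite lee_fin sqr_ge0.
rewrite (sq (fun r w => zeta r w i j - zeta' r w i j))// in est.
have [JB _ _] := jint_fubini ms jd.
set B := (fun w => _) in JB.
have mB := L1_measurable JB.
apply: (@le_trans _ _ (\int[P]_w ((B w + (I s w i j - I' s w i j) - 0) ^+ 2)%:E)%E).
  apply: ae_ge0_le_integral => //.
  - by move=> w _; rewrite lee_fin sqr_ge0.
  - by apply/measurable_EFinP; exact: measurable_funX.
  - by move=> w _; rewrite lee_fin sqr_ge0.
  - apply/measurable_EFinP; apply: measurable_funX; apply: measurable_funB => //.
    by apply: measurable_funD => //; exact: measurable_funB.
  have fP := ae_probability_filter P.
  apply: filterS3 (@filterI _ _ fP _ _ bi bi') (@filterI _ _ fP _ _ XE XE') X0 => w [bi1 bi2] [E1 E2] E0 _.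
  rewrite (E1 s s0T) (E2 s s0T) E0 !mxE subr0 lee_fin.
  rewrite le_eqVlt; apply/orP; left; apply/eqP; congr (_ ^+ 2).
  rewrite /B RintegralB//; last 2 first.
  - exact: mx_integrable_0 sT bi1 i j.
  - exact: mx_integrable_0 sT bi2 i j.
  ring.
have sqr3 := @integral_sqr3 _ _ _ P setT B (fun w => I s w i j - I' s w i j) (fun=> 0)
  measurableT mB (measurable_funB mI mI') (measurable_cst _).
apply: (le_trans sqr3).
rewrite expr0n/= integral0 adde0 ge0_muleDr; last 2 first.
- by apply: integral_ge0 => w _; rewrite lee_fin sqr_ge0.
- by apply: integral_ge0 => w _; rewrite lee_fin sqr_ge0.
apply: leeD.
  rewrite EFinM -muleA; apply: lee_wpmul2l; first by rewrite lee_fin.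
  rewrite -(sq (fun r w => beta r w i j - beta' r w i j)); last exact: (jint_measurable jd).
  have mb2 : measurable_fun (`[0, s]%classic `*` [set: Omega])
      (fun z => ((beta z.1 z.2 i j - beta' z.1 z.2 i j) ^+ 2)%:E).
    by apply/measurable_EFinP; apply: measurable_funX; exact: (jint_measurable jd).
  rewrite -ge0_integralZl//; last 2 first.
  - by apply: (measurable_tonelli_slab2 ms mb2) => z _; rewrite lee_fin sqr_ge0.
  - by move=> w _; apply: integral_ge0 => r _; rewrite lee_fin sqr_ge0.
  apply: ae_ge0_le_integral => //.
  - by move=> w _; rewrite lee_fin sqr_ge0.
  - by apply/measurable_EFinP; exact: measurable_funX.
  - move=> w _; apply: mule_ge0; first by rewrite lee_fin.
    by apply: integral_ge0 => r _; rewrite lee_fin sqr_ge0.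
  - apply: measurable_funeM.
    by apply: (measurable_tonelli_slab2 ms mb2) => z _; rewrite lee_fin sqr_ge0.
  apply: filterS (jint_ae_path ms jd) => w iw _.
  apply: (le_trans (sqr_Rintegral_le s0 iw)).
  apply: lee_wpmul2r; last by rewrite lee_fin.
  by apply: integral_ge0 => r _; rewrite lee_fin sqr_ge0.
have -> : 27 * kappa = 3 * (9 * kappa) by ring.
rewrite [X in (_ <= X * _)%E]EFinM -muleA; apply: lee_wpmul2l => //.
Qed.

Lemma mx_coef_bound D p q (M : R -> 'M[R]_(p, q)) : mx_coef D M ->
  exists2 K, 0 <= K & \forall s \ae mu, D s -> forall i j, `|M s i j| <= K.
Proof.
move=> hM.
have /fin_all_exists[K hK] : forall ij : 'I_p * 'I_q, exists K, 0 <= K /\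
    \forall s \ae mu, D s -> `|M s ij.1 ij.2| <= K.
  by move=> ij; have [_ [K K0 h]] := hM ij.1 ij.2; exists K.
exists (\sum_ij K ij); first by apply: sumr_ge0 => ij _; exact: (hK ij).1.
have : \forall s \ae mu, forall ij, D s -> `|M s ij.1 ij.2| <= K ij.
  by apply: filter_forall => ij; exact: (hK ij).2.
apply: filterS => s h Ds i j; apply: (le_trans (h (i, j) Ds)).
rewrite (bigD1 (i, j))//= lerDl; apply: sumr_ge0 => ij _; exact: (hK ij).1.
Qed.

Lemma sqr_mulmx_le p q (M : 'M[R]_p) (V : 'M[R]_(p, q)) K i j : 0 <= K ->
  (forall i j, `|M i j| <= K) ->
  (M *m V) i j ^+ 2 <= p%:R * K ^+ 2 * \sum_(kl : 'I_p * 'I_q) V kl.1 kl.2 ^+ 2.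
Proof.
move=> K0 MK; rewrite mxE; apply: (le_trans (sqr_sum_le _)).
rewrite card_ord -mulrA ler_wpM2l// -(pair_bigA _ (fun k l => V k l ^+ 2))/= mulr_sumr.
apply: ler_sum => k _; rewrite exprMn.
apply: ler_pM => //; rewrite ?sqr_ge0//.
  by rewrite -(real_normK (num_real (M i k))) lerXn2r// nnegrE.
rewrite (bigD1 j)//= lerDl; apply: sumr_ge0 => l _; exact: sqr_ge0.
Qed.

(** The two equations are compared on [0, t] alone: there the differences of drift and of diffusion
    are linear in X - X'. The sum of the second moments of the entries of X - X' is then bounded and
    satisfies the inequality of [gronwall0]. *)
Lemma sde_unique p q (X beta zeta X' beta' zeta' : R -> Omega -> 'M[R]_(p, q))
    (MA MC : R -> 'M[R]_p) t :
  L2F_C P F T X -> L2F_C P F T X' ->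
  ito_differential P W T X beta zeta -> ito_differential P W T X' beta' zeta' ->
  mjint P `[0, T] beta -> mjint P `[0, T] beta' ->
  L2F P F T zeta -> L2F P F T zeta' ->
  (\forall w \ae P, X 0 w = X' 0 w) -> 0 <= t <= T ->
  mx_coef `[0, T] MA -> mx_coef `[0, T] MC ->
  (\forall r \ae mu, 0 <= r <= t ->
     \forall w \ae P, beta r w - beta' r w = MA r *m (X r w - X' r w)) ->
  (\forall r \ae mu, 0 <= r <= t ->
     \forall w \ae P, zeta r w - zeta' r w = MC r *m (X r w - X' r w)) ->
  \forall w \ae P, X t w = X' t w.
Proof.
move=> LX LX' dX dX' jb jb' Lz Lz' X0 /[dup] t0T /andP[t0 tT] cA cC hb hz.
have [KX KX0 hX] := L2F_C_second_moment cP bm LX.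
have [KX' KX'0 hX'] := L2F_C_second_moment cP bm LX'.
have jX := L2F_C_mjint cP bm LX; have jX' := L2F_C_mjint cP bm LX'.
pose D r w := X r w - X' r w.
have DE r w i j : D r w i j = X r w i j - X' r w i j by rewrite !mxE.
have jD : mjint P `[0, T] D by exact: mjintB.
have mD i j := jint_measurable (jD i j).
have mD2 i j : measurable_fun (`[0, T]%classic `*` [set: Omega]) (fun z => (D z.1 z.2 i j ^+ 2)%:E).
  by apply/measurable_EFinP; exact: measurable_funX.
have mDr r i j : 0 <= r <= T -> measurable_fun setT (fun w => D r w i j).
  move=> rT; have Dr : `[0, T]%classic r by rewrite /= in_itv.
  exact: (measurable_slab_at (Y := fun r w => D r w i j) mT Dr (mD i j)).
pose g r := (\sum_(ij : 'I_p * 'I_q) \int[P]_w (D r w ij.1 ij.2 ^+ 2)%:E)%E.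
have g0 r : (0 <= g r)%E.
  by apply: sume_ge0 => ij _; apply: integral_ge0 => w _; rewrite lee_fin sqr_ge0.
have mg : measurable_fun `[0, T] g.
  apply: emeasurable_sum => ij.
  by apply: (measurable_tonelli_slab1 P mT (mD2 ij.1 ij.2)) => z _; rewrite lee_fin sqr_ge0.
have gsum r : 0 <= r <= T ->
    g r = (\int[P]_w (\sum_(ij : 'I_p * 'I_q) D r w ij.1 ij.2 ^+ 2)%:E)%E.
  move=> rT; under eq_integral do rewrite -sumEFin.
  rewrite ge0_integral_sum//.
  - by move=> ij; apply/measurable_EFinP/measurable_funX; exact: mDr.
  - by move=> ij w _; rewrite lee_fin sqr_ge0.
have gM r : 0 <= r <= T -> (g r <= ((p * q)%:R * (3 * (KX + KX')))%:E)%E.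
  move=> rT; apply: (@le_trans _ _ (\sum_(ij : 'I_p * 'I_q) (3 * (KX + KX'))%:E)%E).
    apply: lee_sum => ij _; have [X2 XK] := hX r ij.1 ij.2 rT; have [X2' XK'] := hX' r ij.1 ij.2 rT.
    have := @integral_sqr3 _ _ _ P setT _ (fun=> 0) _ measurableT X2.1 (measurable_cst _) X2'.1.
    rewrite expr0n/= integral0 adde0.
    under eq_integral do rewrite addr0 -DE.
    move=> /le_trans; apply; rewrite [leRHS]EFinM; apply: lee_wpmul2l; first by rewrite lee_fin.
    by rewrite EFinD; exact: leeD.
  by rewrite sumEFin sumr_const card_prod !card_ord lee_fin -[leLHS]mulr_natl.
(* Used once for the drift and once for the diffusion, both of which differ by a coefficient times X
   - X'. *)
have key (M : R -> 'M[R]_p) (gam gam' : R -> Omega -> 'M[R]_(p, q)) : mx_coef `[0, T] M ->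
    (forall i j, measurable_fun (`[0, T]%classic `*` [set: Omega]) (fun z => gam z.1 z.2 i j)) ->
    (forall i j, measurable_fun (`[0, T]%classic `*` [set: Omega]) (fun z => gam' z.1 z.2 i j)) ->
    (\forall r \ae mu, 0 <= r <= t ->
     \forall w \ae P, gam r w - gam' r w = M r *m (X r w - X' r w)) ->
    exists2 C, 0 <= C & forall i j s, 0 <= s <= t ->
      (\int[mu]_(r in `[0%R, s]) \int[P]_w ((gam r w i j - gam' r w i j) ^+ 2)%:E <=
       C%:E * \int[mu]_(r in `[0%R, s]) g r)%E.
  move=> /mx_coef_bound[K K0 MK] mga mga' hg.
  have C0 : 0 <= p%:R * K ^+ 2 by rewrite mulr_ge0// sqr_ge0.
  exists (p%:R * K ^+ 2) => // i j s /andP[s0 st].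
  have sT := le_trans st tT.
  have ms : measurable `[0, s] by exact: measurable_itv.
  have ss := sub_0T (lexx _) sT.
  have ssl : `[0, s]%classic `*` [set: Omega] `<=` `[0, T]%classic `*` [set: Omega].
    by move=> z [h1 h2]; split => //; exact: ss.
  have mslT := measurable_slab (Omega := Omega) mT.
  have mgg : measurable_fun (`[0, T]%classic `*` [set: Omega]) (fun z => gam z.1 z.2 i j - gam' z.1 z.2 i j).
    exact: measurable_funB.
  have mgs : measurable_fun `[0, s] g by exact: measurable_funS mg.
  rewrite -ge0_integralZl//.
  apply: ae_ge0_le_integral => //.
  - by move=> r _; apply: integral_ge0 => w _; rewrite lee_fin sqr_ge0.
  - apply: (measurable_tonelli_slab1 P ms (f := fun z => ((gam z.1 z.2 i j - gam' z.1 z.2 i j) ^+ 2)%:E)).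
      by apply/measurable_EFinP; apply: measurable_funX; exact: measurable_funS mgg.
    by move=> z _; rewrite lee_fin sqr_ge0.
  - by move=> r _; rewrite mule_ge0.
  - exact: measurable_funeM.
  apply: filterS2 MK hg => r MK hg Dr.
  have rT := ss _ Dr; have {}MK := MK rT.
  move: Dr rT; rewrite /= !in_itv/= => /andP[r0 rs] rT.
  have {}hg := hg _; rewrite r0 (le_trans rs st) in hg; have {}hg := hg isT.
  rewrite gsum//.
  have ms2 : measurable_fun setT (fun w => (\sum_(ij : 'I_p * 'I_q) D r w ij.1 ij.2 ^+ 2)%:E).
    apply/measurable_EFinP; apply: measurable_sum => ij.
    by apply: measurable_funX; exact: mDr.
  have s20 w : (0 <= (\sum_(ij : 'I_p * 'I_q) D r w ij.1 ij.2 ^+ 2)%:E)%E.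
    by rewrite lee_fin sumr_ge0// => ij _; exact: sqr_ge0.
  rewrite -ge0_integralZl//.
  apply: ae_ge0_le_integral => //.
  - by move=> w _; rewrite lee_fin sqr_ge0.
  - apply/measurable_EFinP; apply: measurable_funX.
    have Dr : `[0, T]%classic r by rewrite /= in_itv.
    exact: (measurable_slab_at (Y := fun r w => gam r w i j - gam' r w i j) mT Dr mgg).
  - by move=> w _; rewrite mule_ge0.
  - exact: measurable_funeM.
  apply: filterS hg => w hg _; rewrite -EFinM lee_fin.
  have -> : gam r w i j - gam' r w i j = (M r *m D r w) i j.
    by rewrite -[in RHS]/(X r w - X' r w) -hg !mxE.
  exact: sqr_mulmx_le.
have [CA CA0 hA] := key _ _ _ cA (fun i j => jint_measurable (jb i j)) (fun i j => jint_measurable (jb' i j)) hb.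
have [CC CC0 hC] := key _ _ _ cC (fun i j => (Lz.1 i j).1) (fun i j => (Lz'.1 i j).1) hz.
have k0 : 0 <= kappa := gauss_second_moment_ge0.
have gt : g t = 0%E.
  (* The estimate of [sde_diff_second_moment], summed over the p q entries. *)
  apply: (@gronwall0 _ 0 t ((p * q)%:R * (3 * T * CA + 27 * kappa * CC)) _ g t0 _ _ _ _ t).
  - by rewrite mulr_ge0// addr_ge0// !mulr_ge0.
  - by [].
  - by move=> s /andP[s0 st]; apply: gM; rewrite s0 (le_trans st).
  - move=> s /[dup] s0t /andP[s0 st].
    have s0T : 0 <= s <= T by rewrite s0 (le_trans st).
    have Ig : (0 <= \int[mu]_(r in `[0%R, s]) g r)%E by exact: integral_ge0.
    apply: (@le_trans _ _ (\sum_(ij : 'I_p * 'I_q)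
       ((3 * T * CA + 27 * kappa * CC)%:E * \int[mu]_(r in `[0%R, s]) g r))%E).
      apply: lee_sum => ij _.
      under eq_integral do rewrite DE.
      apply: (le_trans (sde_diff_second_moment dX dX' jb jb' X0 s0T _)).
        by apply: measurable_funB; [exact: (hX s _ _ s0T).1.1|exact: (hX' s _ _ s0T).1.1].
      rewrite EFinD ge0_muleDl ?lee_fin ?mulr_ge0// !(EFinM _ CA) !(EFinM _ CC) -!muleA.
      apply: leeD; apply: lee_wpmul2l; rewrite ?lee_fin ?mulr_ge0//; [exact: hA|exact: hC].
    rewrite -ge0_sume_distrl; last by move=> ij _; rewrite lee_fin addr_ge0 // !mulr_ge0.
    by rewrite sumEFin sumr_const card_prod !card_ord -[X in (X%:E * _ <= _)%E]mulr_natl.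
  - by rewrite t0 lexx.
have : \forall w \ae P, forall ij : 'I_p * 'I_q, D t w ij.1 ij.2 = 0.
  apply: filter_forall => ij.
  have z : (\int[P]_w `|(D t w ij.1 ij.2 ^+ 2)%:E| = 0)%E.
    apply/eqP; rewrite eq_le integral_ge0// andbT -gt /g (bigD1 ij)//=.
    under eq_integral do rewrite /= ger0_norm ?sqr_ge0//.
    rewrite leeDl//; apply: sume_ge0 => kl _; apply: integral_ge0 => w _.
    by rewrite lee_fin sqr_ge0.
  have mD2t : measurable_fun setT (fun w => (D t w ij.1 ij.2 ^+ 2)%:E).
    by apply/measurable_EFinP/measurable_funX; exact: mDr.
  have := (ae_eq_integral_abs P measurableT mD2t).1 z.
  by apply: filterS => w /(_ I) [] /eqP; rewrite sqrf_eq0 => /eqP.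
apply: filterS => w h; apply/matrixP => i j; apply/eqP; rewrite -subr_eq0 -DE; apply/eqP.
exact: (h (i, j)).
Qed.

End stochastic_differentials.

(** * Maximal inequality *)

Section vanishing_quotient.
Context {d : measure_display} {Omega : measurableType d} {R : realType}.
Variables (P : probability Omega R) (W : R -> Omega -> R).
Hypothesis cP : measure_is_complete P.
Hypothesis bm : standard_brownian_motion P W.
Variable t : R.
Local Notation F := (augmented_filtration P W).

(* Doob-type argument: split the event according to the first index n at which
   delta (e n) exceeds eta * e n, which is known at time t. *)
Lemma maximal_inequality (delta : R -> Omega -> R) (K : Omega -> R) (e : nat -> R) (eta : R) :
  0 < eta -> (forall n, 0 < e n) ->
  (forall n, measurable_wrt (F t) (delta (e n))) -> (forall n, L1 P (delta (e n))) ->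
  L1 P K -> (forall w, 0 <= K w) ->
  (forall n A, F t A -> Ex P (fun w => \1_A w * delta (e n) w) <= e n * Ex P (fun w => \1_A w * K w)) ->
  (eta%:E * P (\bigcup_n [set w | (eta * e n < delta (e n) w)%R]) <= (Ex P K)%:E)%E.
Proof.
move=> eta0 e0 md d1 K1 K0 dK.
pose S n := [set w | eta * e n < delta (e n) w].
have FS n : F t (S n).
  have := md n `]eta * e n, +oo[%classic (measurable_itv _); congr (F t _).
  by apply/seteqP; split => w /=; rewrite in_itv/= andbT.
have [F0 FC FU] := smallest_sigma_algebra setT (natural_filtration W t `|` [set N | P.-negligible N]).
have FCC A : F t A -> F t (~` A) by move=> /FC; rewrite setTD.
have FU2 A B : F t A -> F t B -> F t (A `|` B).
  move=> FA FB; rewrite -bigcup2E; apply: FU => -[|[|n]] //=.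
have FD A B : F t A -> F t B -> F t (A `\` B).
  move=> FA FB; rewrite setDE -[A]setCK -setCU; apply: (FCC) => //; apply: FU2 => //; exact: (FCC).
have FB n : F t (seqDU S n).
  rewrite /seqDU; apply: FD => //; elim: n => [|n IH]; first by rewrite big_ord0.
  by rewrite big_ord_recr/=; exact: FU2.
have mS A : F t A -> measurable A by exact: (augmented_filtration_measurable cP bm).
have mB n : measurable (seqDU S n) := mS _ (FB n).
have tB := trivIset_seqDU S.
have mKE : measurable_fun setT (EFin \o K) by apply/measurable_EFinP; exact: L1_measurable K1.
rewrite [\bigcup_n _](_ : _ = \bigcup_n seqDU S n); last by rewrite -seqDU_bigcup_eq.
rewrite measure_semi_bigcup//; last exact: bigcup_measurable.
rewrite -nneseriesZl//.
apply: (@le_trans _ _ (\sum_(0 <= n <oo) \int[P]_(w in seqDU S n) (K w)%:E)%E).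
  apply: lee_nneseries => n _ /=; first by rewrite mule_ge0// lee_fin ltW.
  have KB : (\int[P]_(w in seqDU S n) (K w)%:E = (Ex P (fun w => \1_(seqDU S n) w * K w))%:E)%E.
    rewrite Ex_indicE// fineK//; apply: integrable_fin_num => //.
    exact: integrableS K1.
  have PB : P (seqDU S n) = (Ex P (fun w => \1_(seqDU S n) w * 1))%:E.
    rewrite Ex_indicE// integral_cst// mul1e fineK//; exact: fin_num_measure.
  rewrite KB PB -EFinM lee_fin -(ler_pM2l (e0 n)).
  apply: le_trans (dK n _ (FB n)).
  rewrite mulrA -ExZ; last by apply: L1_indicM => //; exact: L1_cst.
  apply: le_Ex.
  - by apply: L1Z; apply: L1_indicM => //; exact: L1_cst.
  - exact: L1_indicM.
  move=> w; rewrite mulr1 indicE; have [h|h] := boolP (w \in seqDU S n); last by rewrite mulr0 mul0r.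
  rewrite mulr1 mul1r mulrC; apply: ltW.
  by move: h; rewrite inE => -[].
rewrite -ge0_integral_bigcup//; last 2 first.
- exact: measurable_funTS.
- by move=> w _; rewrite lee_fin.
rewrite -(ExE K1); apply: ge0_subset_integral => //; first exact: bigcup_measurable.
by move=> w _; rewrite lee_fin.
Qed.

(** Enumerates the rationals of ]0, h]; codes of anything else are sent to h, so that every value
    lies in ]0, h]. *)
Definition rat_enum (h : R) (n : nat) : R :=
  if unpickle n is Some q then (if 0 < (ratr q : R) <= h then ratr q else h) else h.

Lemma rat_enum_itv h n : 0 < h -> 0 < rat_enum h n <= h.
Proof.
move=> h0; rewrite /rat_enum; case: (unpickle n) => [q|]; last by rewrite h0 lexx.
by case: ifP => //; rewrite h0 lexx.
Qed.

Lemma rat_enum_pickle h (q : rat) : 0 < (ratr q : R) <= h -> rat_enum h (pickle q) = ratr q.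
Proof. by rewrite /rat_enum pickleK => ->. Qed.

(** Choose h_k with E[K_(h_k)] < eta / (k + 1). The maximal inequality bounds the probability that
    the estimate fails for h_k by 1 / (k + 1). Since one good h suffices, the exceptional set is the
    intersection over k, which is null. *)
Lemma ae_rational_bound (h0 : R) (delta K : R -> Omega -> R) : 0 < h0 ->
  (forall e, 0 < e <= h0 -> measurable_wrt (F t) (delta e)) ->
  (forall e, 0 < e <= h0 -> L1 P (delta e)) ->
  (forall h, 0 < h <= h0 -> L1 P (K h)) -> (forall h w, 0 <= K h w) ->
  (forall e h A, 0 < e -> e <= h -> h <= h0 -> F t A ->
     Ex P (fun w => \1_A w * delta e w) <= e * Ex P (fun w => \1_A w * K h w)) ->
  (forall x, 0 < x -> exists2 h, 0 < h <= h0 & Ex P (K h) < x) ->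
  \forall w \ae P, forall m, exists2 h, 0 < h <= h0 &
    forall n, delta (rat_enum h n) w <= m.+1%:R^-1 * rat_enum h n.
Proof.
move=> h00 md d1 K1 K0 dK Ksmall; apply: ae_foralln => m.
pose eta : R := m.+1%:R^-1.
have eta0 : 0 < eta by rewrite invr_gt0.
have /choice[h hP] : forall k : nat, exists x, 0 < x <= h0 /\ Ex P (K x) < eta * k.+1%:R^-1.
  move=> k; have [|x ? ?] := Ksmall (eta * k.+1%:R^-1); last by exists x.
  by rewrite mulr_gt0// invr_gt0.
have hk k : 0 < h k <= h0 := (hP k).1.
have en k n : 0 < rat_enum (h k) n <= h0.
  have /andP[hk0 hkh] := hk k; have /andP[-> /=] := rat_enum_itv n hk0.
  by move/le_trans; apply.
pose U k := \bigcup_n [set w | eta * rat_enum (h k) n < delta (rat_enum (h k) n) w].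
have mU k : measurable (U k).
  apply: bigcup_measurable => n _; apply: (augmented_filtration_measurable cP bm).
  have := md _ (en k n) `]eta * rat_enum (h k) n, +oo[%classic (measurable_itv _).
  by congr (F t _); apply/seteqP; split => w /=; rewrite in_itv/= andbT.
have PU k : (P (U k) <= (k.+1%:R^-1)%:E)%E.
  have /andP[hk0 hkh] := hk k.
  have := @maximal_inequality delta (K (h k)) (rat_enum (h k)) eta eta0 _ _ _ (K1 _ (hk k)) (K0 _) _.
  rewrite -/(U k) => H.
  have {}H : (eta%:E * P (U k) <= (eta * k.+1%:R^-1)%:E)%E.
    apply: (le_trans (H _ _ _ _)).
    - by move=> n; have /andP[] := en k n.
    - by move=> n; exact: md.
    - by move=> n; exact: d1.
    - move=> n A FA; apply: dK => //; first by have /andP[] := en k n.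
      by have /andP[] := rat_enum_itv n hk0.
    - by rewrite lee_fin ltW//; exact: (hP k).2.
  by move: H; rewrite EFinM lee_pmul2l.
exists (\bigcap_k U k); split.
- exact: bigcap_measurable.
- apply/eqP; rewrite eq_le measure_ge0 andbT.
  apply/lee_addgt0Pr => x x0; rewrite add0e.
  pose k := Num.truncn x^-1.
  apply: (@le_trans _ _ (P (U k))).
    by apply: le_measure; rewrite ?inE//; [exact: bigcap_measurable|exact: bigcap_inf].
  apply: (le_trans (PU k)); rewrite lee_fin invf_ple ?posrE//.
  by apply: ltW; exact: truncnS_gt.
move=> w /= H k _; apply: contrapT => nU; apply: H.
exists (h k) => // n; rewrite leNgt; apply/negP => lt.
by apply: nU; exists n.
Qed.

(** [ae_rational_bound] applies to delta and to its opposite, the hypothesis being a bound on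
    absolute values; continuity of the paths then fills in the irrational e. *)
Lemma vanishing_quotient (h0 : R) (delta K : R -> Omega -> R) : 0 < h0 ->
  (forall e, 0 < e <= h0 -> measurable_wrt (F t) (delta e)) ->
  (forall e, 0 < e <= h0 -> L1 P (delta e)) ->
  (forall h, 0 < h <= h0 -> L1 P (K h)) -> (forall h w, 0 <= K h w) ->
  (forall e h A, 0 < e -> e <= h -> h <= h0 -> F t A ->
     `|Ex P (fun w => \1_A w * delta e w)| <= e * Ex P (fun w => \1_A w * K h w)) ->
  (forall x, 0 < x -> exists2 h, 0 < h <= h0 & Ex P (K h) < x) ->
  (\forall w \ae P, {within `]0, h0], continuous (fun e => delta e w)}) ->
  \forall w \ae P, forall x, 0 < x -> exists2 h, 0 < h &
    forall e, 0 < e < h -> `|delta e w| <= x * e.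
Proof.
move=> h00 md d1 K1 K0 dK Ksmall dc.
have mA A : F t A -> measurable A by exact: (augmented_filtration_measurable cP bm).
have up : \forall w \ae P, forall m, exists2 h, 0 < h <= h0 &
    forall n, delta (rat_enum h n) w <= m.+1%:R^-1 * rat_enum h n.
  apply: (ae_rational_bound h00 md d1 K1 K0 _ Ksmall) => e h A e0 eh hh0 FA.
  exact: le_trans (ler_norm _) (dK _ _ _ e0 eh hh0 FA).
have dn : \forall w \ae P, forall m, exists2 h, 0 < h <= h0 &
    forall n, 0 - delta (rat_enum h n) w <= m.+1%:R^-1 * rat_enum h n.
  apply: (@ae_rational_bound h0 (fun e w => 0 - delta e w) K h00 _ _ K1 K0 _ Ksmall).
  - by move=> e eh; apply: measurable_wrtB; [exact: measurable_wrt_cst|exact: md].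
  - by move=> e eh; apply: L1B; [exact: L1_cst|exact: d1].
  move=> e h A e0 eh hh0 FA.
  have eh0 : 0 < e <= h0 by rewrite e0 (le_trans eh).
  rewrite (_ : (fun w => _) = fun w => (-1) * (\1_A w * delta e w)); last first.
    by apply/funext => w; ring.
  rewrite ExZ; last by apply: L1_indicM; [exact: mA|exact: d1].
  rewrite mulN1r; apply: le_trans (dK _ _ _ e0 eh hh0 FA).
  by rewrite -normrN ler_norm.
(* A strict violation at e would persist, by continuity, at a rational slightly below e. *)
have upper : forall m h (del : R -> R), 0 < h <= h0 -> {within `]0, h0], continuous del} ->
    (forall n, del (rat_enum h n) <= m.+1%:R^-1 * rat_enum h n) ->
    forall e, 0 < e < h -> del e <= m.+1%:R^-1 * e.
  move=> m h del /andP[hp hh0] cdel bd e /andP[e0 eh].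
  rewrite leNgt; apply/negP => lt.
  have eA : `]0, h0[%classic e by rewrite /= in_itv/= e0 (lt_le_trans eh).
  have cin : {within `]0, h0[, continuous del}.
    by apply: continuous_subspaceW cdel => x /=; rewrite !in_itv/= => /andP[-> /ltW].
  have /(_ e) ce : {in `]0, h0[%classic, continuous del}.
    by move: cin; rewrite continuous_open_subspace; [exact|exact: interval_open].
  have {}ce := ce (mem_set eA).
  have cv : (del x - m.+1%:R^-1 * x) @[x --> e] --> del e - m.+1%:R^-1 * e.
    by apply: (@cvgB _ R^o) => //; apply: cvgM; [exact: cvg_cst|exact: cvg_id].
  have lt' : 0 < del e - m.+1%:R^-1 * e by rewrite subr_gt0.
  have := cvgr_gt _ cv _ lt'.
  case=> r /= r0 br.
  have lt2 : Num.max 0 (e - r) < e by rewrite gt_max e0/= ltrBlDr ltrDl.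
  have [q /=] := rat_in_itvoo lt2; rewrite in_itv/= gt_max => /andP[/andP[q0 qr] qe].
  have := br (ratr q).
  rewrite /ball/= ger0_norm ?subr_ge0 ?(ltW qe)// ltrBlDr -ltrBlDl => /(_ qr).
  rewrite subr_gt0; apply/negP; rewrite -leNgt.
  have qh : 0 < (ratr q : R) <= h by rewrite q0 (ltW (lt_trans qe eh)).
  by have := bd (pickle q); rewrite rat_enum_pickle.
apply: filterS3 up dn dc => w up dn dc x x0.
pose m := Num.truncn x^-1.
have mx : m.+1%:R^-1 <= x by rewrite invf_ple ?posrE// ltW// truncnS_gt.
have [h h00' uph] := up m; have [h' h00'' dnh] := dn m.
have dc' : {within `]0, h0], continuous (fun e => 0 - delta e w)}.
  move=> e; apply: (@cvgB _ R^o); [exact: cvg_cst|exact: dc].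
exists (Num.min h h').
  by rewrite lt_min; case/andP: h00' => -> _; case/andP: h00'' => -> _.
move=> e; rewrite lt_min => /and3P[e0 eh eh'].
have eh1 : 0 < e < h by rewrite e0.
have eh2 : 0 < e < h' by rewrite e0.
rewrite ler_norml; apply/andP; split; last first.
  apply: (le_trans (upper m h _ h00' dc uph e eh1)); by rewrite ler_wpM2r// ltW.
have := upper m h' _ h00'' dc' dnh e eh2; rewrite sub0r => le1.
rewrite lerNl; apply: (le_trans le1); by rewrite ler_wpM2r// ltW.
Qed.

End vanishing_quotient.

(** * Deterministic integral and linear equations *)

Section deterministic_estimates.
Context {R : realType}.
Local Notation mu := (@lebesgue_measure R).

Lemma Rintegral_ae_bound (a b C : R) (f : R -> R) : a <= b -> 0 <= C ->
  mu.-integrable `[a, b] (EFin \o f) ->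
  (\forall r \ae mu, a <= r <= b -> `|f r| <= C) ->
  `|Rintegral mu `[a, b] f| <= (b - a) * C.
Proof.
move=> ab C0 fi fC; rewrite -lee_fin.
have mab : measurable `[a, b] by exact: measurable_itv.
have mf := measurable_int mu fi.
apply: (@le_trans _ _ (\int[mu]_(r in `[a, b]) `|(f r)%:E|)%E).
  rewrite EFin_normr_Rintegral//; exact: le_abse_integral.
apply: (@le_trans _ _ (\int[mu]_(r in `[a, b]) C%:E)%E).
  apply: ae_ge0_le_integral => //.
  - exact: measurableT_comp.
rewrite integral_cst//= lebesgue_measure_itv/= lte_fin.
case: ltP => h; first by rewrite -EFinD -EFinM lee_fin mulrC.
by rewrite mule0 lee_fin mulr_ge0// subr_ge0.
Qed.

(** Gronwall for the sum of the absolute values of the entries. It will be applied to the difference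
    of the means of the two states, which starts from 0 at time t. *)
Lemma linear_ode_zero p q T t M (N : R -> 'M[R]_p) (v w : R -> 'M[R]_(p, q)) : 0 <= t <= T ->
  mx_coef `[0, T] N ->
  (forall i j, measurable_fun `[t, T] (fun s => v s i j)) ->
  (forall s i j, t <= s <= T -> `|v s i j| <= M) ->
  mx_integrable `[t, T] w ->
  (forall s, t <= s <= T -> v s = mx_integral `[t, s] w) ->
  (\forall r \ae mu, t <= r <= T -> w r = N r *m v r) ->
  forall s, t <= s <= T -> v s = 0.
Proof.
move=> /andP[t0 tT] /mx_coef_bound[K K0 NK] mv vM wi vw wN s sT.
pose g r := (\sum_(ij : 'I_p * 'I_q) `|v r ij.1 ij.2|)%:E.
have mg : measurable_fun `[t, T] g.
  apply/measurable_EFinP; apply: measurable_sum => ij.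
  by apply: measurableT_comp => //; exact: mv.
have g0 r : (0 <= g r)%E by rewrite lee_fin sumr_ge0.
have -> : v s = 0; last by [].
suff gs : g s = 0%E.
  apply/matrixP => i j; rewrite mxE; apply/eqP; rewrite -normr_eq0.
  case: gs => /eqP; rewrite psumr_eq0// => /allP/(_ (i, j)).
  by rewrite mem_index_enum => /(_ isT).
apply: (@gronwall0 _ t T ((p * q)%:R * K) ((p * q)%:R * M) g tT _ _ _ _ s sT).
- by rewrite mulr_ge0.
- by [].
- move=> r rT; rewrite lee_fin.
  apply: (@le_trans _ _ (\sum_(ij : 'I_p * 'I_q) M)).
    by apply: ler_sum => ij _; exact: vM.
  by rewrite sumr_const card_prod !card_ord -[leLHS]mulr_natl.
move=> r /[dup] rT /andP[tr rT'].
have mtr : measurable `[t, r] by exact: measurable_itv.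
have sub : `[t, r]%classic `<=` `[t, T]%classic.
  by move=> y /=; rewrite !in_itv/= => /andP[-> /le_trans]; apply.
have wir : mx_integrable `[t, r] w.
  by move=> i j; apply: integrableS (wi i j) => //; exact: measurable_itv.
have mgr : measurable_fun `[t, r] g by exact: measurable_funS mg.
have term i j : (`|v r i j|%:E <= K%:E * \int[mu]_(y in `[t, r]) g y)%E.
  rewrite (vw r rT) mxE EFin_normr_Rintegral//; last exact: wir.
  apply: (le_trans (le_abse_integral mu mtr (measurable_int mu (wir i j)))).
  rewrite -ge0_integralZl//.
  apply: ae_ge0_le_integral => //.
  - by apply: measurableT_comp => //; exact: measurable_int (wir i j).
  - by move=> y _; rewrite mule_ge0.
  - exact: measurable_funeM.
  apply: filterS2 NK wN => y NK wN Dy.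
  have tyT : t <= y <= T by have := sub _ Dy; rewrite /= in_itv.
  rewrite wN// -EFinM lee_fin mxE (le_trans (ler_norm_sum _ _ _))//.
  rewrite mulr_sumr -(pair_bigA _ (fun k l => K * `|v y k l|))/=.
  apply: ler_sum => k _; rewrite normrM.
  apply: (@le_trans _ _ (K * `|v y k j|)).
    rewrite ler_wpM2r//; apply: NK; rewrite /= in_itv/=.
    by case/andP: tyT => ty ->; rewrite (le_trans t0).
  by rewrite (bigD1 j)//= lerDl sumr_ge0// => l _; rewrite mulr_ge0.
have Ig : (0 <= \int[mu]_(y in `[t, r]) g y)%E by exact: integral_ge0.
rewrite {1}/g -sumEFin.
apply: (@le_trans _ _ (\sum_(ij : 'I_p * 'I_q) (K%:E * \int[mu]_(y in `[t, r]) g y))%E).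
  by apply: lee_sum => ij _; exact: term.
rewrite -ge0_sume_distrl//.
by rewrite sumEFin sumr_const card_prod !card_ord -[X in (X%:E * _ <= _)%E]mulr_natl.
Qed.

Lemma Rintegral_small (t T x : R) (g : R -> R) : t < T -> 0 < x ->
  mu.-integrable `[t, T] (EFin \o g) ->
  exists2 h, 0 < h <= T - t & `|Rintegral mu `[t, t + h] g| < x.
Proof.
move=> tT x0 gi.
have := parameterized_integral_near_left tT x0 gi.
case=> e /= e0 he.
pose h := Num.min (e / 2) (T - t).
have h0 : 0 < h by rewrite lt_min divr_gt0//= subr_gt0.
exists h; first by rewrite h0/= ge_min lexx orbT.
apply: (he (t + h)); last by rewrite lerDl ltW.
rewrite /= opprD addrA subrr sub0r normrN gtr0_norm// gt_min.
by rewrite [X in X || _](_ : _ = true)//; apply/idP; lra.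
Qed.

End deterministic_estimates.

(** * Means over an event and integrals of matrix functions *)

Section mean_values.
Context {d : measure_display} {Omega : measurableType d} {R : realType}.
Variable P : probability Omega R.

Lemma mL1Z p q k (f : Omega -> 'M[R]_(p, q)) : mL1 P f -> mL1 P (fun w => k *: f w).
Proof.
move=> hf i j; have := L1Z k (hf i j).
by congr L1; apply/funext => w; rewrite mxE.
Qed.

Lemma mExZ p q A k (f : Omega -> 'M[R]_(p, q)) : measurable A -> mL1 P f ->
  mEx P A (fun w => k *: f w) = k *: mEx P A f.
Proof.
move=> mA hf; apply/matrixP => i j; rewrite !mxE -ExZ; last exact: L1_indicM.
by congr Ex; apply/funext => w; rewrite mxE mulrCA.
Qed.

(** Serves for the state frozen at time t, which multiplies [Y0] in the left integrand. *)
Lemma mjint_cst (T : R) p q (f : Omega -> 'M[R]_(p, q)) : mL1 P f -> mjint P `[0, T] (fun=> f).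
Proof.
move=> hf i j; have mT : measurable `[0, T] by exact: measurable_itv.
apply: jint_tonelli => //.
  have mfi : measurable_fun setT (fun w => f w i j) by exact: L1_measurable (hf i j).
  by apply: measurable_funTS; exact: (measurableT_comp mfi measurable_snd).
have /integrableP[_ If] := hf i j.
rewrite integral_cst//; apply: lte_mul_pinfty => //.
- exact: integral_ge0.
- by rewrite ge0_fin_numE//; exact: integral_ge0.
rewrite /= lebesgue_measure_itv/=; case: ifP => _; rewrite ?ltry//.
Qed.

Lemma mjintZ D p q k (Y : R -> Omega -> 'M[R]_(p, q)) : measurable D -> mjint P D Y ->
  mjint P D (fun s w => k *: Y s w).
Proof.
move=> mD hY i j; have := jint_coef mD (ae_bounded_cst k mD) (hY i j).
by congr jint; apply/funext => s; apply/funext => w; rewrite mxE.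
Qed.

Lemma jint_abs D (Y : R -> Omega -> R) : measurable D -> jint P D Y ->
  jint P D (fun s w => `|Y s w|).
Proof. by move=> mD; exact: integrable_norm. Qed.

Lemma mEx_le p q A (f : Omega -> 'M[R]_(p, q)) i j : measurable A -> mL1 P f ->
  `|mEx P A f i j| <= Ex P (fun w => \1_A w * `|f w i j|).
Proof.
move=> mA hf; rewrite mxE; have h := L1_indicM mA (hf i j).
apply: (le_trans (le_normr_Rintegral measurableT h)).
apply: le_Ex; [exact: integrable_norm h|apply: L1_indicM => //; exact: integrable_norm (hf i j)|].
by move=> w; rewrite normrM (ger0_norm (_ : 0 <= \1_A w)).
Qed.

End mean_values.

Section integral_estimates.
Context {R : realType}.
Local Notation mu := (@lebesgue_measure R).

Lemma Rintegral_le_ae (D E : set R) (f g : R -> R) : measurable D -> measurable E -> D `<=` E ->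
  mu.-integrable D (EFin \o f) -> mu.-integrable E (EFin \o g) -> (forall r, 0 <= g r) ->
  (\forall r \ae mu, D r -> `|f r| <= g r) -> `|Rintegral mu D f| <= Rintegral mu E g.
Proof.
move=> mD mE DE fi gi g0 fg; rewrite -lee_fin.
have mf := measurable_int mu fi; have mg := measurable_int mu gi.
rewrite EFin_normr_Rintegral//; apply: (le_trans (le_abse_integral mu mD mf)).
rewrite /Rintegral fineK; last exact: integrable_fin_num.
apply: (@le_trans _ _ (\int[mu]_(r in D) (g r)%:E)%E); last first.
  by apply: ge0_subset_integral => // r _; rewrite lee_fin.
apply: ae_ge0_le_integral => //.
- exact: measurableT_comp.
- by move=> r _; rewrite lee_fin.
- exact: measurable_funS mg.
Qed.

Lemma mx_integralB p q D (f g : R -> 'M[R]_(p, q)) : measurable D ->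
  mx_integrable D f -> mx_integrable D g ->
  mx_integral D (fun r => f r - g r) = mx_integral D f - mx_integral D g.
Proof.
move=> mD fi gi; apply/matrixP => i j; rewrite !mxE -RintegralB//; [|exact: fi|exact: gi].
by apply: eq_Rintegral => r _; rewrite !mxE.
Qed.

Lemma mx_integrableB p q D (f g : R -> 'M[R]_(p, q)) : measurable D ->
  mx_integrable D f -> mx_integrable D g -> mx_integrable D (fun r => f r - g r).
Proof.
move=> mD fi gi i j; have := @integrableB _ _ _ mu _ mD _ _ (fi i j) (gi i j).
by congr integrable; apply/funext => r; rewrite !mxE EFinB.
Qed.

Lemma mx_integrableM p q k D (M : 'M[R]_(k, p)) (f : R -> 'M[R]_(p, q)) : measurable D ->
  mx_integrable D f -> mx_integrable D (fun r => M *m f r).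
Proof.
move=> mD fi i j.
have h : mu.-integrable D (fun r => \sum_(l <- index_enum 'I_p) (M i l)%:E * (f r l j)%:E)%E.
  apply: (@integrable_sum _ _ _ mu _ mD) => l _.
  exact: (@integrableZl _ _ _ mu _ mD _ _ (fi l j)).
move: h; congr integrable; apply/funext => r; rewrite mxE -sumEFin.
by apply: eq_bigr => l _; rewrite EFinM.
Qed.

Lemma mx_integralM p q k D (M : 'M[R]_(k, p)) (f : R -> 'M[R]_(p, q)) : measurable D ->
  mx_integrable D f -> mx_integral D (fun r => M *m f r) = M *m mx_integral D f.
Proof.
move=> mD fi; apply/matrixP => i j; rewrite !mxE.
under eq_Rintegral do rewrite mxE.
have fil l : mu.-integrable D (EFin \o (fun r => M i l * f r l j)).
  exact: (@integrableZl _ _ _ mu _ mD _ _ (fi l j)).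
rewrite /Rintegral; under eq_integral do rewrite -sumEFin.
rewrite (@integral_sum _ _ _ mu _ mD _ _ fil) -sum_fine; last first.
  by move=> l _; exact: integrable_fin_num (fil l).
apply: eq_bigr => l _; rewrite mxE -RintegralZl//; exact: fi.
Qed.

End integral_estimates.

Section conditional_means.
Context {d : measure_display} {Omega : measurableType d} {R : realType}.
Variables (P : probability Omega R).

(** Integrability and value are kept together so that the mean of a long expression can be computed
    by following its syntax, each rule supplying the side condition of the next. *)
Definition has_mean p q A (f : Omega -> 'M[R]_(p, q)) (v : 'M[R]_(p, q)) :=
  mL1 P f /\ mEx P A f = v.

Variables (A : set Omega) (mA : measurable A).

Lemma has_meanD p q (f g : Omega -> 'M[R]_(p, q)) a b : has_mean A f a -> has_mean A g b ->
  has_mean A (fun w => f w + g w) (a + b).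
Proof. by move=> [f1 <-] [g1 <-]; split; [exact: mL1D|exact: mExD]. Qed.

Lemma has_meanM p q r (M : 'M[R]_(p, q)) (f : Omega -> 'M[R]_(q, r)) a : has_mean A f a ->
  has_mean A (fun w => M *m f w) (M *m a).
Proof. by move=> [f1 <-]; split; [exact: mL1M|exact: mExM]. Qed.

Lemma has_meanZ p q k (f : Omega -> 'M[R]_(p, q)) a : has_mean A f a ->
  has_mean A (fun w => k *: f w) (k *: a).
Proof. by move=> [f1 <-]; split; [exact: mL1Z|exact: mExZ]. Qed.

End conditional_means.

(** Here a and b stand for the means of the state at t and at s, and v for that of the control. Once
    E_t is averaged out, C b + C' b and (C + C') b coincide, and likewise for the control; only the
    term in Y, frozen at t on the left, is left over. *)
Lemma adjoint_cancellation (R : comPzRingType) n m (B : 'M[R]_(m, n)) (D : 'M[R]_(m, n))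
    (Y Q C C' : 'M[R]_n) (E E' : 'M[R]_(n, m)) (k : R) (q a b s l : 'cV[R]_n) (v : 'cV[R]_m) :
  B *m (Y *m (k *: a) + q) + D *m (Q *m (C *m b + C' *m b + E *m v + E' *m v + s) + l) -
  (B *m (Y *m (k *: b) + q) + D *m (Q *m ((C + C') *m b + (E + E') *m v + s) + l)) =
  (k *: (B *m Y)) *m (a - b).
Proof.
rewrite !(mulmxDl C) (mulmxDl E) !addrA opprD addrACA subrr addr0.
by rewrite -mulmxBr opprD addrACA subrr addr0 -mulmxBr -scalerBr mulmxA -scalemxAr scalemxAl.
Qed.

Section second_moments.
Context {d : measure_display} {Omega : measurableType d} {R : realType}.
Variable P : probability Omega R.

Lemma mEx_second_moment p q A (f : Omega -> 'M[R]_(p, q)) K i j : measurable A ->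
  (forall i j, L2 P (fun w => f w i j)) -> (\int[P]_w (f w i j ^+ 2)%:E <= K%:E)%E ->
  `|mEx P A f i j| <= 1 + K.
Proof.
move=> mA f2 fK.
have f1 : mL1 P f by move=> k l; apply: L2_L1; exact: f2.
apply: (le_trans (mEx_le i j mA f1)).
move: fK; rewrite (ExE (f2 i j).2) lee_fin => fK.
have c1 : L1 P (fun=> 1 : R) by exact: L1_cst.
apply: (@le_trans _ _ (Ex P (fun w => 1 + f w i j ^+ 2))).
  apply: le_Ex; [exact: (L1_indicM mA (integrable_norm (f1 i j)))|exact: (L1D c1 (f2 i j).2)|].
  move=> z; rewrite -(real_normK (num_real (f z i j))) indicE.
  have := normr_ge0 (f z i j); have := sqr_ge0 (`|f z i j| - 1).
  by case: (_ \in _) => /=; nra.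
by rewrite (ExD c1 (f2 i j).2) Ex_cst lerD2l.
Qed.

End second_moments.

(** * Comparison of the two states *)

Section state_comparison.
Context {d : measure_display} {Omega : measurableType d} {R : realType}.
Variables (P : probability Omega R) (W : R -> Omega -> R) (T : R) (n m : nat).
Variables (c : lq_data Omega R n m) (x : 'cV[R]_n) (u : R -> Omega -> 'cV[R]_m).
Variables (cX : R -> Omega -> 'cV[R]_n) (t : R).
Variables (X EX : R -> Omega -> 'cV[R]_n) (Eu : R -> Omega -> 'cV[R]_m).
Local Notation F := (augmented_filtration P W).
Local Notation mu := (@lebesgue_measure R).
Hypothesis T0 : 0 < T.
Hypothesis cP : measure_is_complete P.
Hypothesis bm : standard_brownian_motion P W.
Hypothesis h1 : H1 P F T c.
Hypothesis uL2 : L2F P F T u.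
Hypothesis hcX : is_cal_state P W T c x u cX.
Hypothesis tT : 0 <= t < T.
Hypothesis hEu : condexp_process P F T t u Eu.
Hypothesis hEX : condexp_process P F T t X EX.
Hypothesis hX : is_state P W T c x u Eu X EX.

Local Notation beta := (fun s w => cA c s *m X s w + cAt c s *m EX s w
  + cB c s *m u s w + cBt c s *m Eu s w + cb c s w).
Local Notation betac := (fun s w => sA c s *m cX s w + sB c s *m u s w + cb c s w).

Let mT : measurable `[0, T]. Proof. exact: measurable_itv. Qed.

Lemma mjint_state : mjint P `[0, T] X.
Proof. by have [LX _ _] := hX; exact: (L2F_C_mjint cP bm LX). Qed.

Lemma mjint_cal_state : mjint P `[0, T] cX.
Proof. by have [LX _ _] := hcX; exact: (L2F_C_mjint cP bm LX). Qed.

Lemma mjint_condexp_state : mjint P `[0, T] EX.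
Proof. exact: (condexp_mjint cP bm (tau := fun=> t) hEX.1 mjint_state hEX.2). Qed.

Lemma mjint_condexp_control : mjint P `[0, T] Eu.
Proof. exact: (condexp_mjint cP bm (tau := fun=> t) hEu.1 (L2F_mjint uL2) hEu.2). Qed.

Lemma mjint_drift : mjint P `[0, T] beta.
Proof.
have [[? ? ? ?] [? ? ? ?] _ _ [hb _]] := h1.
apply: (mjintD mT _ (L2F_L1_mjint hb)); apply: (mjintD mT); first apply: (mjintD mT); first apply: (mjintD mT);
  apply: (mjintM mT); try exact: Linfty_mx_coef.
- exact: mjint_state.
- exact: mjint_condexp_state.
- exact: L2F_mjint uL2.
- exact: mjint_condexp_control.
Qed.

Lemma mx_coef_sA : mx_coef `[0, T] (sA c).
Proof. by have [[? ? ? ?] _ _ _ _] := h1; apply: mx_coefD; exact: Linfty_mx_coef. Qed.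

Lemma mx_coef_sB : mx_coef `[0, T] (sB c).
Proof. by have [_ [? ? ? ?] _ _ _] := h1; apply: mx_coefD; exact: Linfty_mx_coef. Qed.

Lemma mx_coef_sC : mx_coef `[0, T] (sC c).
Proof. by have [[? ? ? ?] _ _ _ _] := h1; apply: mx_coefD; exact: Linfty_mx_coef. Qed.

Lemma mx_coef_sD : mx_coef `[0, T] (sD c).
Proof. by have [_ [? ? ? ?] _ _ _] := h1; apply: mx_coefD; exact: Linfty_mx_coef. Qed.

Lemma mjint_cal_drift : mjint P `[0, T] betac.
Proof.
have [_ _ _ _ [hb _]] := h1.
apply: (mjintD mT _ (L2F_L1_mjint hb)); apply: (mjintD mT); apply: (mjintM mT).
- exact: mx_coef_sA.
- exact: mjint_cal_state.
- exact: mx_coef_sB.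
- exact: L2F_mjint uL2.
Qed.

Lemma state_mL1 s : 0 <= s <= T -> mL1 P (X s).
Proof.
have [LX _ _] := hX; have [K K0 hK] := L2F_C_second_moment cP bm LX.
by move=> sT i j; apply: L2_L1; exact: (hK s i j sT).1.
Qed.

Lemma cal_state_mL1 s : 0 <= s <= T -> mL1 P (cX s).
Proof.
have [LX _ _] := hcX; have [K K0 hK] := L2F_C_second_moment cP bm LX.
by move=> sT i j; apply: L2_L1; exact: (hK s i j sT).1.
Qed.

(* Up to time t the two equations coincide, because E_t fixes what is known at t. *)
Lemma state_eq_cal_state : \forall w \ae P, X t w = cX t w.
Proof.
have /andP[t0 tT'] := tT; have t0T : 0 <= t <= T by rewrite t0 ltW.
have [LX X0 dX] := hX; have [LcX cX0 dcX] := hcX.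
have [bi [I [iz _]]] := dX; have [Lz _ _ _] := iz.
have [bic [Ic [izc _]]] := dcX; have [Lzc _ _ _] := izc.
have EXX r : 0 <= r <= t -> \forall w \ae P, EX r w = X r w.
  move=> /andP[r0 rt]; have rT : 0 <= r <= T by rewrite r0 (le_trans rt) ?ltW.
  have [aX _ _] := LX.
  apply: (condexp_ae_eq cP bm (hEX.2 r rT (state_mL1 rT))) => i j.
  exact: measurable_wrt_mono rt ((aX i j).2 r rT).
have Euu r : 0 <= r <= t -> mL1 P (u r) -> \forall w \ae P, Eu r w = u r w.
  move=> /andP[r0 rt] u1; have rT : 0 <= r <= T by rewrite r0 (le_trans rt) ?ltW.
  apply: (condexp_ae_eq cP bm (hEu.2 r rT u1)) => i j.
  exact: measurable_wrt_mono rt ((uL2.1 i j).2 r rT).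
have u1 := mjint_ae_mL1 mT (L2F_mjint uL2).
apply: (sde_unique cP bm (ltW T0) LX LcX dX dcX mjint_drift mjint_cal_drift Lz Lzc _ t0T mx_coef_sA mx_coef_sC).
- by apply: filterS2 X0 cX0 => w -> ->.
- apply: filterS u1 => r u1 rt.
  have rT : `[0, T]%classic r by case/andP: rt => r0 rt; rewrite /= in_itv/= r0 (le_trans rt) ?ltW.
  apply: filterS2 (EXX r rt) (Euu r rt (u1 rT)) => w -> ->.
  rewrite /sA /sB mulmxBr !mulmxDl.
  by apply/matrixP => i j; rewrite !(mxE, mulmxDl); ring.
- apply: filterS u1 => r u1 rt.
  have rT : `[0, T]%classic r by case/andP: rt => r0 rt; rewrite /= in_itv/= r0 (le_trans rt) ?ltW.
  apply: filterS2 (EXX r rt) (Euu r rt (u1 rT)) => w -> ->.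
  rewrite /sC /sD mulmxBr !mulmxDl.
  by apply/matrixP => i j; rewrite !(mxE, mulmxDl); ring.
Qed.

Section future_means.
Variable A : set Omega.
Hypothesis FA : F t A.

Let mA : measurable A. Proof. exact: (augmented_filtration_measurable cP bm FA). Qed.

Let sub_tT s : t <= s -> `[t, s]%classic `<=` `[0, s]%classic.
Proof.
have /andP[t0 _] := tT.
by move=> ts r /=; rewrite !in_itv/= => /andP[tr ->]; rewrite (le_trans t0).
Qed.

Lemma mean_condexp_state s : 0 <= s <= T -> has_mean P A (EX s) (mEx P A (X s)).
Proof.
move=> sT; have ce := hEX.2 s sT (state_mL1 sT); split; first by case: ce.
exact: (condexp_mEx cP bm ce FA).
Qed.

Lemma mean_condexp_control s : 0 <= s <= T -> mL1 P (u s) ->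
  has_mean P A (Eu s) (mEx P A (u s)).
Proof.
move=> sT u1; have ce := hEu.2 s sT u1; split; first by case: ce.
exact: (condexp_mEx cP bm ce FA).
Qed.

(** On A in F_t the processes E_t X and E_t u have the means of X and u, so each coefficient merges
    with its tilde into the calligraphic one. *)
Lemma mean_drift s : 0 <= s <= T -> mL1 P (u s) -> mL1 P (cb c s) ->
  mEx P A (beta s) = sA c s *m mEx P A (X s) + sB c s *m mEx P A (u s) + mEx P A (cb c s).
Proof.
move=> sT u1 b1; rewrite /sA /sB !mulmxDl.
have [_ ->] : has_mean P A (beta s) (cA c s *m mEx P A (X s) + cAt c s *m mEx P A (X s)
    + cB c s *m mEx P A (u s) + cBt c s *m mEx P A (u s) + mEx P A (cb c s)).
  have hX1 := state_mL1 sT.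
  do ?[apply: (has_meanD mA)|apply: (has_meanM mA)] => //.
  - exact: mean_condexp_state.
  - exact: mean_condexp_control.
by rewrite !addrA.
Qed.

Lemma mean_cal_drift s : 0 <= s <= T -> mL1 P (u s) -> mL1 P (cb c s) ->
  mEx P A (betac s) = sA c s *m mEx P A (cX s) + sB c s *m mEx P A (u s) + mEx P A (cb c s).
Proof.
move=> sT u1 b1.
have [_ ->] // : has_mean P A (betac s) (sA c s *m mEx P A (cX s) + sB c s *m mEx P A (u s) + mEx P A (cb c s)).
have hX1 := cal_state_mL1 sT.
by do ?[apply: (has_meanD mA)|apply: (has_meanM mA)].
Qed.

Lemma mean_state s : t <= s <= T -> mEx P A (X s) = mEx P A (cX s).
Proof.
have /andP[t0 tT'] := tT; have t0T : 0 <= t <= T by rewrite t0 ltW.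
move=> /[dup] sT /andP[ts sT'].
have [LX X0 dX] := hX; have [LcX cX0 dcX] := hcX.
have mtT : measurable `[t, T] by exact: measurable_itv.
have tT0 : `[t, T]%classic `<=` `[0, T]%classic by exact: (sub_tT (ltW tT')).
pose v r := mEx P A (X r) - mEx P A (cX r).
pose w r := mEx P A (beta r) - mEx P A (betac r).
have iX p q (Y : R -> Omega -> 'M[R]_(p, q)) : mjint P `[0, T] Y -> mx_integrable `[t, T] (fun r => mEx P A (Y r)).
  by move=> jY; have [] := mjint_fubini mtT mA (mjintS mT mtT tT0 jY).
apply/eqP; rewrite -subr_eq0; apply/eqP; rewrite -/(v s).
have [K K0 hK] := L2F_C_second_moment cP bm LX.
have [K' K0' hK'] := L2F_C_second_moment cP bm LcX.
have vE r i j : v r i j = mEx P A (X r) i j - mEx P A (cX r) i j by rewrite /v !mxE.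
(* The a priori bound comes from |y| <= 1 + y^2 and the uniform second moments of the two states.
   The contributions of u and b cancel in w, which leaves sA v. *)
apply: (@linear_ode_zero _ _ _ T t (1 + K + (1 + K')) (sA c) v w t0T mx_coef_sA _ _ _ _ _ s sT).
- move=> i j.
  have mE (Y : R -> Omega -> 'cV[R]_n) : mjint P `[0, T] Y -> measurable_fun `[t, T] (fun r => mEx P A (Y r) i j).
    by move=> jY; apply/measurable_EFinP; exact: (measurable_int mu (iX _ _ Y jY i j)).
  rewrite (_ : (fun r => v r i j) = (fun r => mEx P A (X r) i j - mEx P A (cX r) i j)).
    exact: measurable_funB (mE _ mjint_state) (mE _ mjint_cal_state).
  by apply/funext => r; rewrite vE.
- move=> r i j /andP[tr rT]; have r0T : 0 <= r <= T by rewrite rT (le_trans t0).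
  rewrite vE; apply: (le_trans (ler_normB _ _)); apply: lerD; apply: mEx_second_moment => //.
  - by move=> k l; exact: (hK r k l r0T).1.
  - exact: (hK r i j r0T).2.
  - by move=> k l; exact: (hK' r k l r0T).1.
  - exact: (hK' r i j r0T).2.
- exact: (mx_integrableB mtT (iX _ _ _ mjint_drift) (iX _ _ _ mjint_cal_drift)).
- move=> r /andP[tr rT].
  have mtr : measurable `[t, r] by exact: measurable_itv.
  have trT : `[t, r]%classic `<=` `[t, T]%classic.
    by move=> y /=; rewrite !in_itv/= => /andP[-> /le_trans]; apply.
  have iXr p q (Y : R -> Omega -> 'M[R]_(p, q)) : mjint P `[0, T] Y -> mx_integrable `[t, r] (fun r => mEx P A (Y r)).
    by move=> jY i j; apply: (@integrableS _ _ _ mu _ _ _ mtT mtr trT); exact: iX.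
  have t0r : 0 <= t <= r by rewrite t0.
  rewrite mx_integralB//; [|exact: (iXr _ _ _ mjint_drift)|exact: (iXr _ _ _ mjint_cal_drift)].
  rewrite /v (sde_mEx cP bm dX mjint_drift state_mL1 t0r rT FA).
  rewrite (sde_mEx cP bm dcX mjint_cal_drift cal_state_mL1 t0r rT FA).
  rewrite (@mEx_ae_eq _ _ _ _ _ _ _ (X t) (cX t))//.
  + by rewrite opprD addrACA subrr add0r.
  + exact: state_mL1.
  + exact: cal_state_mL1.
  + exact: state_eq_cal_state.
- have [_ _ _ _ [hb _]] := h1.
  have u1 := mjint_ae_mL1 mT (L2F_mjint uL2).
  have b1 := mjint_ae_mL1 mT (L2F_L1_mjint hb).
  apply: filterS2 u1 b1 => r u1 b1 /andP[tr rT].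
  have rT0 : 0 <= r <= T by rewrite rT (le_trans t0).
  have Dr : `[0, T]%classic r by rewrite /= in_itv.
  rewrite /w /v (mean_drift rT0 (u1 Dr) (b1 Dr)) (mean_cal_drift rT0 (u1 Dr) (b1 Dr)).
  by rewrite mulmxBr; apply/matrixP => i j; rewrite !mxE; ring.
Qed.

End future_means.

Section quotient.
Variables (EcX : R -> R -> Omega -> 'cV[R]_n) (P1 P2 Y0 : R -> 'M[R]_n).
Variables (P3 P4 L4 : R -> Omega -> 'cV[R]_n) (EP3 : R -> R -> Omega -> 'cV[R]_n).
Hypothesis hEcX : condexp_field P F T cX EcX.
Hypothesis hEP3 : condexp_field P F T P3 EP3.
Hypothesis cP1 : mx_coef `[0, T] P1.
Hypothesis cP2 : mx_coef `[0, T] P2.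
Hypothesis cY0 : mx_coef `[0, T] Y0.
Hypothesis hP3 : L2F_C P F T P3.
Hypothesis hP4 : L2F_C P F T P4.
Hypothesis hL4 : L2F P F T L4.

Local Notation f := (fun s w => (sB c s)^T *m (Y0 s *m (gamma1 c *: X t w)
    + bold_Y P1 P2 EP3 P4 X EX s t w)
  + (sD c s)^T *m bold_Z c P1 L4 u Eu X EX s w).
Local Notation g := (fun s w => (sB c s)^T *m (Y0 s *m (gamma1 c *: cX s w)
    + cal_M P1 P2 EP3 P4 cX EcX s s w)
  + (sD c s)^T *m cal_N c P1 L4 u cX s w).
Local Notation M := (fun s => gamma1 c *: ((sB c s)^T *m Y0 s)).

Let t0T : 0 <= t <= T. Proof. by have /andP[-> /ltW] := tT. Qed.

Lemma mjint_lhs : mjint P `[0, T] f.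
Proof.
have [[? ? ? ?] [? ? ? ?] _ _ [_ hs]] := h1.
have jX := mjint_state; have jEX := mjint_condexp_state; have jEu := mjint_condexp_control.
have ju := L2F_mjint uL2; have js := L2F_mjint hs; have jL4 := L2F_mjint hL4.
have jP4 := L2F_C_mjint cP bm hP4; have jP3 := L2F_C_mjint cP bm hP3.
have hEt := hEP3.1 t t0T.
have jEP3 := condexp_mjint cP bm (tau := fun=> t) hEt.1 jP3 hEt.2.
have jXt := mjintZ (gamma1 c) mT (mjint_cst T (state_mL1 t0T)).
have cB' := mx_coefT mx_coef_sB; have cD' := mx_coefT mx_coef_sD.
rewrite /bold_Y /bold_Z.
by repeat first [assumption | apply: (mjintD mT) | apply: (mjintM mT) | exact: Linfty_mx_coef].
Qed.

Lemma mjint_rhs : mjint P `[0, T] g.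
Proof.
have [_ _ _ _ [_ hs]] := h1.
have ju := L2F_mjint uL2; have js := L2F_mjint hs; have jL4 := L2F_mjint hL4.
have jP4 := L2F_C_mjint cP bm hP4; have jP3 := L2F_C_mjint cP bm hP3.
have jcX := mjint_cal_state.
(* Along the diagonal the time of conditioning is s itself. *)
have jEP3 := condexp_mjint cP bm (tau := id) hEP3.2 jP3 (fun s sT => (hEP3.1 s sT).2 s sT).
have jEcX := condexp_mjint cP bm (tau := id) hEcX.2 jcX (fun s sT => (hEcX.1 s sT).2 s sT).
have jXt := mjintZ (gamma1 c) mT jcX.
have cB' := mx_coefT mx_coef_sB; have cD' := mx_coefT mx_coef_sD.
have cC' := mx_coef_sC; have cD'' := mx_coef_sD.
rewrite /cal_M /cal_N.
by repeat first [assumption | apply: (mjintD mT) | apply: (mjintM mT)].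
Qed.

(** As A belongs to F_t and hence to F_s, both [EP3 t s] and [EP3 s s] have the mean of P3(s), and
    X(s), E_t X(s), cX(s) and E_s cX(s) all share one mean; the rest is [adjoint_cancellation]. *)
Lemma mean_lhs_sub_rhs A s : F t A -> t <= s <= T ->
  mL1 P (u s) -> mL1 P (csigma c s) -> mL1 P (L4 s) ->
  mEx P A (f s) - mEx P A (g s) = M s *m (mEx P A (cX t) - mEx P A (cX s)).
Proof.
move=> FA /[dup] sT /andP[ts sT'] u1 s1 l1.
have mA := augmented_filtration_measurable cP bm FA.
have FsA : F s A := augmented_filtration_mono ts FA.
have s0T : 0 <= s <= T by rewrite sT' andbT (le_trans _ ts)//; case/andP: tT.
have mXt : has_mean P A (X t) (mEx P A (cX t)).
  by split; [exact: state_mL1|apply: mean_state => //; case/andP: t0T => _ ->; rewrite lexx].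
have mX : has_mean P A (X s) (mEx P A (cX s)) by split; [exact: state_mL1|exact: mean_state].
have mEX : has_mean P A (EX s) (mEx P A (cX s)).
  by rewrite -(mean_state FA sT); exact: mean_condexp_state.
have mEu := mean_condexp_control FA s0T u1.
have mcX : has_mean P A (cX s) (mEx P A (cX s)) by split => //; exact: cal_state_mL1.
have mu_ : has_mean P A (u s) (mEx P A (u s)) by [].
have ms : has_mean P A (csigma c s) (mEx P A (csigma c s)) by [].
have ml : has_mean P A (L4 s) (mEx P A (L4 s)) by [].
have L1C (Y : R -> Omega -> 'cV[R]_n) : L2F_C P F T Y -> mL1 P (Y s).
  move=> LY i j; have [K K0 hK] := L2F_C_second_moment cP bm LY.
  by apply: L2_L1; exact: (hK s i j s0T).1.
have m4 : has_mean P A (P4 s) (mEx P A (P4 s)) by split => //; exact: L1C.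
have ce3 r (r0T : 0 <= r <= T) := (hEP3.1 r r0T).2 s s0T (L1C _ hP3).
have m3t : has_mean P A (EP3 t s) (mEx P A (P3 s)).
  by split; [case: (ce3 t t0T)|exact: (condexp_mEx cP bm (ce3 t t0T) FA)].
have m3s : has_mean P A (EP3 s s) (mEx P A (P3 s)).
  by split; [case: (ce3 s s0T)|exact: (condexp_mEx cP bm (ce3 s s0T) FsA)].
have cecX := (hEcX.1 s s0T).2 s s0T (cal_state_mL1 s0T).
have mEcX : has_mean P A (EcX s s) (mEx P A (cX s)).
  by split; [case: cecX|exact: (condexp_mEx cP bm cecX FsA)].
have [_ ->] : has_mean P A (f s) ((sB c s)^T *m (Y0 s *m (gamma1 c *: mEx P A (cX t))
    + (P1 s *m mEx P A (cX s) + P2 s *m mEx P A (cX s) + mEx P A (P3 s) + mEx P A (P4 s)))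
  + (sD c s)^T *m (P1 s *m (cC c s *m mEx P A (cX s) + cCt c s *m mEx P A (cX s)
      + cD c s *m mEx P A (u s) + cDt c s *m mEx P A (u s) + mEx P A (csigma c s)) + mEx P A (L4 s))).
  rewrite /bold_Y /bold_Z.
  by repeat first [assumption | apply: (has_meanD mA) | apply: (has_meanM mA) | apply: (has_meanZ mA)].
have [_ ->] : has_mean P A (g s) ((sB c s)^T *m (Y0 s *m (gamma1 c *: mEx P A (cX s))
    + (P1 s *m mEx P A (cX s) + P2 s *m mEx P A (cX s) + mEx P A (P3 s) + mEx P A (P4 s)))
  + (sD c s)^T *m (P1 s *m (sC c s *m mEx P A (cX s) + sD c s *m mEx P A (u s)
      + mEx P A (csigma c s)) + mEx P A (L4 s))).
  rewrite /cal_M /cal_N.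
  by repeat first [assumption | apply: (has_meanD mA) | apply: (has_meanM mA) | apply: (has_meanZ mA)].
exact: adjoint_cancellation.
Qed.

Lemma mx_coef_terminal : mx_coef `[0, T] M.
Proof. by apply: mx_coefZ => //; apply: mx_coefM => //; apply: mx_coefT; exact: mx_coef_sB. Qed.

Lemma ae_mean_lhs_sub_rhs A : F t A -> \forall s \ae mu, t <= s <= T ->
  mEx P A (f s) - mEx P A (g s) = M s *m (mEx P A (cX t) - mEx P A (cX s)).
Proof.
move=> FA; have /andP[t0 tT'] := tT.
have [_ _ _ _ [_ hs]] := h1.
have u1 := mjint_ae_mL1 mT (L2F_mjint uL2).
have s1 := mjint_ae_mL1 mT (L2F_mjint hs).
have l1 := mjint_ae_mL1 mT (L2F_mjint hL4).
apply: filterS3 u1 s1 l1 => s u1 s1 l1 /[dup] sT /andP[ts sT'].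
have Ds : `[0, T]%classic s by rewrite /= in_itv/= sT' (le_trans t0).
exact: (mean_lhs_sub_rhs FA sT (u1 Ds) (s1 Ds) (l1 Ds)).
Qed.

End quotient.

End state_comparison.

(** * The difference quotient *)

Section conditional_quotient.
Context {d : measure_display} {Omega : measurableType d} {R : realType}.
Variables (P : probability Omega R) (W : R -> Omega -> R) (T t : R) (n m : nat).
Local Notation F := (augmented_filtration P W).
Local Notation mu := (@lebesgue_measure R).
Hypothesis cP : measure_is_complete P.
Hypothesis bm : standard_brownian_motion P W.
Hypothesis tT : 0 <= t < T.
Variables (Y b z : R -> Omega -> 'cV[R]_n) (f g : R -> Omega -> 'cV[R]_m).
Variable M : R -> 'M[R]_(m, n).
Hypothesis dY : ito_differential P W T Y b z.
Hypothesis jb : mjint P `[0, T] b.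
Hypothesis Y1 : forall r, 0 <= r <= T -> mL1 P (Y r).
Hypothesis jf : mjint P `[0, T] f.
Hypothesis jg : mjint P `[0, T] g.
Hypothesis cM : mx_coef `[0, T] M.
Hypothesis fgE : forall A, F t A -> \forall s \ae mu, t <= s <= T ->
  mEx P A (f s) - mEx P A (g s) = M s *m (mEx P A (Y t) - mEx P A (Y s)).

Let mT : measurable `[0, T]. Proof. exact: measurable_itv. Qed.

Variables lhs rhs : R -> Omega -> 'cV[R]_m.
Hypothesis hl : condexp_integral P F T t f lhs.
Hypothesis hr : condexp_integral P F T t g rhs.

(* Integrating the drift of Y from t to s bounds the mean of M(s) (Y t - Y s),
   so the difference of the two integrals is of size e times a vanishing mean. *)
Lemma mean_quotient :
  exists Z : R -> Omega -> R, [/\ jint P `[0, T] Z, forall r w, 0 <= Z r w &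
    forall e h A i, 0 < e -> e <= h -> h <= T - t -> F t A ->
    `|Ex P (fun w => \1_A w * (lhs e w i 0 - rhs e w i 0))| <=
    e * Ex P (fun w => \1_A w * Rintegral mu `[t, t + h] (Z ^~ w))].
Proof.
have /andP[t0 tT'] := tT.
have [K K0 MK] := mx_coef_bound cM.
(* [K] bounds the entries of [M], so [Z r] dominates every entry of M(s) b(r), whatever s. *)
pose Z r w := K * \sum_(j < n) `|b r w j 0|.
have jZ : jint P `[0, T] Z.
  apply: (jint_coef mT (ae_bounded_cst K mT)); apply: (jint_sum _ mT) => j.
  exact: (jint_abs mT (jb j 0)).
have Z0 r w : 0 <= Z r w by rewrite mulr_ge0// sumr_ge0.
exists Z; split => // e h A i e0 eh hT FA.
have mA := augmented_filtration_measurable cP bm FA.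
have e0T : 0 < e <= T - t by rewrite e0 (le_trans eh).
have ehT : t + e <= T by rewrite -lerBrDl (le_trans eh).
have mte : measurable `[t, t + e] by exact: measurable_itv.
have mth : measurable `[t, t + h] by exact: measurable_itv.
have sub0 a : a <= T -> `[t, a]%classic `<=` `[0, T]%classic.
  by move=> aT r /=; rewrite !in_itv/= => /andP[tr ra]; rewrite (le_trans t0)// (le_trans ra).
have [f1 fi fE] := mjint_fubini mte mA (mjintS mT mte (sub0 _ ehT) jf).
have [g1 gi gE] := mjint_fubini mte mA (mjintS mT mte (sub0 _ ehT) jg).
have htT : t + h <= T by rewrite -lerBrDl.
have jZh := jintS mT mth (sub0 _ htT) jZ.
have jZA := jint_indic mth mA jZh.
have [_ Zi ZE] := jint_fubini mth jZA.
have L0 r : 0 <= Ex P (fun w => \1_A w * Z r w).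
  by apply: Rintegral_ge0 => w _; rewrite mulr_ge0// indicE; case: (_ \in _).
have -> : Ex P (fun w => \1_A w * (lhs e w i 0 - rhs e w i 0)) =
    mx_integral `[t, t + e] (fun s => mEx P A (f s) - mEx P A (g s)) i 0.
  have cl := hl.1 e e0T; have cr := hr.1 e e0T.
  rewrite (mx_integralB mte fi gi) -fE -gE -(condexp_mEx cP bm cl FA) -(condexp_mEx cP bm cr FA).
  have [_ l1 _ _] := cl; have [_ r1 _ _] := cr.
  rewrite -(mExB mA l1 r1) [in RHS]mxE.
  by congr Ex; apply/funext => w; rewrite !mxE.
have -> : Ex P (fun w => \1_A w * Rintegral mu `[t, t + h] (Z ^~ w)) =
    Rintegral mu `[t, t + h] (fun r => Ex P (fun w => \1_A w * Z r w)).
  rewrite -ZE; congr Ex; apply/funext => w; rewrite indicE; case: (_ \in _).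
    by rewrite mul1r; apply: eq_Rintegral => s _; rewrite mul1r.
  by rewrite mul0r /Rintegral integral0_eq// => s _; rewrite mul0r.
set J := Rintegral mu `[t, t + h] _.
have J0 : 0 <= J by exact: Rintegral_ge0.
have -> : e * J = (t + e - t) * J by rewrite addrAC subrr add0r.
rewrite mxE; apply: Rintegral_ae_bound => //.
- by rewrite lerDl ltW.
- by have := mx_integrableB mte fi gi i 0.
have b1 := mjint_ae_mL1 mT jb.
apply: filterS2 (fgE FA) MK => s fgs Ms /andP[ts se].
have sT : t <= s <= T by rewrite ts (le_trans se).
have Ds : `[0, T]%classic s by apply: (sub0 T) => //=; rewrite in_itv.
(* The sign is turned so that the increment of Y from t to s appears, which [sde_mEx] expresses
   through the drift. *)
rewrite (fgs sT) -opprB mulmxN.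
have t0s : 0 <= t <= s by rewrite t0.
have sT' : s <= T by case/andP: sT.
have mts : measurable `[t, s] by exact: measurable_itv.
have [_ bi _] := mjint_fubini mts mA (mjintS mT mts (sub0 _ sT') jb).
rewrite (sde_mEx cP bm dY jb Y1 t0s sT' FA) addrAC subrr add0r.
rewrite -(mx_integralM _ mts bi) mxE normrN mxE.
(* Enlarging [t, s] to [t, t + h], which the nonnegativity of Z permits, makes the bound independent
   of s and e. *)
apply: (Rintegral_le_ae mts mth) => //.
- by move=> r /=; rewrite !in_itv/= => /andP[-> rs]; rewrite (le_trans rs)// (le_trans se)// lerD2l //.
- by have := mx_integrableM (M s) mts bi i 0.
apply: filterS b1 => r b1 Dr.
have b1r := b1 (sub0 _ sT' _ Dr).
rewrite mxE (le_trans (ler_norm_sum _ _ _))//.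
have -> : Ex P (fun w => \1_A w * Z r w) = \sum_(j < n) K * Ex P (fun w => \1_A w * `|b r w j 0|).
  have jA j : L1 P (fun w => \1_A w * `|b r w j 0|).
    by apply: L1_indicM => //; exact: integrable_norm (b1r j 0).
  rewrite -mulr_sumr -Ex_sum// -ExZ; last exact: L1_sum.
  by congr Ex; apply/funext => w; rewrite mulrCA mulr_sumr.
apply: ler_sum => j _; rewrite normrM ler_pM//; first exact: Ms Ds i j.
exact: mEx_le.
Qed.

(** [vanishing_quotient] entry by entry, with K_h the integral of Z over [t, t + h]. By Fubini
    E[K_h] is the integral of the integrable function E[Z] over a shrinking interval, hence as small
    as desired. *)
Lemma ae_small_difference : \forall w \ae P, forall i x, 0 < x ->
  exists2 h, 0 < h & forall e, 0 < e < h -> `|(lhs e w - rhs e w) i 0| <= x * e.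
Proof.
have [Z [jZ Z0 HZ]] := mean_quotient.
have /andP[t0 tT'] := tT; have h00 : 0 < T - t by rewrite subr_gt0.
have mtT : measurable `[t, T] by exact: measurable_itv.
have sub0 a : a <= T -> `[t, a]%classic `<=` `[0, T]%classic.
  by move=> aT r /=; rewrite !in_itv/= => /andP[tr ra]; rewrite (le_trans t0)// (le_trans ra).
have jZh h : 0 < h <= T - t -> jint P `[t, t + h] Z.
  move=> /andP[_ hT]; apply: (jintS mT _ _ jZ); first exact: measurable_itv.
  by apply: sub0; rewrite -lerBrDl.
apply: filter_forall => i.
pose delta e w := lhs e w i 0 - rhs e w i 0.
have : \forall w \ae P, forall x, 0 < x -> exists2 h, 0 < h &
    forall e, 0 < e < h -> `|delta e w| <= x * e.
  apply: (vanishing_quotient cP bm (t := t) (K := fun h w => Rintegral mu `[t, t + h] (Z ^~ w)) h00).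
  - move=> e eT; have [_ _ ml _] := hl.1 e eT; have [_ _ mr _] := hr.1 e eT.
    exact: measurable_wrtB.
  - by move=> e eT; have [_ l1 _ _] := hl.1 e eT; have [_ r1 _ _] := hr.1 e eT; exact: (L1B (l1 i 0) (r1 i 0)).
  - move=> h hT; have [h1 _ _] := jint_fubini (measurable_itv _) (jZh h hT); exact: h1.
  - by move=> h w; exact: Rintegral_ge0.
  - by move=> e h A e0 eh hT FA; exact: HZ.
  - move=> x x0.
    have [_ Zi _] := jint_fubini mtT (jintS mT mtT (sub0 _ (lexx _)) jZ).
    have [h hT hx] := Rintegral_small tT' x0 Zi.
    exists h => //; have [_ _ ->] := jint_fubini (measurable_itv _) (jZh h hT).
    exact: le_lt_trans (ler_norm _) hx.
  - apply: filterS2 hl.2 hr.2 => w cl cr e.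
    have co (V : R -> Omega -> 'cV[R]_m) : {within `]0, T - t], continuous (V ^~ w)} ->
        {within `]0, T - t], continuous (fun e => V e w i 0)}.
      by move=> cV y; exact: (@cvg_comp _ _ _ _ (fun N : 'cV[R]_m => N i 0) _ _ _ (cV y) (@coord_continuous _ _ _ i 0 _)).
    by apply: (@cvgB _ R^o); [exact: (co lhs cl e)|exact: (co rhs cr e)].
by apply: filterS => w h x x0; have [r r0 hr'] := h x x0; exists r => // e er; rewrite !mxE; exact: hr'.
Qed.

End conditional_quotient.

(** The scaled difference tends to 0, so convergence to l passes from one side to the other; the
    hypothesis is symmetric in a and b, which reduces the equivalence to one implication. *)
Lemma cvg_quotient_iff (R : realType) (m : nat) (a b : R -> 'cV[R]_m) (l : 'cV[R]_m) :
  (forall i x, 0 < x -> exists2 h, 0 < h & forall e, 0 < e < h -> `|(a e - b e) i 0| <= x * e) ->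
  e^-1 *: a e @[e --> 0^'+] --> l <-> e^-1 *: b e @[e --> 0^'+] --> l.
Proof.
have key (a' b' : R -> 'cV[R]_m) :
    (forall i x, 0 < x -> exists2 h, 0 < h & forall e, 0 < e < h -> `|(a' e - b' e) i 0| <= x * e) ->
    e^-1 *: a' e @[e --> 0^'+] --> l -> e^-1 *: b' e @[e --> 0^'+] --> l.
  move=> ab al.
  have d0 : (e^-1 *: (a' e - b' e)) @[e --> 0^'+] --> (0 : 'cV[R]_m).
    apply/cvgr0Pnorm_le => x x0.
    have : \forall e \near 0^'+, forall i, `|(a' e - b' e) i 0| <= x * e.
      apply: filter_forall => i; have [h h0 hab] := ab i x x0.
      near=> e; apply: hab; apply/andP; split; near: e.
        exact: nbhs_right_gt.
      exact: nbhs_right_lt.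
    apply: filterS2 (nbhs_right_gt (0 : R)) => e e0 he.
    rewrite [leLHS]/Num.norm/= mx_normrE; apply/bigmax_leP; split; first exact: ltW.
    move=> [i j] _ /=; rewrite mxE normrM (ord1 j) normfV (gtr0_norm e0).
    by rewrite ler_pdivrMl// mulrC.
  rewrite (_ : (fun e => e^-1 *: b' e) = (fun e => e^-1 *: a' e) - (fun e => e^-1 *: (a' e - b' e))).
    by rewrite -[l]subr0; exact: cvgB.
  by apply/funext => e; rewrite !fctE scalerBr subKr.
move=> ab; split; apply: key => // i x x0; have [h h0 hab] := ab i x x0; exists h => // e eh.
by rewrite -opprB mxE normrN; exact: hab.
Unshelve. all: by end_near. Qed.

Theorem lemma3p4 (R : realType) (d : measure_display) (Omega : measurableType d)
  (P : probability Omega R) (W : R -> Omega -> R) (T : R) (n m : nat)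
  (c : lq_data Omega R n m) (x : 'cV[R]_n) (u : R -> Omega -> 'cV[R]_m)
  (cX : R -> Omega -> 'cV[R]_n) (EcX : R -> R -> Omega -> 'cV[R]_n)
  (P1 P2 : R -> 'M[R]_n)
  (P3 L3 : R -> Omega -> 'cV[R]_n) (EP3 : R -> R -> Omega -> 'cV[R]_n)
  (P4 L4 : R -> Omega -> 'cV[R]_n) (Y0 : R -> 'M[R]_n) :
  let F := augmented_filtration P W in
  0 < T ->
  measure_is_complete P ->
  standard_brownian_motion P W ->
  H1 P F T c ->
  L2F P F T u ->
  is_cal_state P W T c x u cX -> condexp_field P F T cX EcX ->
  is_P1 T c P1 ->
  is_P2 T c P1 P2 ->
  is_P4 P W T c u P1 P4 L4 ->
  is_P3 P W T c u P1 P2 P4 L4 P3 L3 -> condexp_field P F T P3 EP3 ->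
  is_Y0 T c Y0 ->
  forall (t : R), 0 <= t < T ->
  forall (X EX : R -> Omega -> 'cV[R]_n) (Eu : R -> Omega -> 'cV[R]_m),
  condexp_process P F T t u Eu ->
  condexp_process P F T t X EX ->
  is_state P W T c x u Eu X EX ->
  forall lhs rhs : R -> Omega -> 'cV[R]_m,
  condexp_integral P F T t
    (fun s w =>
       (sB c s)^T *m (Y0 s *m (gamma1 c *: X t w)
                      + bold_Y P1 P2 EP3 P4 X EX s t w)
       + (sD c s)^T *m bold_Z c P1 L4 u Eu X EX s w) lhs ->
  condexp_integral P F T t
    (fun s w =>
       (sB c s)^T *m (Y0 s *m (gamma1 c *: cX s w)
                      + cal_M P1 P2 EP3 P4 cX EcX s s w)
       + (sD c s)^T *m cal_N c P1 L4 u cX s w) rhs ->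
  \forall w \ae P, forall l : 'cV[R]_m,
    e^-1 *: lhs e w @[e --> 0^'+] --> l <-> e^-1 *: rhs e w @[e --> 0^'+] --> l.
Proof.
move=> F T0 cP bm h1 uL2 hcX hEcX hP1 hP2 [hP4 hL4 _ _] [hP3 _ _ _] hEP3 hY0 t tT X EX Eu hEu hEX hX lhs rhs hl hr.
have T0' := ltW T0.
have [[cP1 _ _] _] := hP1; have [[cP2 _ _] _] := hP2; have [[cY0 _ _] _] := hY0.
have kP1 := continuous_mx_coef T0' cP1; have kP2 := continuous_mx_coef T0' cP2.
have kY0 := continuous_mx_coef T0' cY0.
have [_ _ dcX] := hcX.
have := ae_small_difference cP bm tT dcX (mjint_cal_drift cP bm h1 uL2 hcX)
  (cal_state_mL1 cP bm hcX)
  (mjint_lhs cP bm h1 uL2 tT hEu hEX hX hEP3 kP1 kP2 kY0 hP3 hP4 hL4)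
  (mjint_rhs cP bm h1 uL2 hcX hEcX hEP3 kP1 kP2 kY0 hP3 hP4 hL4)
  (mx_coef_terminal h1 kY0)
  (fun A => ae_mean_lhs_sub_rhs T0 cP bm h1 uL2 hcX tT hEu hEX hX P1 P2 Y0 hEcX hEP3 hP3 hP4 hL4 (A := A))
  hl hr.
by apply: filterS => w h l; exact: cvg_quotient_iff.
Qed.
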